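(* Let $M$ be a compact Riemannian manifold. Let $S$ be a compact, orientable surface of negative Euler characteristic, possibly with boundary, let $\phi\in\operatorname{Homeo}(S)$ be a (possibly orientation reversing) homeomorphism, and let $T=T_\phi$ be the mapping torus of $\phi$. If $\phi$ induces a hyperbolic automorphism $\phi^*$ of $H^1(S,\mathbb{R})$, then there exists a neighborhood $\mathcal{U}$ of the trivial representation in $\operatorname{Hom}(\pi_1(T),\operatorname{Diff}^1(M))$ such that $\rho(\pi_1(S))=\{1\}$ for all representations $\rho\in\mathcal{U}$.
   Context: Surfaces are connected. The group $\pi_1(T)$ fits into a short exact sequence $1\to\pi_1(S)\to\pi_1(T)\to\mathbb{Z}\to1$, where $\pi_1(S)$ is the fundamental group of the fiber and $\mathbb{Z}$ acts by conjugation on $\pi_1(S)$ via the action induced by $\phi$; $\pi_1(S)$ is regarded as a subgroup of $\pi_1(T)$ in this way. A linear automorphism of a finite-dimensional real vector space $V$ is called hyperbolic if $V\neq0$ and every (complex) eigenvalue has modulus different from one. $\operatorname{Diff}^1(M)$ is the group of $C^1$-diffeomorphisms of $M$. Fix a $C^1$ embedding $M\subset\mathbb{R}^N$ for some $N$. Norms $\|\cdot\|$ are $\ell^\infty$ norms (the maximum of absolute values of coordinates/entries for vectors and matrices; the supremum for functions). The $C^1$-metric on $\operatorname{Diff}^1(M)$ is $d(f,g)=\|f-g\|+\sup_{x\in M}\|D_xf-D_xg\|$, computed in the ambient Euclidean space. For a group $G$ generated by a finite set $\Sigma$, the $C^1$-topology on $\operatorname{Hom}(G,\operatorname{Diff}^1(M))$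 is the one given by the metric $d_\Sigma(\rho,\rho')=\max_{s\in\Sigma}d(\rho(s),\rho'(s))$; it does not depend on $\Sigma$. The trivial representation sends every element of $G$ to the identity map $1$ of $M$. *)

(* Defs.v *)
From HB Require Import structures.
From mathcomp Require Import all_boot all_order all_algebra generic_quotient ring_quotient.
From mathcomp Require Import lra.
From mathcomp Require Import all_classical all_reals all_analysis homotopy.
From mathcomp.real_closed Require Import complex.
From mathcomp.multinomials Require Import freeg.
Set Implicit Arguments.
Unset Strict Implicit.
Unset Printing Implicit Defensive.

Import Order.TTheory GRing.Theory Num.Theory.
Import numFieldNormedType.Exports.

Local Open Scope classical_set_scope.
Local Open Scope ring_scope.
Local Open Scope quotient_scope.

Lemma cvg_mx (R : realType) (T : Type) (F : set_system T) m n
    (f : T -> 'M[R]_(m, n)) (A : 'M[R]_(m, n)) : Filter F ->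
  (forall i j, (fun t => f t i j) @ F --> A i j) -> f @ F --> A.
Proof.
move=> FF fA P [B nB BP].
have : \forall u \near F, forall i j, B i j (f u i j).
  by apply: filter_forall => i; apply: filter_forall => j; exact/fA/nB.
by apply: filterS => u fu; exact: BP.
Qed.

Lemma continuous_mx (R : realType) (T : topologicalType) m n
    (f : T -> 'M[R]_(m, n)) :
  (forall i j, continuous (fun t => f t i j)) -> continuous f.
Proof. by move=> cf t; apply: cvg_mx => i j; exact: cf. Qed.

Lemma cvg_sum_ord (R : realType) n (T : Type) (H : set_system T) (f : 'I_n -> T -> R) (a : 'I_n -> R) :
  Filter H -> (forall i, f i @ H --> a i) ->
  (fun t => \sum_i f i t) @ H --> \sum_i a i.
Proof.
move=> FH; elim: n f a => [|n IH] f a fa.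
  rewrite big_ord0 (_ : (fun t => _) = cst 0); first exact: cvg_cst.
  by apply/funext => t; rewrite big_ord0.
rewrite big_ord_recl (_ : (fun t => _) =
  f ord0 \+ (fun t => \sum_(i < n) f (fintype.lift ord0 i) t)); last first.
  by apply/funext => t; rewrite big_ord_recl.
by apply: cvgD; [exact: fa|apply: IH => i; exact: fa].
Qed.

Lemma mulmx_continuous_at (R : realType) (T : topologicalType) m n p
    (A : T -> 'M[R]_(m, n)) (B : T -> 'M[R]_(n, p)) (t : T) :
  {for t, continuous A} -> {for t, continuous B} ->
  {for t, continuous (fun u => A u *m B u)}.
Proof.
move=> cA cB; apply: cvg_mx => i j; rewrite mxE.
rewrite (_ : (fun u => _) = (fun u => \sum_k A u i k * B u k j)); last first.
  by apply/funext => u; rewrite mxE.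
apply: cvg_sum_ord => k; apply: cvgM.
  by apply: (cvg_comp _ (fun A : 'M[R]_(m, n) => A i k) cA); exact: coord_continuous.
by apply: (cvg_comp _ (fun A : 'M[R]_(n, p) => A k j) cB); exact: coord_continuous.
Qed.

Lemma near_eq_continuous_at (T U : topologicalType) (f g : T -> U) (t : T) :
  (\forall u \near t, f u = g u) -> f t = g t ->
  {for t, continuous f} -> {for t, continuous g}.
Proof.
move=> fg fgt; rewrite /prop_for /continuous_at fgt; apply: cvg_trans.
by apply: near_eq_cvg; move: fg; apply: filterS.
Qed.

Section C1.
Variables (R : realType) (N : nat).

Definition C1_on (U : set 'rV[R]_N) (F : 'rV[R]_N -> 'rV[R]_N) : Prop :=
  forall x, U x -> differentiable F x /\ {for x, continuous (jacobian F)}.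

Implicit Types (U V : set 'rV[R]_N) (F G : 'rV[R]_N -> 'rV[R]_N).

Lemma C1_on_id U : C1_on U id.
Proof.
move=> x _; have di y : differentiable (@id 'rV[R]_N) y by apply: ex_diff; exact: is_diff_id.
split=> //.
rewrite (_ : jacobian _ = cst 1%:M); first exact: cst_continuous.
apply/funext => z; apply/row_matrixP => i.
by rewrite !rowE -deriveEjacobian// mulmx1 derive_id.
Qed.

Lemma mul_jacobian F x (v : 'rV[R]_N) : v *m jacobian F x = 'd F x v.
Proof. by rewrite /jacobian mul_rV_lin1. Qed.

Lemma C1_on_comp U V F G : open U -> open V -> C1_on U G -> C1_on V F ->
  open (U `&` G @^-1` V) /\ C1_on (U `&` G @^-1` V) (F \o G).
Proof.
move=> oU oV CG CF.
have cG y : U y -> {for y, continuous G}.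
  by move=> /CG[dG _]; exact: differentiable_continuous.
have nUV y : U y -> V (G y) -> nbhs y (U `&` G @^-1` V).
  move=> Uy VGy; apply: filterI; first exact: open_nbhs_nbhs.
  by apply: (cG _ Uy); exact: open_nbhs_nbhs.
split; first by rewrite openE => y [Uy VGy]; exact: nUV.
move=> y [Uy VGy]; have [dG cJG] := CG _ Uy; have [dF cJF] := CF _ VGy.
split; first exact: differentiable_comp.
have JE z : U z -> V (G z) ->
    jacobian (F \o G) z = jacobian G z *m jacobian F (G z).
  move=> Uz VGz; have [dGz _] := CG _ Uz; have [dFz _] := CF _ VGz.
  apply/row_matrixP => i; rewrite 2!rowE mulmxA.
  transitivity ('d (F \o G) z (delta_mx 0 i)); first exact: mul_jacobian.
  rewrite (diff_comp dGz dFz).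
  transitivity ('d F (G z) (delta_mx 0 i *m jacobian G z)); last first.
    exact/esym/mul_jacobian.
  exact/esym/(congr1 ('d F (G z)))/mul_jacobian.
apply: (@near_eq_continuous_at _ _ (fun z => jacobian G z *m jacobian F (G z))).
- by move: (nUV _ Uy VGy); apply: filterS => z [Uz VGz]; rewrite JE.
- by rewrite JE.
- apply: (@mulmx_continuous_at R _ N N N (jacobian G)
    (fun z => jacobian F (G z)) y cJG).
  exact: (@continuous_comp _ _ _ G (jacobian F) y (cG _ Uy) cJF).
Qed.
End C1.

Definition unit_interval (R : realType) : Type := `[0%R : R, 1]%classic.

Section unit_interval.
Variable R : realType.
Local Notation I := (unit_interval R).

HB.instance Definition _ := Topological.on I.

Lemma clamp_subproof (t : R) : Num.max 0 (Num.min 1 t) \in `[0%R : R, 1]%classic.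
Proof.
apply/mem_set; rewrite /= in_itv /= le_max lexx /= ge_max ler01 /=.
by rewrite ge_min lexx.
Qed.

Definition clamp (t : R) : I := exist _ (Num.max 0 (Num.min 1 t)) (clamp_subproof t).

Definition ival (t : I) : R := val t.

Lemma ival_ge0 (t : I) : 0 <= ival t.
Proof. by case: t => t p; have := set_mem p; rewrite /= in_itv /= => /andP[]. Qed.

Lemma ival_le1 (t : I) : ival t <= 1.
Proof. by case: t => t p; have := set_mem p; rewrite /= in_itv /= => /andP[]. Qed.

Lemma ival_inj : injective ival.
Proof. exact: val_inj. Qed.

Lemma clampK (t : R) : 0 <= t <= 1 -> ival (clamp t) = t.
Proof. by case/andP=> t0 t1; rewrite /ival /= (min_idPr t1) (max_idPr t0). Qed.

Lemma ivalK (t : I) : clamp (ival t) = t.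
Proof. by apply: ival_inj; rewrite clampK // ival_ge0 ival_le1. Qed.

Lemma ival_continuous : continuous ival.
Proof. exact: initial_continuous. Qed.

Lemma clamp_continuous : continuous clamp.
Proof.
apply: continuous_comp_initial => t.
rewrite (_ : _ \o _ = (fun=> 0) \max ((fun=> 1) \min id)) //.
apply: (@continuous_max _ _ (fun=> 0)); first exact: cst_continuous.
by apply: (@continuous_min _ _ (fun=> 1)); first exact: cst_continuous.
Qed.

Lemma clamp01_neq : clamp 0 != clamp 1.
Proof.
apply/eqP => /(congr1 ival); rewrite !clampK ?lexx ?ler01 //.
by move/eqP; rewrite eq_sym oner_eq0.
Qed.
HB.instance Definition _ := isBiPointed.Build I clamp01_neq.
End unit_interval.

Section continuity.
Variables (X Y Z : topologicalType).

Lemma continuous_compE (f : X -> Y) (g : Y -> Z) :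
  continuous f -> continuous g -> continuous (fun x => g (f x)).
Proof. by move=> cf cg x; exact: (@continuous_comp _ _ _ f g x (cf x) (cg (f x))). Qed.

Lemma continuous_pairE (f : X -> Y) (g : X -> Z) :
  continuous f -> continuous g -> continuous (fun x => (f x, g x)).
Proof. by move=> cf cg x; apply: cvg_pair; [exact: cf|exact: cg]. Qed.

Lemma continuous_fstE : continuous (@fst X Y).
Proof. by move=> x; exact: cvg_fst. Qed.

Lemma continuous_sndE : continuous (@snd X Y).
Proof. by move=> x; exact: cvg_snd. Qed.

Variable R : realType.

Lemma continuous_affine (f : X -> R) (a b : R) :
  continuous f -> continuous (fun x => a * f x + b).
Proof.
move=> cf x; apply: cvgD; last exact: cvg_cst.
by apply: cvgM; [exact: cvg_cst|exact: cf].
Qed.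
End continuity.
Arguments continuous_compE {X Y Z f g} _ _ x t _.
Arguments continuous_pairE {X Y Z f g} _ _ x t _.
Arguments continuous_fstE {X Y} x t _.
Arguments continuous_sndE {X Y} x t _.
Arguments continuous_affine {X R f} a b _ x t _.
Arguments ival_continuous {R} x t _.
Arguments clamp_continuous {R} x t _.

Section clamp_continuity.
Context (R : realType) (Y : topologicalType) (f : Y -> R) (cf : continuous f).

Lemma continuous_clamp_affine (a b : R) :
  continuous (fun y => clamp (a * f y + b)).
Proof.
exact: (continuous_compE (continuous_affine a b (@cf)) clamp_continuous).
Qed.

Lemma continuous_clamp_lin (a : R) : continuous (fun y => clamp (a * f y)).
Proof.
rewrite (_ : (fun y => _) = (fun y => clamp (a * f y + 0))).
  exact: continuous_clamp_affine.
by apply/funext => y; rewrite addr0.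
Qed.

Lemma continuous_clamp_rev : continuous (fun y => clamp (1 - f y)).
Proof.
rewrite (_ : (fun y => _) = (fun y => clamp (- 1 * f y + 1))).
  exact: continuous_clamp_affine.
by apply/funext => y; rewrite mulN1r addrC.
Qed.
End clamp_continuity.
Arguments continuous_clamp_affine {R Y f} _ a b x t _.
Arguments continuous_clamp_lin {R Y f} _ a x t _.
Arguments continuous_clamp_rev {R Y f} _ x t _.

Lemma ival0 (R : realType) : ival (zero : unit_interval R) = 0.
Proof. by rewrite /zero /= clampK ?lexx ?ler01. Qed.

Lemma ival1 (R : realType) : ival (one : unit_interval R) = 1.
Proof. by rewrite /one /= clampK ?lexx ?ler01. Qed.

Section glue.
Variables (R : realType) (Y X : topologicalType).

Lemma glue_continuous (a : Y -> R) (c : R) (f g : Y -> X) :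
  continuous a -> continuous f -> continuous g ->
  (forall y, a y = c -> f y = g y) ->
  continuous (fun y => if a y <= c then f y else g y).
Proof.
move=> ca cf cg fg; set h := fun y => _.
have cA : closed [set y | a y <= c].
  by apply: closed_comp (@closed_le R c) => // y _; exact: ca.
have cB : closed [set y | c <= a y].
  by apply: closed_comp (@closed_ge R c) => // y _; exact: ca.
have hA : {within [set y | a y <= c], continuous h}.
  apply: (@subspace_eq_continuous _ _ _ f); last exact: continuous_subspaceT.
  by move=> y /set_mem /= ay; rewrite /from_subspace /h ay.
have hB : {within [set y | c <= a y], continuous h}.
  apply: (@subspace_eq_continuous _ _ _ g); last exact: continuous_subspaceT.
  move=> y /set_mem /= ay; rewrite /from_subspace /h; case: ifPn => // ya.
  by rewrite fg //; apply/le_anti; rewrite ya ay.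
have := withinU_continuous cA cB hA hB.
rewrite (_ : _ `|` _ = setT); first by rewrite -continuous_subspace_setT.
by apply/seteqP; split=> // y _; case: (leP (a y) c) => [|/ltW]; [left|right].
Qed.
End glue.

Section fundamental_group.
Variable R : realType.
Local Notation I := (unit_interval R).

Section concat.
Variables (X : topologicalType) (x y z : X).
Variables (p : {path I from x to y}) (q : {path I from y to z}).

Definition concat_fun (t : I) : X :=
  if ival t <= 2^-1 then p (clamp (2 * ival t)) else q (clamp (2 * ival t - 1)).

Lemma concat_continuous : continuous concat_fun.
Proof.
apply: glue_continuous.
- exact: ival_continuous.
- exact: (continuous_compE (continuous_clamp_lin ival_continuous _)
    (@cts_fun _ _ p)).
- exact: (continuous_compE (continuous_clamp_affine ival_continuous _ _)
    (@cts_fun _ _ q)).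
- move=> t ->; rewrite divff ?pnatr_eq0// subrr.
  by rewrite [RHS]path_zero [LHS]path_one.
Qed.

Lemma concat_zero : concat_fun zero = x.
Proof.
rewrite /concat_fun /zero /= clampK ?lexx ?ler01 //.
by rewrite invr_ge0 ler0n mulr0 [LHS]path_zero.
Qed.

Lemma concat_one : concat_fun one = z.
Proof.
rewrite /concat_fun /one /= clampK ?lexx ?ler01 //.
rewrite leNgt (_ : 2^-1 < 1) /=; last by lra.
by rewrite (_ : 2 * 1 - 1 = 1 :> R); [rewrite [LHS]path_one|lra].
Qed.

Definition concat : {path I from x to z} :=
  @mk_path I X x z concat_fun concat_continuous concat_zero concat_one.
End concat.

Section reverse.
Variables (X : topologicalType) (x y : X) (p : {path I from x to y}).

Definition reverse_fun (t : I) : X := p (clamp (1 - ival t)).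

Lemma reverse_continuous : continuous reverse_fun.
Proof.
exact: (continuous_compE (continuous_clamp_rev ival_continuous)
  (@cts_fun _ _ p)).
Qed.

Lemma reverse_zero : reverse_fun zero = y.
Proof.
by rewrite /reverse_fun /zero /= clampK ?lexx ?ler01 // subr0 [LHS]path_one.
Qed.

Lemma reverse_one : reverse_fun one = x.
Proof.
by rewrite /reverse_fun /one /= clampK ?lexx ?ler01 // subrr [LHS]path_zero.
Qed.

Definition reverse : {path I from y to x} :=
  @mk_path I X y x reverse_fun reverse_continuous reverse_zero reverse_one.
End reverse.

Section homotopy.
Variables (X : topologicalType) (x y : X).
Implicit Types p q r : {path I from x to y}.

(* Homotopy relative to the endpoints; the first coordinate is the time of the
   homotopy. *)
Definition path_homotopic p q : Prop := exists H : I * I -> X,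
  [/\ continuous H,
      forall t, H (zero, t) = p t,
      forall t, H (one, t) = q t &
      forall s, H (s, zero) = x /\ H (s, one) = y].

Lemma path_homotopic_refl p : path_homotopic p p.
Proof.
exists (fun st => p st.2); split => //.
- exact: (continuous_compE continuous_sndE (@cts_fun _ _ p)).
- by move=> s; rewrite [p _]path_zero [p _]path_one.
Qed.

Lemma path_homotopic_sym p q : path_homotopic p q -> path_homotopic q p.
Proof.
case=> H [cH H0 H1 He]; exists (fun st => H (clamp (1 - ival st.1), st.2)).
split.
- apply: (continuous_compE _ cH).
  apply: (continuous_pairE _ continuous_sndE).
  exact: (continuous_clamp_rev
    (continuous_compE continuous_fstE ival_continuous)).
- by move=> t; rewrite /zero /= clampK ?lexx ?ler01 // subr0 H1.
- by move=> t; rewrite /one /= clampK ?lexx ?ler01 // subrr H0.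
- by move=> s; exact: He.
Qed.

Lemma path_homotopic_trans q p r :
  path_homotopic p q -> path_homotopic q r -> path_homotopic p r.
Proof.
case=> H [cH H0 H1 He] [K [cK K0 K1 Ke]].
exists (fun st => if ival st.1 <= 2^-1 then H (clamp (2 * ival st.1), st.2)
                  else K (clamp (2 * ival st.1 - 1), st.2)).
have cf : continuous (fun st : I * I => ival st.1).
  exact: (continuous_compE continuous_fstE ival_continuous).
split.
- apply: (@glue_continuous R _ X (fun st : I * I => ival st.1)) => //.
  + by apply: (continuous_compE _ cH); apply: (continuous_pairE _ continuous_sndE);
      exact: (continuous_clamp_lin cf 2).
  + by apply: (continuous_compE _ cK); apply: (continuous_pairE _ continuous_sndE);
      exact: (continuous_clamp_affine cf 2 (- 1)).
  + move=> [s t] /= ->; rewrite divff ?pnatr_eq0// subrr.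
    by rewrite [LHS]H1 [RHS]K0.
- move=> t; rewrite /zero /= clampK ?lexx ?ler01 //.
  by rewrite invr_ge0 ler0n mulr0 [LHS]H0.
- move=> t; rewrite /one /= clampK ?lexx ?ler01 //.
  rewrite leNgt (_ : 2^-1 < 1) /=; last by lra.
  by rewrite (_ : 2 * 1 - 1 = 1 :> R); [rewrite [LHS]K1|lra].
- by move=> s /=; case: ifP => _; [exact: He|exact: Ke].
Qed.

(* Two reparameterizations of a path with the same endpoints are homotopic. *)
Lemma reparam_homotopic (a b : X) (r : {path I from a to b}) (u v : I -> R) p q :
  continuous u -> continuous v ->
  u zero = v zero -> u one = v one ->
  (forall t, p t = r (clamp (u t))) -> (forall t, q t = r (clamp (v t))) ->
  path_homotopic p q.
Proof.
move=> cu cv uv0 uv1 pu qv.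
exists (fun st => r (clamp ((1 - ival st.1) * u st.2 + ival st.1 * v st.2))).
have c1 : continuous (fun st : I * I => ival st.1).
  exact: (continuous_compE continuous_fstE ival_continuous).
have cu2 : continuous (fun st : I * I => u st.2).
  exact: (continuous_compE continuous_sndE cu).
have cv2 : continuous (fun st : I * I => v st.2).
  exact: (continuous_compE continuous_sndE cv).
split.
- apply: (continuous_compE _ (@cts_fun _ _ r)).
  apply: (continuous_compE _ clamp_continuous) => st.
  apply: cvgD; apply: cvgM; [|exact: cu2|exact: c1|exact: cv2].
  by apply: cvgB; [exact: cvg_cst|exact: c1].
- by move=> t; rewrite pu /zero /= clampK ?lexx ?ler01 // subr0 mul1r mul0r addr0.
- by move=> t; rewrite qv /one /= clampK ?lexx ?ler01 // subrr mul1r mul0r add0r.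
- move=> s /=; rewrite uv0 uv1 -!mulrDl !subrK !mul1r -!qv.
  by rewrite [q _]path_zero [q _]path_one.
Qed.

End homotopy.

Lemma concat_homotopic (X : topologicalType) (x y z : X)
    (p p' : {path I from x to y}) (q q' : {path I from y to z}) :
  path_homotopic p p' -> path_homotopic q q' ->
  path_homotopic (concat p q) (concat p' q').
Proof.
case=> H [cH H0 H1 He] [K [cK K0 K1 Ke]].
exists (fun st => if ival st.2 <= 2^-1 then H (st.1, clamp (2 * ival st.2))
                  else K (st.1, clamp (2 * ival st.2 - 1))).
have cf : continuous (fun st : I * I => ival st.2).
  exact: (continuous_compE continuous_sndE ival_continuous).
split.
- apply: (@glue_continuous R _ X (fun st : I * I => ival st.2)) => //.
  + by apply: (continuous_compE _ cH); apply: (continuous_pairE continuous_fstE);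
      exact: (continuous_clamp_lin cf 2).
  + by apply: (continuous_compE _ cK); apply: (continuous_pairE continuous_fstE);
      exact: (continuous_clamp_affine cf 2 (- 1)).
  + move=> [s t] /= ->; rewrite divff ?pnatr_eq0// subrr.
    by rewrite [LHS](He s).2 [RHS](Ke s).1.
- by move=> t /=; rewrite H0 K0.
- by move=> t /=; rewrite H1 K1.
- move=> s; split => /=.
    rewrite /zero /= clampK ?lexx ?ler01 //.
    by rewrite invr_ge0 ler0n mulr0 [LHS](He s).1.
  rewrite /one /= clampK ?lexx ?ler01 //.
  rewrite leNgt (_ : 2^-1 < 1) /=; last by lra.
  by rewrite (_ : 2 * 1 - 1 = 1 :> R); [rewrite [LHS](Ke s).2|lra].
Qed.

Lemma reverse_homotopic (X : topologicalType) (x y : X)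
    (p p' : {path I from x to y}) :
  path_homotopic p p' -> path_homotopic (reverse p) (reverse p').
Proof.
case=> H [cH H0 H1 He]; exists (fun st => H (st.1, clamp (1 - ival st.2))).
split.
- apply: (continuous_compE _ cH).
  apply: (continuous_pairE continuous_fstE).
  exact: (continuous_clamp_rev
    (continuous_compE continuous_sndE ival_continuous)).
- by move=> t; rewrite [LHS]H0.
- by move=> t; rewrite [LHS]H1.
- move=> s /=; rewrite /zero /one /= !clampK ?lexx ?ler01 // subr0 subrr.
  by have [] := He s.
Qed.

Section pi1.
Variables (X : topologicalType) (x : X).
Local Notation loop := {path I from x to x}.

Definition loop_equiv (p q : loop) : bool := `[< path_homotopic p q >].

Lemma loop_equiv_class : equiv_class_of loop_equiv.
Proof.
split.
- by move=> p; apply/asboolP/path_homotopic_refl.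
- by move=> p q; apply/asboolP/asboolP => /path_homotopic_sym.
- by move=> q p r /asboolP pq /asboolP qr; apply/asboolP/(path_homotopic_trans pq).
Qed.

Canonical loop_equivRel := EquivRelPack loop_equiv_class.

Definition fundamental_group := {eq_quot loop_equivRel}.

HB.instance Definition _ := Choice.on fundamental_group.
HB.instance Definition _ := EqQuotient.on fundamental_group.

Definition homotopy_class (p : loop) : fundamental_group := \pi p.

Lemma homotopy_classP (p q : loop) :
  homotopy_class p = homotopy_class q <-> path_homotopic p q.
Proof.
split; first by move/eqmodP/asboolP.
by move=> pq; apply/eqmodP/asboolP.
Qed.

Lemma homotopy_class_repr (g : fundamental_group) : homotopy_class (repr g) = g.
Proof. exact: reprK. Qed.

Definition pi1_one : fundamental_group := homotopy_class (cst x : loop).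
Definition pi1_mul (g h : fundamental_group) : fundamental_group :=
  homotopy_class (concat (repr g) (repr h)).
Definition pi1_inv (g : fundamental_group) : fundamental_group :=
  homotopy_class (reverse (repr g)).

Lemma pi1_mulE (p q : loop) :
  pi1_mul (homotopy_class p) (homotopy_class q) = homotopy_class (concat p q).
Proof.
by apply/homotopy_classP/concat_homotopic; apply/homotopy_classP;
  rewrite homotopy_class_repr.
Qed.

Lemma pi1_invE (p : loop) :
  pi1_inv (homotopy_class p) = homotopy_class (reverse p).
Proof.
by apply/homotopy_classP/reverse_homotopic/homotopy_classP;
  rewrite homotopy_class_repr.
Qed.

Lemma concatA (p q r : loop) :
  path_homotopic (concat p (concat q r)) (concat (concat p q) r).
Proof.
pose u (t : I) : R :=
  Num.min (2 * ival t + 0) (Num.min (1 * ival t + 4^-1) (2^-1 * ival t + 2^-1)).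
apply/path_homotopic_sym.
apply: (@reparam_homotopic _ _ _ _ _ (concat p (concat q r)) u (@ival R)).
- move=> t; apply: (@continuous_min _ _ (fun t => 2 * ival t + 0)).
    exact: (continuous_affine _ _ ival_continuous).
  apply: (@continuous_min _ _ (fun t => 1 * ival t + 4^-1));
    exact: (continuous_affine _ _ ival_continuous).
- exact: ival_continuous.
- rewrite /u ival0 !mulr0 !add0r; apply/min_idPl.
  by rewrite le_min !invr_ge0 !ler0n.
- rewrite /u ival1 !mulr1 addr0.
  rewrite (_ : 2^-1 + 2^-1 = 1 :> R); last by lra.
  rewrite (min_r (y := 1)); last by lra.
  by rewrite min_r; lra.
- move=> t; have t0 := ival_ge0 t; have t1 := ival_le1 t.
  rewrite /= /mk_path /= /concat_fun /= /mk_path /concat_fun /u.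
  have [t2|t2] := leP (ival t) 2^-1.
    rewrite (clampK (t := 2 * ival t)); last by lra.
    have [t4|t4] := leP (2 * ival t) 2^-1.
      rewrite (min_l (y := Num.min _ _)); last by rewrite le_min; lra.
      by rewrite clampK; [rewrite ifT; [congr (p (clamp _)); lra|lra]|lra].
    rewrite (min_l (x := 1 * ival t + 4^-1)); last by lra.
    rewrite min_r; last by lra.
    rewrite clampK; last by lra.
    case: ifP => [t3|_].
      by have : False by lra.
    rewrite clampK; last by lra.
    by rewrite ifT; [congr (q (clamp _)); lra|lra].
  rewrite (min_r (x := 1 * ival t + 4^-1)); last by lra.
  rewrite min_r; last by lra.
  rewrite clampK; last by lra.
  case: ifP => [t3|_]; first by have : False by lra.
  rewrite clampK; last by lra.
  case: ifP => [t3|_]; first by have : False by lra.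
  by congr (r (clamp _)); lra.
- by move=> t; rewrite ivalK.
Qed.

Lemma concat_cstl (p : loop) : path_homotopic (concat (cst x : loop) p) p.
Proof.
pose u (t : I) : R := Num.max (2 * ival t + - 1) (0 * ival t + 0).
apply: (@reparam_homotopic _ _ _ _ _ p u (@ival R)).
- move=> t; apply: (@continuous_max _ _ (fun t => 2 * ival t + - 1));
    exact: (continuous_affine _ _ ival_continuous).
- exact: ival_continuous.
- by rewrite /u ival0; rewrite max_r; lra.
- by rewrite /u ival1; rewrite max_l; lra.
- move=> t; have t0 := ival_ge0 t; have t1 := ival_le1 t.
  rewrite /= /mk_path /concat_fun /u; case: (leP (ival t)) => t2.
    rewrite max_r; last by lra.
    rewrite mul0r addr0; exact: (esym (@path_zero _ _ _ _ p)).
  by rewrite max_l //; lra.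
- by move=> t; rewrite ivalK.
Qed.

Lemma concat_cstr (p : loop) : path_homotopic (concat p (cst x : loop)) p.
Proof.
pose u (t : I) : R := Num.min (2 * ival t + 0) (0 * ival t + 1).
apply: (@reparam_homotopic _ _ _ _ _ p u (@ival R)).
- move=> t; apply: (@continuous_min _ _ (fun t => 2 * ival t + 0));
    exact: (continuous_affine _ _ ival_continuous).
- exact: ival_continuous.
- by rewrite /u ival0; rewrite min_l; lra.
- by rewrite /u ival1; rewrite min_r; lra.
- move=> t; have t0 := ival_ge0 t; have t1 := ival_le1 t.
  rewrite /= /mk_path /concat_fun /u; case: (leP (ival t)) => t2.
    by rewrite min_l ?addr0 //; lra.
  rewrite min_r; last by lra.
  by rewrite mul0r add0r; exact: (esym (@path_one _ _ _ _ p)).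
- by move=> t; rewrite ivalK.
Qed.

Lemma concat_reverse (p : loop) :
  path_homotopic (concat p (reverse p)) (cst x : loop).
Proof.
pose u (t : I) : R := Num.min (2 * ival t + 0) (- 2 * ival t + 2).
apply: (@reparam_homotopic _ _ _ _ _ p u (fun=> 0)).
- move=> t; apply: (@continuous_min _ _ (fun t => 2 * ival t + 0));
    exact: (continuous_affine _ _ ival_continuous).
- exact: cst_continuous.
- by rewrite /u ival0; rewrite min_l; lra.
- by rewrite /u ival1; rewrite min_r; lra.
- move=> t; have t0 := ival_ge0 t; have t1 := ival_le1 t.
  rewrite /= /mk_path /concat_fun /u; case: (leP (ival t)) => t2.
    by rewrite min_l ?addr0 //; lra.
  rewrite min_r; last by lra.
  rewrite /= /mk_path /reverse_fun clampK; last by lra.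
  by congr (p (clamp _)); lra.
- by move=> t; exact: (esym (@path_zero _ _ _ _ p)).
Qed.

Lemma reverse_concat (p : loop) :
  path_homotopic (concat (reverse p) p) (cst x : loop).
Proof.
pose u (t : I) : R := Num.max (- 2 * ival t + 1) (2 * ival t + - 1).
apply: (@reparam_homotopic _ _ _ _ _ p u (fun=> 1)).
- move=> t; apply: (@continuous_max _ _ (fun t => - 2 * ival t + 1));
    exact: (continuous_affine _ _ ival_continuous).
- exact: cst_continuous.
- by rewrite /u ival0; rewrite max_l; lra.
- by rewrite /u ival1; rewrite max_r; lra.
- move=> t; have t0 := ival_ge0 t; have t1 := ival_le1 t.
  rewrite /= /mk_path /concat_fun /u; case: (leP (ival t)) => t2.
    rewrite max_l; last by lra.
    rewrite /= /mk_path /reverse_fun clampK; last by lra.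
    by congr (p (clamp _)); lra.
  by rewrite max_r //; lra.
- by move=> t; exact: (esym (@path_one _ _ _ _ p)).
Qed.

Lemma pi1_mulA : associative pi1_mul.
Proof.
move=> f g h; rewrite -[f]homotopy_class_repr -[g]homotopy_class_repr.
rewrite -[h]homotopy_class_repr !pi1_mulE.
exact/homotopy_classP/concatA.
Qed.

Lemma pi1_mul1 : left_id pi1_one pi1_mul.
Proof.
move=> f; rewrite -[f]homotopy_class_repr pi1_mulE.
exact/homotopy_classP/concat_cstl.
Qed.

Lemma pi1_mulr1 : right_id pi1_one pi1_mul.
Proof.
move=> f; rewrite -[f]homotopy_class_repr pi1_mulE.
exact/homotopy_classP/concat_cstr.
Qed.

Lemma pi1_mulV : left_inverse pi1_one pi1_inv pi1_mul.
Proof.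
move=> f; rewrite -[f]homotopy_class_repr pi1_invE pi1_mulE.
exact/homotopy_classP/reverse_concat.
Qed.

Lemma pi1_mulrV : right_inverse pi1_one pi1_inv pi1_mul.
Proof.
move=> f; rewrite -[f]homotopy_class_repr pi1_invE pi1_mulE.
exact/homotopy_classP/concat_reverse.
Qed.

HB.instance Definition _ := isGroup.Build fundamental_group
  pi1_mulA pi1_mul1 pi1_mulr1 pi1_mulV pi1_mulrV.

End pi1.

Section functoriality.
Variables (X Y : topologicalType) (f : continuousType X Y) (x : X).

Definition pi1_map (g : fundamental_group x) : fundamental_group (f x) :=
  homotopy_class (f \o repr g : {path I from f x to f x}).

Lemma pi1_mapE (p : {path I from x to x}) :
  pi1_map (homotopy_class p) =
  homotopy_class (f \o p : {path I from f x to f x}).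
Proof.
apply/homotopy_classP.
have : homotopy_class (repr (homotopy_class p)) = homotopy_class p.
  exact: homotopy_class_repr.
move/homotopy_classP => [H [cH H0 H1 He]].
exists (fun st => f (H st)); split.
- exact: (continuous_compE cH (@cts_fun _ _ f)).
- by move=> t; rewrite H0.
- by move=> t; rewrite H1.
- by move=> s; have [-> ->] := He s.
Qed.

Lemma pi1_map_mul : {morph pi1_map : g h / (g * h)%g}.
Proof.
move=> g h; rewrite -[g]homotopy_class_repr -[h]homotopy_class_repr.
move: (repr g) (repr h) => p q.
have -> : (homotopy_class p * homotopy_class q)%g = homotopy_class (concat p q).
  exact: pi1_mulE.
rewrite !pi1_mapE [RHS]pi1_mulE; congr homotopy_class; apply/path_eqP => t.
by rewrite /= /mk_path /concat_fun /=; case: ifP.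
Qed.

HB.instance Definition _ :=
  isMultiplicative.Build (fundamental_group x) (fundamental_group (f x))
    pi1_map pi1_map_mul.
End functoriality.
End fundamental_group.
Arguments fundamental_group R {X} x.

Definition homeomorphism (X Y : topologicalType) (f : continuousType X Y) : Prop :=
  exists2 g : continuousType Y X, cancel f g & cancel g f.

Section mapping_torus.
Variables (R : realType) (S : topologicalType) (phi : S -> S).
Local Notation I := (unit_interval R).

(* Gluing (x, 1) to (phi x, 0) amounts to identifying two points whenever they
   have the same image under the following map. *)
Definition seam (a : S * I) : S * I :=
  if a.2 == one then (phi a.1, zero) else a.

Definition torus_equiv (a b : S * I) : bool := seam a == seam b.

Lemma torus_equiv_class : equiv_class_of torus_equiv.
Proof.
by split=> [a|a b|b a c]; rewrite /torus_equiv // => /eqP-> /eqP->.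
Qed.

Canonical torus_equivRel := EquivRelPack torus_equiv_class.

Definition mapping_torus : Type := quotient_topology {eq_quot torus_equivRel}.

HB.instance Definition _ := Topological.on mapping_torus.

Definition fiber (x : S) : mapping_torus :=
  \pi_{eq_quot torus_equivRel} (x, zero).

Lemma fiber_continuous : continuous fiber.
Proof.
apply: (continuous_compE _ (@pi_continuous _ {eq_quot torus_equivRel})).
apply: (continuous_pairE _ _); first by move=> x; exact: cvg_id.
exact: cst_continuous.
Qed.

HB.instance Definition _ := isContinuous.Build S mapping_torus fiber fiber_continuous.
End mapping_torus.
Arguments mapping_torus R {S} phi.
Arguments fiber R {S} phi x.

Section singular.
Variable R : realType.

Definition std_simplex (n : nat) : set 'rV[R]_n.+1 :=
  [set t | (forall i, 0 <= t 0 i) /\ \sum_i t 0 i = 1].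
Arguments std_simplex n : clear implicits.

(* The i-th face inclusion of the standard simplex inserts a 0 at position i. *)
Definition coface_row (n : nat) (i : 'I_n.+2) (t : 'rV[R]_n.+1) : 'rV[R]_n.+2 :=
  \row_j oapp (t 0) 0 (unlift i j).

Lemma coface_subproof n (i : 'I_n.+2) (t : std_simplex n) :
  coface_row i (val t) \in std_simplex n.+1.
Proof.
case: t => t p; have [t0 t1] := set_mem p; apply/mem_set; split=> [j|] /=.
  by rewrite mxE; case: unlift => [k|] /=.
rewrite (bigD1_ord i)//= mxE unlift_none /= add0r -[RHS]t1.
by apply: eq_bigr => k _; rewrite mxE liftK.
Qed.

Definition coface n (i : 'I_n.+2) (t : std_simplex n) : std_simplex n.+1 :=
  exist _ (coface_row i (val t)) (coface_subproof i t).

Lemma coface_continuous n (i : 'I_n.+2) : continuous (@coface n i).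
Proof.
apply: continuous_comp_initial.
apply: (@continuous_compE _ _ _ (set_val : std_simplex n -> _) (@coface_row n i)).
  exact: initial_continuous.
apply: continuous_mx => k j; rewrite ord1.
rewrite (_ : (fun t => _) = (fun t : 'rV[R]_n.+1 => oapp (t 0) 0 (unlift i j))).
  by case: (unlift i j) => [l|] /=; [exact: coord_continuous|exact: cst_continuous].
by apply/funext => t; rewrite mxE.
Qed.

HB.instance Definition _ n (i : 'I_n.+2) :=
  isContinuous.Build (std_simplex n) (std_simplex n.+1) (@coface n i)
    (@coface_continuous n i).

Definition singular_simplex (n : nat) (X : topologicalType) : choiceType :=
  continuousType (std_simplex n) X.

Definition face n (X : topologicalType) (i : 'I_n.+2)
    (s : singular_simplex n.+1 X) : singular_simplex n X :=
  (s : continuousType _ _) \o @coface n i.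

Definition chain (n : nat) (X : topologicalType) :=
  {freeg (singular_simplex n X) / int}.

Definition boundary n (X : topologicalType) : chain n.+1 X -> chain n X :=
  fglift (fun s : singular_simplex n.+1 X =>
    \sum_(i < n.+2) (-1) ^+ i *: (<< face i s >> : chain n X)).

Definition cochain (n : nat) (X : topologicalType) := singular_simplex n X -> R^o.

HB.instance Definition _ n X := GRing.Lmodule.on (cochain n X).

Definition coboundary n (X : topologicalType) (c : cochain n X) :
    cochain n.+1 X :=
  fun s => \sum_(i < n.+2) (-1) ^+ i * c (face i s).

Section cohomology.
Variables (n : nat) (X : topologicalType).

Lemma coboundary_linear m : linear (@coboundary m X).
Proof.
move=> a c d; apply/funext => s.
change (\sum_(i < m.+2) (-1) ^+ i * (a * c (face i s) + d (face i s)) =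
  a * (\sum_(i < m.+2) (-1) ^+ i * c (face i s)) +
  \sum_(i < m.+2) (-1) ^+ i * d (face i s)).
rewrite mulr_sumr -big_split /=.
by apply: eq_bigr => i _; rewrite mulrDr mulrCA.
Qed.

HB.instance Definition _ m := GRing.isLinear.Build R (cochain m X)
  (cochain m.+1 X) _ (@coboundary m X) (@coboundary_linear m).

Definition is_cocycle : {pred cochain n X} := fun c => coboundary c == 0.

Lemma cocycle_submod_closed : submod_closed is_cocycle.
Proof.
split=> [|a c d]; rewrite !unfold_in ?linear0 //.
by move=> /eqP c0 /eqP d0; rewrite linearP /= c0 d0 scaler0 addr0.
Qed.

HB.instance Definition _ := GRing.isSubmodClosed.Build R (cochain n X)
  is_cocycle cocycle_submod_closed.

Record cocycle := Cocycle { cocycle_val : cochain n X; _ : cocycle_val \in is_cocycle }.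

HB.instance Definition _ := [isSub for cocycle_val].
HB.instance Definition _ := [Choice of cocycle by <:].
HB.instance Definition _ := [SubChoice_isSubLmodule of cocycle by <:].

Definition coboundaries (m : nat) : set (cochain m X) :=
  match m with 0 => [set 0] | m'.+1 => range (@coboundary m' X) end.

Arguments coboundaries : clear implicits.

Definition is_exact : {pred cocycle} := fun c => `[< coboundaries n (val c) >].

Lemma coboundaries0 m : coboundaries m 0.
Proof. by case: m => [//|m]; exists 0 => //; rewrite linear0. Qed.

Lemma coboundariesP m a (c d : cochain m X) :
  coboundaries m c -> coboundaries m d -> coboundaries m (a *: c + d).
Proof.
case: m c d => [|m] c d /=; first by move=> -> ->; rewrite scaler0 addr0.
by move=> [c' _ <-] [d' _ <-]; exists (a *: c' + d') => //; rewrite linearP.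
Qed.

Lemma exact_submod_closed : submod_closed is_exact.
Proof.
split=> [|a c d]; rewrite !unfold_in.
  by apply/asboolP; rewrite linear0; exact: coboundaries0.
move=> /asboolP c0 /asboolP d0; apply/asboolP.
by rewrite linearP; exact: coboundariesP.
Qed.

HB.instance Definition _ := GRing.isSubmodClosed.Build R cocycle
  is_exact exact_submod_closed.

Definition cohomology : Type := Quotient.quot is_exact.

HB.instance Definition _ := GRing.Zmodule.on cohomology.
HB.instance Definition _ := Quotient.on cohomology.

Definition cohomology_class (c : cocycle) : cohomology := \pi_(Quotient.quot is_exact) c.

Lemma cohomology_classP (c d : cocycle) :
  cohomology_class c = cohomology_class d <-> coboundaries n (val c - val d).
Proof.
rewrite -raddfB; split; first by move/eqP; rewrite -Quotient.idealrBE => /asboolP.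
by move=> cd; apply/eqP; rewrite -Quotient.idealrBE; apply/asboolP.
Qed.

Lemma cohomology_class_repr (u : cohomology) : cohomology_class (repr u) = u.
Proof. exact: reprK. Qed.

Lemma cohomology_classD : {morph cohomology_class : c d / c + d}.
Proof. by move=> c d; rewrite /cohomology_class !piE. Qed.

Definition cohomology_scale (a : R) (u : cohomology) : cohomology :=
  cohomology_class (a *: repr u).

Lemma cohomology_scaleE a c :
  cohomology_scale a (cohomology_class c) = cohomology_class (a *: c).
Proof.
rewrite /cohomology_scale; apply/cohomology_classP.
rewrite -raddfB -scalerBr.
have /cohomology_classP := cohomology_class_repr (cohomology_class c).
rewrite -raddfB => h.
have : a *: (repr (cohomology_class c) - c) \in is_exact.
  by apply: rpredZ; rewrite unfold_in; apply/asboolP.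
by rewrite unfold_in => /asboolP.
Qed.

Lemma cohomology_scaleA a b u :
  cohomology_scale a (cohomology_scale b u) = cohomology_scale (a * b) u.
Proof.
by rewrite -[u]cohomology_class_repr !cohomology_scaleE scalerA.
Qed.

Lemma cohomology_scale1 : left_id 1 cohomology_scale.
Proof.
by move=> u; rewrite -[u]cohomology_class_repr cohomology_scaleE scale1r.
Qed.

Lemma cohomology_scaleDr : right_distributive cohomology_scale +%R.
Proof.
move=> a u v; rewrite -[u]cohomology_class_repr -[v]cohomology_class_repr.
rewrite !cohomology_scaleE -!cohomology_classD cohomology_scaleE.
by rewrite scalerDr.
Qed.

Lemma cohomology_scaleDl u : {morph cohomology_scale^~ u : a b / a + b}.
Proof.
move=> a b; rewrite -[u]cohomology_class_repr !cohomology_scaleE.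
by rewrite -cohomology_classD scalerDl.
Qed.

HB.instance Definition _ := GRing.Zmodule_isLmodule.Build R cohomology
  cohomology_scaleA cohomology_scale1 cohomology_scaleDr cohomology_scaleDl.
End cohomology.

Section pullback.
Variables (n : nat) (X Y : topologicalType) (f : continuousType X Y).

Definition pullback_cochain m (c : cochain m Y) : cochain m X :=
  fun s => c (f \o (s : continuousType _ _)).

Lemma pullback_cochain_linear m : linear (@pullback_cochain m).
Proof. by []. Qed.

HB.instance Definition _ m := GRing.isLinear.Build R (cochain m Y)
  (cochain m X) _ (@pullback_cochain m) (@pullback_cochain_linear m).

Lemma pullback_coboundary m (c : cochain m Y) :
  coboundary (pullback_cochain c) = pullback_cochain (coboundary c).
Proof.
apply/funext => s; apply: eq_bigr => i _; congr (_ * c _).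
exact/continuousEP.
Qed.

Lemma pullback_subproof (c : cocycle n Y) :
  pullback_cochain (val c) \in @is_cocycle n X.
Proof.
case: c => c p; have /eqP c0 : coboundary c == 0 := p.
by rewrite unfold_in pullback_coboundary [coboundary _]c0 linear0.
Qed.

Definition pullback_cocycle (c : cocycle n Y) : cocycle n X :=
  Cocycle (pullback_subproof c).

Definition pullback (u : cohomology n Y) : cohomology n X :=
  cohomology_class (pullback_cocycle (repr u)).

Lemma pullbackE (c : cocycle n Y) :
  pullback (cohomology_class c) = cohomology_class (pullback_cocycle c).
Proof.
apply/cohomology_classP.
have /cohomology_classP := cohomology_class_repr (cohomology_class c).
rewrite /= -linearB; move: (_ - _) => d.
case: n d => [|m] d /=; first by move=> ->; rewrite linear0.
by case=> b _ <-; exists (pullback_cochain b) => //; rewrite pullback_coboundary.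
Qed.

Lemma pullback_linear : linear pullback.
Proof.
move=> a u v; rewrite -[u]cohomology_class_repr -[v]cohomology_class_repr.
rewrite [a *: _]cohomology_scaleE -cohomology_classD !pullbackE.
rewrite [a *: _]cohomology_scaleE -cohomology_classD.
by congr cohomology_class; apply: val_inj.
Qed.

HB.instance Definition _ := GRing.isLinear.Build R (cohomology n Y)
  (cohomology n X) _ pullback pullback_linear.
End pullback.

End singular.
Arguments pullback R n {X Y} f u.

Section linear_algebra.
Variables (R : realType) (V : lmodType R).

Definition is_basis (n : nat) (e : 'I_n -> V) : Prop :=
  forall v, exists! a : 'rV[R]_n, v = \sum_i a 0 i *: e i.

Definition has_dim (n : nat) : Prop := exists e : 'I_n -> V, is_basis e.

(* V is finite-dimensional and nonzero, and no complex eigenvalue of f has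
   modulus one. *)
Definition hyperbolic (f : {linear V -> V}) : Prop :=
  exists (n : nat) (e : 'I_n -> V) (A : 'M[R]_n),
    [/\ (0 < n)%N, is_basis e, forall i, f (e i) = \sum_j A i j *: e j &
        forall z : complex R, eigenvalue (map_mx (real_complex R) A) z ->
          `|z| != 1].
End linear_algebra.

Section surface.
Variables (R : realType) (X : topologicalType).

(* A homeomorphism f, with inverse g, from an open neighbourhood of x onto a
   relatively open subset W `&` H of H. *)
Definition has_chart (H : set (R * R)) (x : X) : Prop :=
  exists (U : set X) (W : set (R * R)) (f : X -> R * R) (g : R * R -> X),
    [/\ open U, U x & open W] /\
    [/\ {within U, continuous f}, {within W `&` H, continuous g},
        forall y, U y -> (W `&` H) (f y) /\ g (f y) = y &
        forall w, (W `&` H) w -> U (g w) /\ f (g w) = w].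

Definition half_plane : set (R * R) := [set w | 0 <= w.2].

(* Second countability follows from compactness. *)
Definition compact_surface : Prop :=
  [/\ hausdorff_space X, compact [set: X], connected [set: X] &
      forall x, has_chart half_plane x].

Definition manifold_interior : set X := has_chart setT.

Definition supported_in n (A : set X) (c : chain R n X) : Prop :=
  forall s, s \in dom c -> range (s : continuousType _ _) `<=` A.

Definition relative_cycle n (A : set X) (c : chain R n.+1 X) : Prop :=
  supported_in A (boundary c).

Definition relative_homologous n (A : set X) (c d : chain R n X) : Prop :=
  exists b : chain R n.+1 X, supported_in A (c - d - boundary b).

(* c represents a generator of the infinite cyclic group H_2(X, X - x; Z). *)
Definition local_orientation (x : X) (c : chain R 2 X) : Prop :=
  relative_cycle (~` [set x]) c /\
  forall d : chain R 2 X, relative_cycle (~` [set x]) d ->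
    exists k : int, relative_homologous (~` [set x]) d (k *: c).

Definition orientable : Prop :=
  exists mu : X -> chain R 2 X, forall x, manifold_interior x ->
    local_orientation x (mu x) /\
    exists (B : set X) (c : chain R 2 X),
      [/\ nbhs x B, relative_cycle (~` B) c &
          forall y, B y -> manifold_interior y ->
            relative_homologous (~` [set y]) c (mu y)].

Definition euler_characteristic (chi : int) : Prop :=
  exists (b : nat -> nat) (N : nat),
    [/\ forall n, has_dim (cohomology R n X) (b n),
        forall n, (N <= n)%N -> b n = 0%N &
        chi = \sum_(n < N) (-1) ^+ n * (b n)%:Z].
End surface.

Section manifold.
Variables (R : realType) (N : nat).
Implicit Types M : set 'rV[R]_N.

(* M is an m-dimensional C^1 submanifold (without boundary) of R^N: near each of
   its points, a C^1 diffeomorphism F between open sets, with inverse G,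
   straightens M into R^m x {0}. *)
Definition C1_submanifold (m : nat) M : Prop :=
  (m <= N)%N /\
  forall x, M x -> exists (U W : set 'rV[R]_N) (F G : 'rV[R]_N -> 'rV[R]_N),
    [/\ open U, U x & open W] /\
    [/\ C1_on U F, C1_on W G,
        forall y, U y -> W (F y) /\ G (F y) = y,
        forall w, W w -> U (G w) /\ F (G w) = w &
        forall y, U y ->
          (M y <-> forall j : 'I_N, (m <= j)%N -> F y 0 j = 0)].

Section maps.
Variable M : set 'rV[R]_N.
Implicit Types (x : M) (f g : M -> M).

Definition ambient x : 'rV[R]_N := set_val x.

Definition velocity (gamma : R -> M) (x : M) (v : 'rV[R]_N) : Prop :=
  gamma 0 = x /\ is_derive (0 : R) (1 : R) (ambient \o gamma) v.

Definition tangent (x : M) : set 'rV[R]_N :=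
  [set v | exists gamma, velocity gamma x v].

Definition riemannian_metric (q : M -> 'M[R]_N) : Prop :=
  [/\ continuous q, forall x, (q x)^T = q x &
      forall x v, tangent x v -> v != 0 -> 0 < (v *m q x *m v^T) 0 0].

Definition C1_map f : Prop := forall x : M,
  exists (U : set 'rV[R]_N) (F : 'rV[R]_N -> 'rV[R]_N),
    [/\ open U, U (ambient x), C1_on U F &
        forall y : M, U (ambient y) -> F (ambient y) = ambient (f y)].

(* Matrices act on row vectors on the right: v *m A is D_x f (v) for v in T_xM,
   and w *m A = 0 for w orthogonal to T_xM. *)
Definition is_tangent_matrix f (x : M) (A : 'M[R]_N) : Prop :=
  (forall gamma v, velocity gamma x v -> velocity (f \o gamma) (f x) (v *m A)) /\
  (forall w : 'rV[R]_N, (forall v, tangent x v -> w *m v^T = 0) -> w *m A = 0).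

Definition tangent_map f (x : M) : 'M[R]_N := xget 0 (is_tangent_matrix f x).

Lemma C1_map_id : C1_map id.
Proof.
move=> x; exists setT, id; split=> //; first exact: openT.
exact: C1_on_id.
Qed.

Lemma C1_map_comp f g : C1_map f -> C1_map g -> C1_map (f \o g).
Proof.
move=> Cf Cg x; have [U [G [oU Ux CG Gg]]] := Cg x.
have [V [F [oV Vgx CF Ff]]] := Cf (g x).
have [oUV CFG] := C1_on_comp oU oV CG CF.
exists (U `&` G @^-1` V), (F \o G); split=> //.
  by split=> //; rewrite /preimage /= Gg.
by move=> y [Uy VGy]; rewrite /= Gg// Ff// -Gg.
Qed.

Record C1_diffeo := C1Diffeo {
  diffeo_fun :> M -> M;
  diffeo_inv : M -> M;
  diffeo_funK : cancel diffeo_fun diffeo_inv;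
  diffeo_invK : cancel diffeo_inv diffeo_fun;
  diffeo_C1 : C1_map diffeo_fun;
  diffeo_inv_C1 : C1_map diffeo_inv }.

HB.instance Definition _ := gen_eqMixin C1_diffeo.
HB.instance Definition _ := gen_choiceMixin C1_diffeo.

Implicit Types p q r : C1_diffeo.

Lemma C1_diffeoP p q : p =1 q -> p = q.
Proof.
case: p q => [f f' fK f'K Cf Cf'] [g g' gK g'K Cg Cg'] /= fg.
have /funext {}fg := fg; subst g.
have f'g' : f' = g' by apply/funext => x; rewrite -[x in LHS]g'K fK.
by subst g'; congr C1Diffeo; exact: Prop_irrelevance.
Qed.

Definition diffeo_id : C1_diffeo :=
  C1Diffeo (fun=> erefl) (fun=> erefl) C1_map_id C1_map_id.

Definition diffeo_comp p q : C1_diffeo :=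
  C1Diffeo (can_comp (@diffeo_funK p) (@diffeo_funK q))
    (can_comp (@diffeo_invK q) (@diffeo_invK p))
    (C1_map_comp (@diffeo_C1 p) (@diffeo_C1 q))
    (C1_map_comp (@diffeo_inv_C1 q) (@diffeo_inv_C1 p)).

Definition diffeo_sym p : C1_diffeo :=
  C1Diffeo (@diffeo_invK p) (@diffeo_funK p)
    (@diffeo_inv_C1 p) (@diffeo_C1 p).

Lemma diffeo_compA : associative diffeo_comp.
Proof. by move=> p q r; exact: C1_diffeoP. Qed.

Lemma diffeo_comp1 : left_id diffeo_id diffeo_comp.
Proof. by move=> p; exact: C1_diffeoP. Qed.

Lemma diffeo_compr1 : right_id diffeo_id diffeo_comp.
Proof. by move=> p; exact: C1_diffeoP. Qed.

Lemma diffeo_compV : left_inverse diffeo_id diffeo_sym diffeo_comp.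
Proof. by move=> p; apply: C1_diffeoP => x /=; rewrite diffeo_funK. Qed.

Lemma diffeo_comprV : right_inverse diffeo_id diffeo_sym diffeo_comp.
Proof. by move=> p; apply: C1_diffeoP => x /=; rewrite diffeo_invK. Qed.

HB.instance Definition _ := isGroup.Build C1_diffeo
  diffeo_compA diffeo_comp1 diffeo_compr1 diffeo_compV diffeo_comprV.

(* The norms on row vectors and on matrices are maximum norms. *)
Definition C1_dist p q : R :=
  sup (range (fun x => `|ambient (p x) - ambient (q x)|)) +
  sup (range (fun x => `|tangent_map p x - tangent_map q x|)).

End maps.
End manifold.

Section representations.
Variables (R : realType) (N : nat) (M : set 'rV[R]_N) (G : groupType).
Local Notation hom := {multiplicative G -> C1_diffeo M}.

Definition generates (Sigma : seq G) : Prop :=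
  forall H : set G, H 1%g -> (forall s, s \in Sigma -> H s) ->
    (forall g h, H g -> H h -> H (g * h)%g) -> (forall g, H g -> H g^-1%g) ->
    forall g, H g.

Definition rep_dist (Sigma : seq G) (rho rho' : hom) : R :=
  \big[Num.max/0]_(s <- Sigma) C1_dist (rho s) (rho' s).

Definition C1_nbhs (rho : hom) (U : set hom) : Prop :=
  exists (Sigma : seq G) (e : R), [/\ generates Sigma, 0 < e &
    forall rho' : hom, rep_dist Sigma rho rho' < e -> U rho'].

Definition trivial_rep : hom := @one_fun G (C1_diffeo M).
End representations.
Arguments trivial_rep {R N} M G.

(* Main.v *)
From HB Require Import structures.
Require Import Defs.
From mathcomp Require Import all_boot all_order all_algebra generic_quotient.
From mathcomp Require Import lra ring.
From mathcomp Require Import all_classical all_reals all_analysis homotopy.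
From mathcomp.real_closed Require Import complex.
Set Implicit Arguments.
Unset Strict Implicit.
Unset Printing Implicit Defensive.
Import Order.TTheory GRing.Theory Num.Theory.
Import numFieldNormedType.Exports.
Local Open Scope classical_set_scope.
Local Open Scope ring_scope.

(** The proof is by contradiction.  Suppose that representations rho_k converge
    to the trivial one and that no rho_k kills H = pi1(S).

    A diffeomorphism of M that is C1-close to the identity has a displacement
    x - f x with a small Lipschitz constant [displacement_lipschitz].  Hence the
    displacement of a product is, up to a small relative error, the sum of the
    displacements.  Choose a point x_k at which finitely many generators of H are
    displaced by at least half of the maximal amount, and divide by that amount:
    along an ultrafilter the normalised displacements at x_k converge to a
    nonzero homomorphism from H to R^N.  Let L be a nonzero coordinate of it.

    The stable letter t of the mapping torus acts on H by the monodromy of phi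
    [stable_letter_conj].  The displacement of a conjugate of h at x_k is, up to
    a factor close to 1, the displacement of h at another point of M, so it is
    bounded by a multiple of the maximal amount.  Thus L is bounded along the
    orbits of the monodromy, in both directions of time
    [near_trivial_reps_kill].

    Homomorphisms from H to R embed into the first singular cohomology, with the
    monodromy corresponding to the pullback by phi [pullback_hom_class,
    hom_class_inj].  Applying the linear factors of the characteristic polynomial
    of the pullback to L one after the other, one meets a nonzero complex
    eigenfunction of the monodromy with bounded orbits.  Its eigenvalue has
    modulus one, against hyperbolicity [hyperbolic_no_bounded_hom].

    The argument needs H to be finitely generated [pi1_finitely_generated] and
    pi1(T) to be generated by H and t [mapping_torus_generated].  Both are proved
    with the same tool.  After the choice of a path c x from the base point to
    every point x, a path p from x to y has a class in the fundamental group, its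
    holonomy, represented by c x, then p, then c y backwards.  Holonomy turns
    concatenation into multiplication, and a subgroup contains all holonomies as
    soon as it contains those of short paths [holonomy_local_global]. *)

(** * Homotopies of paths *)

Section path_algebra.
Variables (R : realType) (X : topologicalType).
Local Notation I := (unit_interval R).

Lemma clamp_le0 (t : R) : t <= 0 -> clamp t = zero.
Proof.
move=> t0; apply: ival_inj; rewrite ival0 /ival /=.
by apply/max_idPl; rewrite ge_min t0 orbT.
Qed.

Lemma clamp_ge1 (t : R) : 1 <= t -> clamp t = one.
Proof.
move=> t1; apply: ival_inj; rewrite ival1 /ival /= (min_idPl t1).
exact/max_idPr.
Qed.

(** Both bracketings traverse the same path at different speeds. *)
Lemma concat_assoc (x y z w : X) (p : {path I from x to y})
    (q : {path I from y to z}) (r : {path I from z to w}) :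
  path_homotopic (concat p (concat q r)) (concat (concat p q) r).
Proof.
pose u (t : I) : R :=
  Num.min (2 * ival t + 0) (Num.min (1 * ival t + 4^-1) (2^-1 * ival t + 2^-1)).
apply/path_homotopic_sym.
apply: (@reparam_homotopic _ _ _ _ _ _ (concat p (concat q r)) u (@ival R)).
- move=> t; apply: (@continuous_min _ _ (fun t => 2 * ival t + 0)).
    exact: (continuous_affine _ _ ival_continuous).
  apply: (@continuous_min _ _ (fun t => 1 * ival t + 4^-1));
    exact: (continuous_affine _ _ ival_continuous).
- exact: ival_continuous.
- by rewrite /u ival0 min_l ?le_min; lra.
- by rewrite /u ival1 (min_r (y := 2^-1 * 1 + 2^-1)) ?min_r; lra.
- move=> t; have t0 := ival_ge0 t; have t1 := ival_le1 t.
  rewrite /= /mk_path /= /concat_fun /= /mk_path /concat_fun /u.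
  have [t2|t2] := leP (ival t) 2^-1.
    rewrite (clampK (t := 2 * ival t)); last by lra.
    have [t4|t4] := leP (2 * ival t) 2^-1.
      rewrite (min_l (y := Num.min _ _)); last by rewrite le_min; lra.
      by rewrite clampK; [rewrite ifT; [congr (p (clamp _)); lra|lra]|lra].
    rewrite (min_l (x := 1 * ival t + 4^-1)); last by lra.
    rewrite min_r; last by lra.
    rewrite clampK; last by lra.
    rewrite ifF; last by lra.
    rewrite clampK; last by lra.
    by rewrite ifT; [congr (q (clamp _)); lra|lra].
  rewrite (min_r (x := 1 * ival t + 4^-1)); last by lra.
  rewrite min_r; last by lra.
  rewrite clampK; last by lra.
  rewrite ifF; last by lra.
  rewrite clampK; last by lra.
  by rewrite ifF; [congr (r (clamp _)); lra|lra].
- by move=> t; rewrite ivalK.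
Qed.

(** Both sides of a filled square run from corner to corner inside the square,
    and a square is convex: the straight-line homotopy between the two edge
    paths, pushed into X, is the required homotopy. *)
Lemma square_homotopic (x y z w : X) (H : I * I -> X)
    (a : {path I from x to y}) (b : {path I from y to w})
    (c : {path I from x to z}) (d : {path I from z to w}) :
  continuous H ->
  (forall t, a t = H (zero, t)) -> (forall t, b t = H (t, one)) ->
  (forall t, c t = H (t, zero)) -> (forall t, d t = H (one, t)) ->
  path_homotopic (concat a b) (concat c d).
Proof.
move=> cH aE bE cE dE.
(* the two edge paths have coordinates (r, l) and (l, r) *)
pose l (t : I) : R := ival (clamp (2 * ival t)).
pose r (t : I) : R := ival (clamp (2 * ival t - 1)).
pose mix (u v : I -> R) (st : I * I) : I :=
  clamp ((1 - ival st.1) * u st.2 + ival st.1 * v st.2).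
have cl : continuous l.
  exact: (continuous_compE (continuous_clamp_lin ival_continuous _) ival_continuous).
have cr : continuous r.
  exact: (continuous_compE (continuous_clamp_affine ival_continuous _ _) ival_continuous).
have cmix u v : continuous u -> continuous v -> continuous (mix u v).
  move=> cu cv; apply: (continuous_compE _ clamp_continuous) => st.
  have c1 : continuous (fun st : I * I => ival st.1).
    exact: (continuous_compE continuous_fstE ival_continuous).
  apply: cvgD; apply: cvgM.
  - by apply: cvgB; [exact: cvg_cst|exact: c1].
  - exact: (continuous_compE continuous_sndE cu).
  - exact: c1.
  - exact: (continuous_compE continuous_sndE cv).
have l0 : l zero = 0 by rewrite /l ival0 clampK; lra.
have r0 : r zero = 0.
  by rewrite /r ival0 clamp_le0 ?ival0; lra.
have l1 : l one = 1.
  by rewrite /l ival1 clamp_ge1 ?ival1; lra.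
have r1 : r one = 1 by rewrite /r ival1 clampK; lra.
exists (fun st => H (mix r l st, mix l r st)); split.
- apply: (continuous_compE _ cH).
  by apply: (continuous_pairE _ _); exact: cmix.
- move=> t; rewrite /mix /= ival0 subr0 !mul0r !addr0 !mul1r !ivalK.
  have t0 := ival_ge0 t; have t1 := ival_le1 t.
  rewrite /= /mk_path /concat_fun; case: leP => t2.
    rewrite aE; congr (H (_, _)); rewrite clamp_le0//; lra.
  rewrite bE; congr (H (_, _)); rewrite clamp_ge1//; lra.
- move=> t; rewrite /mix /= ival1 subrr !mul0r !add0r !mul1r !ivalK.
  have t0 := ival_ge0 t; have t1 := ival_le1 t.
  rewrite /= /mk_path /concat_fun; case: leP => t2.
    rewrite cE; congr (H (_, _)); rewrite clamp_le0//; lra.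
  rewrite dE; congr (H (_, _)); rewrite clamp_ge1//; lra.
- move=> s; rewrite /mix /= l0 r0 l1 r1 !mulr0 !mulr1 addr0 subrK; split.
    by rewrite -[x](@path_zero _ _ _ _ a) [RHS]aE.
  by rewrite -[w](@path_one _ _ _ _ b) [RHS]bE.
Qed.

Lemma concat_homotopic_cstl (x y : X) (p : {path I from x to y}) :
  path_homotopic (concat (cst x : {path I from x to x}) p) p.
Proof.
pose u (t : I) : R := Num.max (2 * ival t + - 1) (0 * ival t + 0).
apply: (@reparam_homotopic _ _ _ _ _ _ p u (@ival R)).
- move=> t; apply: (@continuous_max _ _ (fun t => 2 * ival t + - 1));
    exact: (continuous_affine _ _ ival_continuous).
- exact: ival_continuous.
- by rewrite /u ival0 max_r; lra.
- by rewrite /u ival1 max_l; lra.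
- move=> t; have t0 := ival_ge0 t; have t1 := ival_le1 t.
  rewrite /= /mk_path /concat_fun /u; case: leP => t2.
    rewrite max_r; last by lra.
    rewrite mul0r addr0; exact: (esym (@path_zero _ _ _ _ p)).
  by rewrite max_l //; lra.
- by move=> t; rewrite ivalK.
Qed.

Lemma reverse_concat_cst (x y : X) (p : {path I from x to y}) :
  path_homotopic (concat (reverse p) p) (cst y : {path I from y to y}).
Proof.
pose u (t : I) : R := Num.max (- 2 * ival t + 1) (2 * ival t + - 1).
apply: (@reparam_homotopic _ _ _ _ _ _ p u (fun=> 1)).
- move=> t; apply: (@continuous_max _ _ (fun t => - 2 * ival t + 1));
    exact: (continuous_affine _ _ ival_continuous).
- exact: cst_continuous.
- by rewrite /u ival0 max_l; lra.
- by rewrite /u ival1 max_r; lra.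
- move=> t; have t0 := ival_ge0 t; have t1 := ival_le1 t.
  rewrite /= /mk_path /concat_fun /u; case: leP => t2.
    rewrite max_l; last by lra.
    rewrite /= /mk_path /reverse_fun clampK; last by lra.
    by congr (p (clamp _)); lra.
  by rewrite max_r //; lra.
- by move=> t; exact: (esym (@path_one _ _ _ _ p)).
Qed.
End path_algebra.

(** * Holonomy along paths *)

Lemma locally_constant_connected (X : topologicalType) (P : set X) (x0 : X) :
  connected [set: X] -> P x0 ->
  (forall x, \forall y \near x, P y <-> P x) -> forall x, P x.
Proof.
move=> cX Px0 lc.
suff -> : P = setT by [].
have oP : open P.
  rewrite openE => x Px; rewrite /interior; near=> y.
  by apply/(near (lc x) y) => //.
have cP : closed P.
  rewrite -openC openE => x nPx; rewrite /interior; near=> y.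
  by move=> /= Py; apply: nPx; apply/(near (lc x) y) => //.
by apply: cX; [exists x0|exists P => //; rewrite setTI..].
Unshelve. all: by end_near.
Qed.

Section subgroups.
Variable G : groupType.

Definition subgroup_set (K : set G) : Prop :=
  [/\ K 1%g, forall g h, K g -> K h -> K (g * h)%g & forall g, K g -> K g^-1%g].

(** Membership in the subgroup generated by Sigma, as an induction principle. *)
Definition span_set (Sigma : seq G) : set G :=
  [set g | forall K : set G, subgroup_set K -> (forall s, s \in Sigma -> K s) -> K g].

Lemma span_subgroup Sigma : subgroup_set (span_set Sigma).
Proof.
split.
- by move=> K [].
- by move=> g h Kg Kh K sK SK; case: (sK) => _ + _; apply; [exact: Kg|exact: Kh].
- by move=> g Kg K sK SK; case: (sK) => _ _; apply; exact: Kg.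
Qed.

Lemma span_mem Sigma s : s \in Sigma -> span_set Sigma s.
Proof. by move=> sS K _; apply. Qed.

Lemma span_generates Sigma : (forall g, span_set Sigma g) -> generates Sigma.
Proof. by move=> gS K K1 SK KM KV g; apply: gS. Qed.

Lemma generates_sub Sigma (K : set G) : generates Sigma -> subgroup_set K ->
  (forall s, s \in Sigma -> K s) -> forall g, K g.
Proof. by move=> gS [K1 KM KV] SK; apply: gS. Qed.
End subgroups.

Section holonomy.
Variables (R : realType) (X : topologicalType) (x0 : X).
Local Notation I := (unit_interval R).
Variable c : forall x : X, {path I from x0 to x}.
Hypothesis c0 : c x0 =1 cst x0.
Local Notation pi1 := (fundamental_group R x0).

Definition close_up x y (p : {path I from x to y}) : pi1 :=
  homotopy_class (concat (concat (c x) p) (reverse (c y))).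

Lemma close_up_homotopic x y (p q : {path I from x to y}) :
  path_homotopic p q -> close_up p = close_up q.
Proof.
move=> pq; apply/homotopy_classP/concat_homotopic; last exact: path_homotopic_refl.
by apply: concat_homotopic => //; exact: path_homotopic_refl.
Qed.

Lemma close_up_concat x y z (p : {path I from x to y}) (q : {path I from y to z}) :
  close_up (concat p q) = (close_up p * close_up q)%g.
Proof.
rewrite /close_up [RHS]pi1_mulE; apply/homotopy_classP.
set a := c x; set b := c y; set d := reverse (c z).
apply: (path_homotopic_trans (q := concat (concat (concat a p) q) d)).
  by apply: concat_homotopic; [exact: concat_assoc|exact: path_homotopic_refl].
apply: path_homotopic_sym.
apply: (path_homotopic_trans
  (q := concat (concat a p) (concat (reverse b) (concat (concat b q) d)))).
  exact/path_homotopic_sym/concat_assoc.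
apply: (path_homotopic_trans (q := concat (concat a p) (concat q d))); last first.
  exact: concat_assoc.
apply: concat_homotopic; first exact: path_homotopic_refl.
apply: (path_homotopic_trans (q := concat (concat (reverse b) (concat b q)) d)).
  exact: concat_assoc.
apply: concat_homotopic; last exact: path_homotopic_refl.
apply: (path_homotopic_trans (q := concat (concat (reverse b) b) q)).
  exact: concat_assoc.
apply: (path_homotopic_trans (q := concat (cst y : {path I from y to y}) q)).
  apply: concat_homotopic; last exact: path_homotopic_refl.
  exact: reverse_concat_cst.
exact: concat_homotopic_cstl.
Qed.

(** Defined on bare functions rather than on paths with prescribed ends, so that
    relations between holonomies are equations in the group alone, without
    transport between path types. *)
Definition holonomy (f : I -> X) : pi1 :=
  if pselect (continuous f) is left cf then
    close_up (@mk_path I X (f zero) (f one) f cf erefl erefl) else 1%g.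

Lemma holonomyE x y (p : {path I from x to y}) : holonomy p = close_up p.
Proof.
rewrite /holonomy; case: pselect => [cp|[]]; last exact: (@cts_fun _ _ p).
suff h (f : I -> X) (cf cf' : continuous f) a b (fa : f zero = a) (fb : f one = b) :
    close_up (@mk_path I X _ _ f cf erefl erefl) =
    close_up (@mk_path I X a b f cf' fa fb).
  rewrite (h p cp (@cts_fun _ _ p) _ _ (@path_zero _ _ _ _ p) (@path_one _ _ _ _ p)).
  by congr close_up; apply/path_eqP.
by case: _ / fa; case: _ / fb; congr close_up; apply/path_eqP.
Qed.

Lemma holonomy_homotopic x y (p q : {path I from x to y}) :
  path_homotopic p q -> holonomy p = holonomy q.
Proof. by rewrite !holonomyE; exact: close_up_homotopic. Qed.

Lemma holonomy_concat x y z (p : {path I from x to y}) (q : {path I from y to z}) :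
  holonomy (concat p q) = (holonomy p * holonomy q)%g.
Proof. by rewrite !holonomyE close_up_concat. Qed.

(* A constant path is homotopic to its own square. *)
Lemma holonomy_cst x : holonomy (cst x) = 1%g.
Proof.
pose e : {path I from x to x} := cst x.
have h : path_homotopic (concat e e) e by exact: concat_homotopic_cstl.
have := holonomy_homotopic h; rewrite holonomy_concat.
move=> /(congr1 (fun g => (holonomy (cst x))^-1 * g)%g).
by rewrite mulKg mulVg.
Qed.

Lemma holonomy_reverse x y (p : {path I from x to y}) :
  holonomy (reverse p) = (holonomy p)^-1%g.
Proof.
have h := holonomy_homotopic (reverse_concat_cst p).
rewrite holonomy_cst holonomy_concat in h.
by apply: (@mulIg _ (holonomy p)); rewrite h mulVg.
Qed.

Lemma holonomy_loop (p : {path I from x0 to x0}) : holonomy p = homotopy_class p.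
Proof.
rewrite holonomyE /close_up.
have -> : c x0 = (cst x0 : {path I from x0 to x0}) by exact/path_eqP.
have -> : reverse (cst x0 : {path I from x0 to x0}) = (cst x0 : {path I from x0 to x0}).
  exact/path_eqP.
apply/homotopy_classP/(path_homotopic_trans (concat_cstr _)).
exact: concat_homotopic_cstl.
Qed.

(** The relations between holonomies in a mapping torus and the cocycle relation
    are instances of this one, for suitable maps of the square. *)
Lemma holonomy_square (H : I * I -> X) : continuous H ->
  (holonomy (fun t => H (zero, t)) * holonomy (fun t => H (t, one)) =
   holonomy (fun t => H (t, zero)) * holonomy (fun t => H (one, t)))%g.
Proof.
move=> cH.
have c1 : continuous (fun t => H (zero, t)).
  apply: (continuous_compE _ cH); apply: (continuous_pairE _ _) => [|t].
    exact: cst_continuous.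
  exact: cvg_id.
have c2 : continuous (fun t => H (t, one)).
  apply: (continuous_compE _ cH); apply: (continuous_pairE _ _) => [t|].
    exact: cvg_id.
  exact: cst_continuous.
have c3 : continuous (fun t => H (t, zero)).
  apply: (continuous_compE _ cH); apply: (continuous_pairE _ _) => [t|].
    exact: cvg_id.
  exact: cst_continuous.
have c4 : continuous (fun t => H (one, t)).
  apply: (continuous_compE _ cH); apply: (continuous_pairE _ _) => [|t].
    exact: cst_continuous.
  exact: cvg_id.
pose a := @mk_path I X (H (zero, zero)) (H (zero, one)) _ c1 erefl erefl.
pose b := @mk_path I X (H (zero, one)) (H (one, one)) _ c2 erefl erefl.
pose d := @mk_path I X (H (zero, zero)) (H (one, zero)) _ c3 erefl erefl.
pose e := @mk_path I X (H (one, zero)) (H (one, one)) _ c4 erefl erefl.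
change (holonomy a * holonomy b = holonomy d * holonomy e)%g.
rewrite -!holonomy_concat.
by apply: holonomy_homotopic; exact: (@square_homotopic _ _ _ _ _ _ H).
Qed.

Definition subpath (g : R -> X) (a b : R) : I -> X :=
  fun t => g (a + (b - a) * ival t).

Lemma subpath_continuous g a b : continuous g -> continuous (subpath g a b).
Proof.
move=> cg; apply: (continuous_compE _ cg).
rewrite (_ : (fun t => _) = (fun t : I => (b - a) * ival t + a)).
  exact: (continuous_affine _ _ ival_continuous).
by apply/funext => t; rewrite addrC.
Qed.

Lemma holonomy_subpath g a b d : continuous g ->
  (holonomy (subpath g a b) * holonomy (subpath g b d) = holonomy (subpath g a d))%g.
Proof.
move=> cg.
(* a square whose edges run from a to b, from b to d, stay at a, and run from a to d *)
pose H (st : I * I) := g (a + (1 - ival st.1) * (ival st.2 * (b - a)) +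
  ival st.1 * (ival st.2 * (d - a) + (1 - ival st.2) * 0)).
have cH : continuous H.
  have cf1 : continuous (fun st : I * I => ival st.1).
    exact: (continuous_compE continuous_fstE ival_continuous).
  have cf2 : continuous (fun st : I * I => ival st.2).
    exact: (continuous_compE continuous_sndE ival_continuous).
  apply: (continuous_compE _ cg) => st.
  have h1 := cf1 st; have h2 := cf2 st.
  apply: cvgD; first apply: cvgD; first exact: cvg_cst.
    apply: cvgM; first by apply: cvgB => //; exact: cvg_cst.
    by apply: cvgM => //; exact: cvg_cst.
  apply: cvgM => //; apply: cvgD.
    by apply: cvgM => //; exact: cvg_cst.
  apply: cvgM; last exact: cvg_cst.
  by apply: cvgB => //; exact: cvg_cst.
have := holonomy_square cH.
have -> : (fun t => H (zero, t)) = subpath g a b.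
  by apply/funext => t; rewrite /H /subpath /= ival0; congr g; ring.
have -> : (fun t => H (t, one)) = subpath g b d.
  by apply/funext => t; rewrite /H /subpath /= ival1; congr g; ring.
have -> : (fun t => H (t, zero)) = cst (g a).
  by apply/funext => t; rewrite /H /subpath /= ival0; congr g; ring.
have -> : (fun t => H (one, t)) = subpath g a d.
  by apply/funext => t; rewrite /H /subpath /= ival1; congr g; ring.
by rewrite holonomy_cst mul1g.
Qed.

(** A local-to-global principle replacing subdivision: the twisted holonomy of
    the initial segment of a path lies in K for a clopen set of end times. *)
Lemma holonomy_local_global (K : set pi1) (b : X -> pi1) :
  subgroup_set K ->
  (forall x, exists U : set X, [/\ open U, U x &
     forall p : I -> X, continuous p -> (forall t, U (p t)) ->
       K (b (p zero) * holonomy p * (b (p one))^-1)%g]) ->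
  forall p : I -> X, continuous p -> K (b (p zero) * holonomy p * (b (p one))^-1)%g.
Proof.
move=> [K1 KM KV] loc p cp.
pose g (t : R) := p (clamp t).
have cg : continuous g := continuous_compE clamp_continuous cp.
pose P := [set t : R | K (b (g 0) * holonomy (subpath g 0 t) * (b (g t))^-1)%g].
suff : P 1.
  rewrite /P /=; have -> : subpath g 0 1 = p.
    by apply/funext => t; rewrite /subpath subr0 mul1r add0r /g ivalK.
  by rewrite /g clamp_le0// clamp_ge1.
apply: (@locally_constant_connected _ _ 0).
- by apply/connected_intervalP => x y.
- rewrite /P /= (_ : subpath g 0 0 = cst (g 0)); last first.
    by apply/funext => t; rewrite /subpath subrr mul0r addr0.
  by rewrite holonomy_cst mulg1 mulgV.
move=> t0; have [U [oU Ut0 KU]] := loc (g t0).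
have : nbhs t0 (g @^-1` U) by apply: (cg t0); exact: open_nbhs_nbhs.
move=> /nbhs_ballP[e /= e0 eU].
have KE t : ball t0 e t ->
    K (b (g t0) * holonomy (subpath g t0 t) * (b (g t))^-1)%g.
  move=> te; have := KU (subpath g t0 t) (subpath_continuous cg).
  rewrite {2 4}/subpath ival0 ival1 mulr0 mulr1 addr0 addrC subrK; apply=> s.
  apply: eU; move: te; rewrite /ball /= opprD addrA subrr sub0r normrN normrM.
  rewrite distrC; apply: le_lt_trans; rewrite -[leRHS]mulr1 ler_wpM2l//.
  by rewrite ger0_norm ?ival_ge0 ?ival_le1.
near=> t; have te : ball t0 e t by near: t; exact: nbhsx_ballx.
have Kt := KE t te.
have E : (b (g 0) * holonomy (subpath g 0 t) * (b (g t))^-1 =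
   (b (g 0) * holonomy (subpath g 0 t0) * (b (g t0))^-1) *
   (b (g t0) * holonomy (subpath g t0 t) * (b (g t))^-1))%g.
  by rewrite -(holonomy_subpath 0 t0 t cg) !mulgA mulgVK.
rewrite /P /= E; split; last by move=> h; exact: KM.
by move=> h; have := KM _ _ h (KV _ Kt); rewrite mulgK.
Unshelve. all: by end_near.
Qed.
End holonomy.

(** * Finite generation of the fundamental group *)

Lemma near_seq (T : topologicalType) (J : eqType) (s : seq J) (P : J -> set T) (x : T) :
  (forall j, j \in s -> \forall y \near x, P j y) ->
  \forall y \near x, forall j, j \in s -> P j y.
Proof.
elim: s => [|j s IH] h; first by near=> y => k; rewrite in_nil.
have h1 := h j (mem_head _ _).
have h2 : \forall y \near x, forall k, k \in s -> P k y.
  by apply: IH => k ks; apply: h; rewrite in_cons ks orbT.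
near=> y => k; rewrite in_cons => /predU1P[->|]; first by near: y.
by move: k; near: y.
Unshelve. all: by end_near.
Qed.

(** Near covering along the filter of finite sequences ordered by inclusion. *)
Lemma compact_finite_subcover (T : topologicalType) (A : set T) (U : T -> set T) :
  compact A -> (forall x, A x -> nbhs x (U x)) ->
  exists s : seq T, forall y, A y -> exists2 x, x \in s & U x y.
Proof.
move=> /compact_near_coveringP cA nU.
pose F : set_system (seq T) :=
  [set B | exists s0 : seq T, forall s : seq T, {subset s0 <= s} -> B s].
have FF : Filter F.
  split; first by exists [::].
  - move=> P Q [s1 h1] [s2 h2]; exists (s1 ++ s2) => s h; split.
      by apply: h1 => x xs; apply: h; rewrite mem_cat xs.
    by apply: h2 => x xs; apply: h; rewrite mem_cat xs orbT.
  - by move=> P Q PQ [s1 h1]; exists s1 => s h; apply/PQ/h1.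
have [s0 hs0] : \forall s \near F, A `<=` [set y | exists2 x, x \in s & U x y].
  apply: cA => x Ax.
  exists (U x, [set s : seq T | x \in s]).
    split => /=; first exact: nU.
    by exists [:: x] => s; apply; rewrite mem_head.
  by move=> [y s] /= [Uxy xs]; exists x.
by exists s0; exact: hs0.
Qed.

Section cells.
Variables (R : realType) (X : topologicalType).
Local Notation I := (unit_interval R).

(** A substitute for contractible open sets.  The homotopies may leave V, so that
    the last clause is inherited by subsets. *)
Definition cell (V : set X) : Prop :=
  [/\ open V,
    forall y z, V y -> V z ->
      exists p : {path I from y to z}, forall t, V (p t) &
    forall y z (p q : {path I from y to z}),
      (forall t, V (p t)) -> (forall t, V (q t)) -> path_homotopic p q].

Definition has_cells : Prop :=
  forall x (U : set X), nbhs x U -> exists V, [/\ cell V, V x & V `<=` U].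

Lemma based_path_family (x0 : X) :
  (forall x, exists _ : {path I from x0 to x}, True) ->
  exists c : forall x, {path I from x0 to x}, c x0 =1 cst x0.
Proof.
move=> h.
have h' x : exists p : {path I from x0 to x}, x = x0 -> p =1 cst x0.
  have [xx0|nx] := EM (x = x0).
    by move: xx0; case: _ /; exists (cst x).
  by have [p _] := h x; exists p.
exists (fun x => projT1 (cid (h' x))).
exact: (projT2 (cid (h' x0))).
Qed.

Lemma path_connected (x0 : X) : connected [set: X] -> has_cells ->
  exists c : forall x, {path I from x0 to x}, c x0 =1 cst x0.
Proof.
move=> cX cells; apply: based_path_family.
pose P := [set x : X | exists _ : {path I from x0 to x}, True].
apply: (@locally_constant_connected _ P x0) => //.
  by exists (cst x0 : {path I from x0 to x0}).
move=> x; have [V [[oV pV _] Vx _]] := cells x setT filterT.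
have nV : nbhs x V by exact: open_nbhs_nbhs.
apply: filterS nV => y Vy; split=> -[p _].
  by have [q _] := pV _ _ Vy Vx; exists (concat p q).
by have [q _] := pV _ _ Vx Vy; exists (concat p q).
Qed.

(** Shrink finitely many of the given sets to sets W x with closure in U x.  The
    neighbourhood N y is cut out by all conditions that y satisfies: it lies in
    every U x with y in the closure of W x and avoids the other closures.  A
    common point of N y and N z lies in some W x, and then so do y and z up to
    closure, which puts both neighbourhoods into U x. *)
Lemma star_refinement (Q : set X -> Prop) : hausdorff_space X -> compact [set: X] ->
  (forall x, exists U, [/\ open U, U x & Q U]) ->
  exists N : X -> set X, (forall y, nbhs y (N y)) /\
    forall y z w, N y w -> N z w -> exists U, [/\ Q U, N y `<=` U & N z `<=` U].
Proof.
move=> hX cX /choice[U UP].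
have /choice[W WP] x : exists B, nbhs x B /\ closure B `<=` U x.
  have nU : nbhs x (U x) by have [oU Ux _] := UP x; exact: open_nbhs_nbhs.
  have [B nB BU] := @compact_regular _ x _ hX cX filterT _ nU.
  by exists B; split.
have [s sP] := compact_finite_subcover cX (fun x _ => (WP x).1).
exists (fun y => [set z | forall x, x \in s ->
  (closure (W x) y -> U x z) /\ (~ closure (W x) y -> ~ closure (W x) z)]).
have key y w x : x \in s -> W x w ->
    (forall x, x \in s -> (closure (W x) y -> U x w) /\
      (~ closure (W x) y -> ~ closure (W x) w)) -> closure (W x) y.
  move=> xs Ww h; have [//|nWy] := EM (closure (W x) y).
  by have [_ /(_ nWy)] := h x xs; case; exact: subset_closure.
split=> [y|y z w hy hz].
  apply: near_seq => x xs; have [cy|ncy] := EM (closure (W x) y).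
    have nU : nbhs y (U x).
      by have [oU _ _] := UP x; apply: open_nbhs_nbhs; split=> //; exact: (WP x).2.
    by apply: filterS nU => z Uz; split.
  have nC : nbhs y (~` closure (W x)).
    by apply: open_nbhs_nbhs; split => //; exact/closed_openC/closed_closure.
  by apply: filterS nC => z Uz; split.
have [x xs Wxw] := sP w Logic.I.
have cy := key y w x xs Wxw hy; have cz := key z w x xs Wxw hz.
exists (U x); split; first by have [] := UP x.
  by move=> v hv; exact: (hv x xs).1.
by move=> v hv; exact: (hv x xs).1.
Qed.
End cells.

Section finite_generation.
Variables (R : realType) (X : topologicalType) (x0 : X).
Local Notation I := (unit_interval R).

(** Cover X by finitely many cells V y so small that any two that meet lie in a
    common cell U.  Inside U all paths between the centres y and z are homotopic,
    so the pair (y, z) contributes a single class; holonomies, twisted by the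
    class of a path joining each point to the centre of a cell containing it,
    are products of these finitely many classes. *)
Theorem pi1_finitely_generated :
  hausdorff_space X -> compact [set: X] -> connected [set: X] -> has_cells R X ->
  exists Sigma : seq (fundamental_group R x0), forall g, span_set Sigma g.
Proof.
move=> hX cX conX cells.
have [c c0] := path_connected x0 conX cells.
pose hol := holonomy c.
have [N [nN starN]] : exists N : X -> set X, (forall y, nbhs y (N y)) /\
    forall y z w, N y w -> N z w ->
      exists U, [/\ cell R U, N y `<=` U & N z `<=` U].
  apply: star_refinement => // x.
  by have [V [cV Vx _]] := cells x _ filterT; exists V; split=> //; case: cV.
have /choice[V VP] y := cells y (N y) (nN y).
have nV y : nbhs y (V y).
  by have [[oV _ _] Vy _] := VP y; exact: open_nbhs_nbhs.
have [s sP] := compact_finite_subcover cX (fun x _ => nV x).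
have {sP}/choice[j jP] x : exists y, y \in s /\ V y x.
  by have [y ys Vyx] := sP x Logic.I; exists y.
(* e y z is the class shared by all paths from y to z that run through V y and
   then V z *)
have eP y z : exists e, forall w (p : {path I from y to w}) (q : {path I from w to z}),
    (forall t, V y (p t)) -> (forall t, V z (q t)) -> (hol p * hol q)%g = e.
  have [[w0 [Vyw0 Vzw0]]|nw] := EM (exists w, V y w /\ V z w); last first.
    exists 1%g => w p q Vp Vq; exfalso; apply: nw; exists w.
    by have := conj (Vp one) (Vq zero); rewrite path_one path_zero.
  have [[_ cy _] Vy VNy] := VP y; have [[_ cz _] Vz VNz] := VP z.
  have [U [[_ _ hU] NyU NzU]] := starN _ _ _ (VNy _ Vyw0) (VNz _ Vzw0).
  have [p0 Vp0] := cy _ _ Vy Vyw0; have [q0 Vq0] := cz _ _ Vzw0 Vz.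
  exists (hol p0 * hol q0)%g => w p q Vp Vq.
  rewrite /hol -!(holonomy_concat c); apply: holonomy_homotopic.
  by apply: hU => t; rewrite /= /mk_path /concat_fun; case: ifP => _;
    [apply/NyU/VNy|apply/NzU/VNz|apply/NyU/VNy|apply/NzU/VNz].
pose e y z := projT1 (cid (eP y z)).
have eE y z w (p : {path I from y to w}) (q : {path I from w to z}) :
    (forall t, V y (p t)) -> (forall t, V z (q t)) -> (hol p * hol q)%g = e y z.
  exact: (projT2 (cid (eP y z))).
have leg y x : exists p : {path I from y to x}, V y x -> forall t, V y (p t).
  have [Vyx|nV'] := EM (V y x).
    have [[_ h _] Vy _] := VP y.
    by have [p pV] := h _ _ Vy Vyx; exists p.
  by exists (concat (reverse (c y)) (c x)).
pose l y x : {path I from y to x} := projT1 (cid (leg y x)).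
have lP y x : V y x -> forall t, V y (l y x t) := projT2 (cid (leg y x)).
pose b x := hol (l (j x) x).
(* twisting by b changes the class of a loop by conjugation with b x0 *)
pose Sigma := b x0 :: [seq e y z | y <- s, z <- s].
exists Sigma.
have [K1 KM KV] := span_subgroup Sigma; set K := span_set Sigma in K1 KM KV.
have Ke y z : y \in s -> z \in s -> K (e y z).
  by move=> ys zs; apply: span_mem; rewrite in_cons allpairs_f ?orbT.
have loc : forall p : I -> X, continuous p ->
    K (b (p zero) * hol p * (b (p one))^-1)%g.
  apply: (@holonomy_local_global _ _ _ c K b) => [|x]; first by split.
  exists (V (j x)); have [js Vjx] := jP x.
  have [[oV _ hV] _ _] := VP (j x); split=> // p cp Vp.
  pose p' := @mk_path I X (p zero) (p one) p cp erefl erefl.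
  set y := j x in js Vjx Vp oV hV *; set a := p zero; set a' := p one.
  have [Va Va'] : V y a /\ V y a' by split; exact: Vp.
  (* p is homotopic inside V y to the detour through the centre y *)
  have -> : holonomy c p = ((hol (l y a))^-1 * hol (l y a'))%g.
    apply: (@mulgI _ (hol (l y a))); rewrite mulVKg.
    rewrite -[holonomy c p]/(hol p') /hol -(holonomy_concat c).
    apply: holonomy_homotopic; apply: hV => t; last exact: lP.
    by rewrite /= /mk_path /concat_fun; case: ifP => _; [exact: lP|exact: Vp].
  have E z : V y z -> K (b z * (hol (l y z))^-1)%g.
    move=> Vyz; have [jzs Vz] := jP z.
    have -> : (b z * (hol (l y z))^-1 = e (j z) y)%g.
      rewrite /hol -(holonomy_reverse c); apply: eE => t; first exact: lP.
      by rewrite /= /mk_path /reverse_fun; exact: lP.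
    exact: Ke.
  have -> : (b a * ((hol (l y a))^-1 * hol (l y a')) * (b a')^-1 =
     (b a * (hol (l y a))^-1) * (b a' * (hol (l y a'))^-1)^-1)%g.
    by rewrite invgM invgK !mulgA.
  by apply: KM; [exact: E|apply: KV; exact: E].
move=> g; rewrite -[g]homotopy_class_repr; set p := repr g.
have := loc p (@cts_fun _ _ p).
rewrite /hol (holonomy_loop c0) (@path_zero _ _ _ _ p) (@path_one _ _ _ _ p) => Kg.
have Kb : K (b x0) by apply: span_mem; rewrite mem_head.
have := KM _ _ (KM _ _ (KV _ Kb) Kg) Kb.
by rewrite !mulgA mulVg mul1g mulgVK.
Qed.
End finite_generation.

(** * Cells in a surface *)

Section charts.
Variables (R : realType) (X : topologicalType).
Local Notation I := (unit_interval R).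

Lemma continuous_comp_within (Z T U : topologicalType) (A : set T) (h : Z -> T)
    (g : T -> U) : continuous h -> (forall z, A (h z)) ->
  {within A, continuous g} -> continuous (fun z => g (h z)).
Proof.
move=> ch Ah /subspace_continuousP cg z B nB.
have := cg _ (Ah z) B nB; rewrite /= nbhs_simpl /within /= => hB.
have := ch z _ hB; rewrite /= nbhs_simpl /=.
by apply: filterS => z' /(_ (Ah z')).
Qed.

Definition segment (v w : R * R) (s : R) : R * R :=
  ((1 - s) * v.1 + s * w.1, (1 - s) * v.2 + s * w.2).

Lemma segment_continuous (Z : topologicalType) (a b : Z -> R * R) (s : Z -> R) :
  continuous a -> continuous b -> continuous s ->
  continuous (fun z => segment (a z) (b z) (s z)).
Proof.
move=> ca cb cs; apply: continuous_pairE => z;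
  (apply: cvgD; apply: cvgM; last 1 [idtac]; do ?
  [by apply: cvgB; [exact: cvg_cst|exact: cs] | exact: cs
  |exact: (continuous_compE ca continuous_fstE)
  |exact: (continuous_compE cb continuous_fstE)
  |exact: (continuous_compE ca continuous_sndE)
  |exact: (continuous_compE cb continuous_sndE)]).
Qed.

Lemma segment_id v s : segment v v s = v.
Proof. by case: v => a b; congr (_, _); rewrite /= -mulrDl subrK mul1r. Qed.

Lemma segment0 v w : segment v w 0 = v.
Proof. by case: v => a b; rewrite /segment subr0 !mul1r !mul0r !addr0. Qed.

Lemma segment1 v w : segment v w 1 = w.
Proof. by case: w => a b; rewrite /segment subrr !mul1r !mul0r !add0r. Qed.

Lemma segment_ball (v0 v w : R * R) (e s : R) : 0 <= s <= 1 ->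
  ball v0 e v -> ball v0 e w -> ball v0 e (segment v w s).
Proof.
move=> s01.
have h (x a b : R) : `|x - a| < e -> `|x - b| < e ->
    `|x - ((1 - s) * a + s * b)| < e.
  rewrite !ltr_norml => /andP[a1 a2] /andP[b1 b2].
  (* one of the two weights is at least 1/2, which makes the inequality strict *)
  case: (lerP s 2^-1) => s2; apply/andP; split; nra.
by move=> [/= h1 h2] [/= h3 h4]; split; rewrite /= /ball /=; exact: h.
Qed.

Lemma segment_half_plane (v w : R * R) (s : R) : 0 <= s <= 1 ->
  half_plane v -> half_plane w -> half_plane (segment v w s).
Proof.
rewrite /half_plane /= => /andP[s0 s1] v0 w0.
by rewrite addr_ge0// mulr_ge0// subr_ge0.
Qed.

(** A small ball of the half plane is convex, so its image under a chart is
    path connected and its paths are homotopic along straight lines. *)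
Lemma surface_has_cells : (forall x : X, has_chart (@half_plane R) x) -> has_cells R X.
Proof.
move=> chart x U0 nU0; have [U [W [f [g [[oU Ux oW] [cf cg fP gP]]]]]] := chart x.
set H := @half_plane R in cg fP gP.
have [Wfx gfx] := fP x Ux.
have : nbhs (f x) [set w | W w /\ ((W `&` H) w -> U0 (g w))].
  apply: filterI; first by apply: open_nbhs_nbhs; split=> //; case: Wfx.
  have /subspace_continuousP/(_ _ Wfx) := cg.
  have gU0 : nbhs (g (f x)) U0 by rewrite gfx.
  by move=> /(_ U0 gU0).
move=> /nbhs_ballP[e /= e0 eP].
pose B := ball (f x) e.
have cfU y : U y -> {for y, continuous f}.
  move=> Uy; move: cf; rewrite continuous_open_subspace// => cf.
  by apply: cf; apply/mem_set.
pose V := U `&` f @^-1` B.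
have VB y : V y -> (W `&` H `&` B) (f y).
  by move=> [Uy By]; split=> //; exact: (fP _ Uy).1.
have BV v w s : 0 <= s <= 1 -> (H `&` B) v -> (H `&` B) w ->
    (W `&` H) (segment v w s) /\ V (g (segment v w s)).
  move=> s01 [Hv Bv] [Hw Bw]; have Bs := segment_ball s01 Bv Bw.
  have WH : (W `&` H) (segment v w s).
    by split; [exact: (eP _ Bs).1|exact: segment_half_plane].
  by split=> //; have [Ug fg] := gP _ WH; split=> //; rewrite /preimage /= fg.
have s01 t : 0 <= ival (t : I) <= 1 by rewrite ival_ge0 ival_le1.
exists V; split; [split| |].
- rewrite openE => y [Uy By]; apply: filterI; first exact: open_nbhs_nbhs.
  by apply: (cfU _ Uy); apply: open_nbhs_nbhs; split=> //; exact: ball_open.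
- move=> y z Vy Vz; have [[WHy Hy] By] := VB y Vy; have [[WHz Hz] Bz] := VB z Vz.
  pose l (t : I) := segment (f y) (f z) (ival t).
  have cl : continuous (fun t => g (l t)).
    apply: (continuous_comp_within (A := W `&` H)) => // [|t].
      by apply: segment_continuous; [exact: cst_continuous..|exact: ival_continuous].
    exact: (BV _ _ _ (s01 t) (conj Hy By) (conj Hz Bz)).1.
  have l0 : g (l zero) = y.
    by rewrite /l ival0 segment0; exact: (fP _ Vy.1).2.
  have l1 : g (l one) = z.
    by rewrite /l ival1 segment1; exact: (fP _ Vz.1).2.
  exists (@mk_path I X y z _ cl l0 l1) => t.
  exact: (BV _ _ _ (s01 t) (conj Hy By) (conj Hz Bz)).2.
- move=> y z p q Vp Vq.
  have cfp (r : {path I from y to z}) : (forall t, V (r t)) -> continuous (f \o r).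
    move=> Vr t; apply: continuous_comp; first exact: (@cts_fun _ _ r).
    by apply: cfU; case: (Vr t).
  exists (fun st => g (segment (f (p st.2)) (f (q st.2)) (ival st.1))); split.
  + apply: (continuous_comp_within (A := W `&` H)) => // [|st].
      apply: segment_continuous.
      * exact: (continuous_compE continuous_sndE (cfp p Vp)).
      * exact: (continuous_compE continuous_sndE (cfp q Vq)).
      * exact: (continuous_compE continuous_fstE ival_continuous).
    have [[_ Hy] By] := VB _ (Vp st.2); have [[_ Hz] Bz] := VB _ (Vq st.2).
    exact: (BV _ _ _ (s01 _) (conj Hy By) (conj Hz Bz)).1.
  + by move=> t /=; rewrite ival0 segment0; exact: (fP _ (Vp t).1).2.
  + by move=> t /=; rewrite ival1 segment1; exact: (fP _ (Vq t).1).2.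
  + move=> s /=.
    rewrite (@path_zero _ _ _ _ p) (@path_zero _ _ _ _ q).
    rewrite (@path_one _ _ _ _ p) (@path_one _ _ _ _ q) !segment_id.
    split.
      have := (fP _ (Vp zero).1).2; by rewrite (@path_zero _ _ _ _ p).
    have := (fP _ (Vp one).1).2; by rewrite (@path_one _ _ _ _ p).
- by split=> //; exact: ballxx.
- move=> y Vy; have [[Wy Hy] By] := VB y Vy.
  by have := (eP _ By).2 (conj Wy Hy); rewrite (fP _ Vy.1).2.
Qed.
End charts.

(** * The fundamental group of a mapping torus *)

Lemma pi1_map_holonomy (R : realType) (X Y : topologicalType)
    (f : continuousType X Y) (x0 : X)
    (c : forall x, {path unit_interval R from x0 to x})
    (d : forall y, {path unit_interval R from f x0 to y})
    (d0 : d (f x0) =1 cst (f x0))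
    (x y : X) (p : {path unit_interval R from x to y}) :
  (pi1_map f (holonomy c p) = holonomy d (f \o c x) * holonomy d (f \o p) *
    (holonomy d (f \o c y))^-1)%g.
Proof.
rewrite holonomyE /close_up pi1_mapE -(holonomy_loop d0).
pose fp (a b : X) (q : {path unit_interval R from a to b}) :=
  (f \o q : {path unit_interval R from f a to f b}).
have -> : (f \o concat (concat (c x) p) (reverse (c y)) :
      {path unit_interval R from f x0 to f x0}) =
    concat (concat (fp _ _ (c x)) (fp _ _ p)) (reverse (fp _ _ (c y))).
  apply/path_eqP => t; rewrite /= /mk_path /concat_fun /= /mk_path.
  rewrite /concat_fun /reverse_fun.
  by case: ifP => _ //; case: ifP.
by rewrite (holonomy_concat d) (holonomy_concat d) (holonomy_reverse d).
Qed.

Section mapping_torus_group.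
Variables (R : realType) (S : topologicalType) (phi psi : continuousType S S).
Hypotheses (phiK : cancel phi psi) (psiK : cancel psi phi).
Local Notation I := (unit_interval R).
Local Notation T := (mapping_torus R phi).
Local Open Scope quotient_scope.
Local Notation sm := (@seam R S phi).

Let proj (a : S * I) : T := \pi_{eq_quot (torus_equivRel R phi)} a.

Lemma proj_continuous : continuous proj.
Proof. exact: (@pi_continuous _ {eq_quot (torus_equivRel R phi)}). Qed.

Lemma projP a a' : proj a = proj a' <-> sm a = sm a'.
Proof. by split=> [/eqmodP/eqP|/eqP h]; last exact/eqmodP. Qed.

Lemma seam_idem a : sm (sm a) = sm a.
Proof.
rewrite {1}/seam; case: ifP => //; rewrite /seam; case: ifP => [_|-> //] /=.
by rewrite eq_sym => /eqP h; have /eqP := @zero_one_neq (I : bpTopologicalType); rewrite h.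
Qed.

(** The representative of a point of the torus at a level below 1. *)
Definition torus_lift (z : T) : S * I := sm (repr z).

Lemma torus_lift_proj a : torus_lift (proj a) = sm a.
Proof. by apply/projP; rewrite /proj reprK. Qed.

Lemma proj_torus_lift z : proj (torus_lift z) = z.
Proof.
by rewrite -[RHS]reprK; apply/projP; rewrite seam_idem.
Qed.

Lemma torus_lift_lt1 z : ival (torus_lift z).2 < 1.
Proof.
have h : (torus_lift z).2 != one.
  rewrite /torus_lift /seam; case: ifP => [_|-> //] /=; exact: zero_one_neq.
rewrite lt_neqAle ival_le1 andbT; apply: contra h => /eqP h.
by apply/eqP/ival_inj; rewrite ival1.
Qed.

Lemma torus_open (A : set T) : open (proj @^-1` A) -> open A.
Proof. by []. Qed.

(** The quotient map restricts to a quotient map over the open set A. *)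
Lemma torus_continuous_on (Z : topologicalType) (A : set T) (h : T -> Z) :
  open (proj @^-1` A) ->
  (forall a, A (proj a) -> {for a, continuous (fun a => h (proj a))}) ->
  forall z, A z -> {for z, continuous h}.
Proof.
move=> oA ch z Az B nB.
pose C := A `&` h @^-1` B^°.
have oC : open C.
  apply: torus_open; rewrite openE => a [Aa Ba]; apply: filterI.
    exact: open_nbhs_nbhs.
  by apply: (ch a Aa); apply: open_nbhs_nbhs; split=> //; exact: open_interior.
have nC : nbhs z C by apply: open_nbhs_nbhs; split=> //; split.
by apply: filterS nC => w [_]; exact: interior_subset.
Qed.

(** The suspension flow started on the fibre, for times in [0, 2]. *)
Definition torus_flow (xu : S * R) : T :=
  if xu.2 <= 1 then proj (xu.1, clamp xu.2) else proj (phi xu.1, clamp (xu.2 - 1)).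

Lemma torus_flow_continuous : continuous torus_flow.
Proof.
apply: glue_continuous.
- exact: continuous_sndE.
- apply: (continuous_compE _ proj_continuous).
  apply: (continuous_pairE continuous_fstE).
  exact: (continuous_compE continuous_sndE clamp_continuous).
- apply: (continuous_compE _ proj_continuous).
  apply: continuous_pairE.
    exact: (continuous_compE continuous_fstE (@cts_fun _ _ phi)).
  rewrite (_ : (fun y => _) = (fun y : S * R => clamp (1 * y.2 + -1))).
    exact: (continuous_clamp_affine continuous_sndE).
  by apply/funext => y; rewrite mul1r.
- move=> [x u] /= ->; apply/projP.
  by rewrite subrr (clamp_le0 (lexx 0)) (clamp_ge1 (lexx 1)) /seam /= eqxx (negbTE zero_one_neq).
Qed.

Lemma torus_flow0 x : torus_flow (x, 0) = fiber R phi x.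
Proof. by rewrite /torus_flow /= ler01 clamp_le0. Qed.

Lemma torus_flow_ge1 x u : 1 <= u -> u <= 2 ->
  torus_flow (x, u) = torus_flow (phi x, u - 1).
Proof.
move=> u1 u2; rewrite /torus_flow /=; case: leP => u1'.
  have -> : u = 1 by lra.
  rewrite subrr ler01; apply/projP.
  by rewrite (clamp_le0 (lexx 0)) (clamp_ge1 (lexx 1)) /seam /= eqxx (negbTE zero_one_neq).
by rewrite ifT//; lra.
Qed.

Lemma torus_flow_lift z : torus_flow ((torus_lift z).1, ival (torus_lift z).2) = z.
Proof.
by rewrite /torus_flow /= ival_le1 ivalK -surjective_pairing proj_torus_lift.
Qed.

Lemma torus_lift_flow x u : 0 <= u < 1 -> torus_lift (torus_flow (x, u)) = (x, clamp u).
Proof.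
move=> /andP[u0 u1]; rewrite /torus_flow /= ltW// torus_lift_proj /seam /= ifF//.
apply/eqP => /(congr1 (@ival R)); rewrite ival1 clampK; lra.
Qed.

(** The flow S x R -> T has local sections: over the levels in (0, 1) the obvious
    one, and across the seam the one taking values in S x (1/2, 3/2). *)
Lemma torus_local_lift (z : T) : exists (A : set T) (x : T -> S) (u : T -> R),
  [/\ open A, A z & forall w, A w ->
    [/\ {for w, continuous x}, {for w, continuous u},
      torus_flow (x w, u w) = w & 0 <= u w < 2]].
Proof.
have clev : continuous (fun a : S * I => ival a.2).
  exact: (continuous_compE continuous_sndE ival_continuous).
have c1 : continuous (fun a : S * I => a.1) by exact: continuous_fstE.
have olt (r : R) : open [set a : S * I | ival a.2 < r].
  exact: (open_comp (fun a _ => clev a) (open_lt (y := r))).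
have ogt (r : R) : open [set a : S * I | r < ival a.2].
  exact: (open_comp (fun a _ => clev a) (open_gt (y := r))).
have lt12 : 2^-1 < 1 :> R by lra.
have smE a : ival a.2 < 1 -> sm a = a.
  by rewrite /seam; case: eqP => // ->; rewrite ival1 ltxx.
have one_or (a : S * I) : a.2 = one \/ ival a.2 < 1.
  have [->|na] := eqVneq a.2 one; [by left|right].
  rewrite lt_neqAle ival_le1 andbT; apply: contra na => /eqP na.
  by apply/eqP/ival_inj; rewrite ival1.
have [zh|zh] := eqVneq (ival (torus_lift z).2) 2^-1.
  pose A := [set w : T | 0 < ival (torus_lift w).2].
  have AE a : A (proj a) <-> 0 < ival a.2 /\ ival a.2 < 1.
    rewrite /A /= torus_lift_proj; case: (one_or a) => [a1|a1]; last first.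
      by rewrite smE //; split=> [|[]].
    rewrite /seam a1 eqxx /= ival0 ival1 !ltxx.
    by split=> // -[].
  have oA : open (proj @^-1` A).
    rewrite (_ : _ @^-1` _ = [set a | 0 < ival a.2] `&` [set a | ival a.2 < 1]).
      exact: openI.
    by apply/seteqP; split=> a /=; rewrite AE.
  exists A, (fun w => (torus_lift w).1), (fun w => ival (torus_lift w).2).
  have Esm a : A (proj a) -> \forall b \near a, b = torus_lift (proj b).
    move=> Aa; have : nbhs a (proj @^-1` A) by exact: open_nbhs_nbhs.
    by apply: filterS => b /AE[_ b1]; rewrite torus_lift_proj smE.
  split; first exact: torus_open.
    by rewrite /A /= zh invr_gt0.
  move=> w Aw; split.
  - apply: (torus_continuous_on oA) Aw => a Aa.
    apply: (near_eq_continuous_at (f := fun b => b.1)).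
    + by apply: filterS (Esm a Aa) => b {1}->.
    + by rewrite {1}(nbhs_singleton (Esm a Aa)).
    + exact: c1.
  - apply: (torus_continuous_on oA) Aw => a Aa.
    apply: (near_eq_continuous_at (f := fun b => ival b.2)).
    + by apply: filterS (Esm a Aa) => b {1}->.
    + by rewrite {1}(nbhs_singleton (Esm a Aa)).
    + exact: clev.
  - exact: torus_flow_lift.
  - by rewrite ival_ge0 (lt_trans (torus_lift_lt1 w)) ?ltr1n.
pose A := [set w : T | ival (torus_lift w).2 != 2^-1].
have AE a : A (proj a) <-> 2^-1 < ival a.2 \/ ival a.2 < 2^-1.
  rewrite /A /= torus_lift_proj; case: (one_or a) => [a1|a1]; last first.
    rewrite smE // neq_lt; split=> [/orP[]|[->|->]]; rewrite ?orbT; by [right|left|].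
  rewrite /seam a1 eqxx /= ival0 ival1 lt12.
  by split=> _; [left|rewrite eq_sym invr_eq0 pnatr_eq0].
have oA : open (proj @^-1` A).
  rewrite (_ : _ @^-1` _ = [set a | 2^-1 < ival a.2] `|` [set a | ival a.2 < 2^-1]).
    exact: openU.
  by apply/seteqP; split=> a /=; rewrite AE.
pose x (w : T) := if 2^-1 < ival (torus_lift w).2 then (torus_lift w).1
  else psi (torus_lift w).1.
pose u (w : T) := if 2^-1 < ival (torus_lift w).2 then ival (torus_lift w).2
  else ival (torus_lift w).2 + 1.
have hi a : 2^-1 < ival a.2 -> x (proj a) = a.1 /\ u (proj a) = ival a.2.
  rewrite /x /u torus_lift_proj; case: (one_or a) => [a1|a1] ah.
    rewrite /seam a1 eqxx /= ival0 ival1 add0r ltNge invr_ge0 ler0n /=.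
    by rewrite phiK.
  by rewrite smE // ah.
have lo a : ival a.2 < 2^-1 -> x (proj a) = psi a.1 /\ u (proj a) = ival a.2 + 1.
  move=> ah; rewrite /x /u torus_lift_proj smE ?(lt_trans ah)//.
  by rewrite ltNge (ltW ah).
exists A, x, u; split; [exact: torus_open|exact: zh|].
move=> w Aw; split.
- apply: (torus_continuous_on oA) Aw => a /AE[ah|ah].
    apply: (near_eq_continuous_at (f := fun b => b.1)).
    + have : nbhs a [set b | 2^-1 < ival b.2] by exact: open_nbhs_nbhs.
      by apply: filterS => b /hi[-> _].
    + by rewrite (hi _ ah).1.
    + exact: c1.
  apply: (near_eq_continuous_at (f := fun b => psi b.1)).
  + have : nbhs a [set b | ival b.2 < 2^-1] by exact: open_nbhs_nbhs.
    by apply: filterS => b /lo[-> _].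
  + by rewrite (lo _ ah).1.
  + exact: (continuous_compE c1 (@cts_fun _ _ psi)).
- apply: (torus_continuous_on oA) Aw => a /AE[ah|ah].
    apply: (near_eq_continuous_at (f := fun b => ival b.2)).
    + have : nbhs a [set b | 2^-1 < ival b.2] by exact: open_nbhs_nbhs.
      by apply: filterS => b /hi[_ ->].
    + by rewrite (hi _ ah).2.
    + exact: clev.
  apply: (near_eq_continuous_at (f := fun b => ival b.2 + 1)).
  + have : nbhs a [set b | ival b.2 < 2^-1] by exact: open_nbhs_nbhs.
    by apply: filterS => b /lo[_ ->].
  + by rewrite (lo _ ah).2.
  + by apply: cvgD; [exact: clev|exact: cvg_cst].
- rewrite /x /u; case: ifP => _; first exact: torus_flow_lift.
  rewrite torus_flow_ge1 ?lerDr ?ival_ge0//; last by rewrite -[leRHS]/(1 + 1) lerD2r ival_le1.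
  by rewrite psiK addrK torus_flow_lift.
- have l0 := ival_ge0 (torus_lift w).2; have l1 := torus_lift_lt1 w.
  rewrite /u; case: ifP => _; apply/andP; split; lra.
Qed.

Section generators.
Variable s0 : S.
Variables (c : forall x : S, {path I from s0 to x}).
Hypothesis c0 : c s0 =1 cst s0.
Local Notation H := (fundamental_group R s0).
Local Notation G := (fundamental_group R (fiber R phi s0)).
Local Notation incl := (@pi1_map R S T (fiber R phi) s0).

(** The action of phi on the fundamental group, which moves the base point:
    the class of c (phi s0), then the image loop, then c (phi s0) backwards. *)
Definition monodromy (g : H) : H := holonomy c (phi \o repr g).

Lemma monodromyE (p : {path I from s0 to s0}) :
  monodromy (homotopy_class p) = holonomy c (phi \o p).
Proof.
pose image (r : {path I from s0 to s0}) := (phi \o r : {path I from phi s0 to phi s0}).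
rewrite /monodromy.
apply: (@holonomy_homotopic _ _ _ c _ _ (image (repr (homotopy_class p))) (image p)).
have /homotopy_classP[K [cK K0 K1 Ke]] := homotopy_class_repr (homotopy_class p).
exists (fun st => phi (K st)); split.
- exact: (continuous_compE cK (@cts_fun _ _ phi)).
- by move=> t; rewrite K0.
- by move=> t; rewrite K1.
- by move=> s; have [-> ->] := Ke s.
Qed.

Lemma monodromyM : {morph monodromy : g h / (g * h)%g}.
Proof.
move=> g h; rewrite -[g]homotopy_class_repr -[h]homotopy_class_repr.
move: (repr g) (repr h) => p q.
have -> : (homotopy_class p * homotopy_class q)%g = homotopy_class (concat p q).
  exact: pi1_mulE.
rewrite !monodromyE -(holonomy_concat c (phi \o p : {path I from phi s0 to phi s0})
  (phi \o q : {path I from phi s0 to phi s0})).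
congr holonomy; apply/funext => t.
by rewrite /= /mk_path /concat_fun /=; case: ifP.
Qed.

Lemma monodromy_surj g : exists g', monodromy g' = g.
Proof.
pose d := c (phi s0); pose e := holonomy c d.
pose p := repr (e * g * e^-1)%g.
(* a loop at phi s0 of holonomy g: the conjugation by e undoes the one by d *)
pose q := concat (concat (reverse d) p) d.
have cq : continuous (psi \o q).
  exact: (continuous_compE (@cts_fun _ _ q) (@cts_fun _ _ psi)).
have q0 : (psi \o q) zero = s0 by rewrite /= [q _]path_zero phiK.
have q1 : (psi \o q) one = s0 by rewrite /= [q _]path_one phiK.
exists (homotopy_class (@mk_path I S s0 s0 _ cq q0 q1)).
rewrite monodromyE (_ : phi \o _ = q); last first.
  by apply/funext => t; rewrite /= /mk_path /= psiK.
rewrite /q !(holonomy_concat c) holonomy_reverse (holonomy_loop c0).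
by rewrite /p homotopy_class_repr -/e !mulgA mulVg mul1g mulgVK.
Qed.

Variables (d : forall z : T, {path I from fiber R phi s0 to z}).
Hypothesis d0 : d (fiber R phi s0) =1 cst (fiber R phi s0).

(** beta joins the base point to (x, 0) inside the fibre and rise continues along
    the flow line to (x, u).  Twisting holonomies of the torus by their product
    moves them into the subgroup generated by pi1(S) and the stable letter. *)
Let beta (x : S) : G := holonomy d (fiber R phi \o c x).
Let rise (x : S) (u : R) : G := holonomy d (fun t => torus_flow (x, u * ival t)).

(** Once around the circle: up the flow line of s0 to the point phi s0 of the
    fibre, and back to s0 inside the fibre. *)
Definition stable_letter : G := (rise s0 1 * (beta (phi s0))^-1)%g.

Let beta0 : beta s0 = 1%g.
Proof.
rewrite /beta (_ : _ \o _ = cst (fiber R phi s0)) ?holonomy_cst //.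
by apply/funext => t; rewrite /= c0.
Qed.

(* The square over a path in S x R, filled by flow lines from level 0. *)
Let flow_square (x : I -> S) (u : I -> R) : continuous x -> continuous u ->
  (holonomy d (fiber R phi \o x) * rise (x one) (u one) =
   rise (x zero) (u zero) * holonomy d (fun t => torus_flow (x t, u t)))%g.
Proof.
move=> cx cu.
have cH : continuous (fun st : I * I => torus_flow (x st.2, u st.2 * ival st.1)).
  apply: (continuous_compE _ torus_flow_continuous).
  apply: (continuous_pairE (continuous_compE continuous_sndE cx)) => st.
  apply: cvgM; first exact: (continuous_compE continuous_sndE cu).
  exact: (continuous_compE continuous_fstE ival_continuous).
have := holonomy_square d cH => /=.
rewrite (_ : (fun t => torus_flow (x t, u t * ival zero)) = fiber R phi \o x); last first.
  by apply/funext => t; rewrite ival0 mulr0 torus_flow0.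
rewrite (_ : (fun t => torus_flow (x t, u t * ival one)) = (fun t => torus_flow (x t, u t))) //.
by apply/funext => t; rewrite ival1 mulr1.
Qed.

Let incl_holonomy x y (p : {path I from x to y}) :
  (incl (holonomy c p) = beta x * holonomy d (fiber R phi \o p) * (beta y)^-1)%g.
Proof. exact: pi1_map_holonomy. Qed.

(** The square over a loop p at s0, filled by flow lines up to level 1, compares
    the loop p at the bottom with the loop phi p at the top. *)
Lemma stable_letter_conj g :
  (incl g * stable_letter = stable_letter * incl (monodromy g))%g.
Proof.
rewrite -[g]homotopy_class_repr; set p := repr g.
rewrite monodromyE -(holonomy_loop c0).
rewrite !(incl_holonomy p) (incl_holonomy (phi \o p : {path I from phi s0 to phi s0})).
rewrite beta0 invg1 mul1g mulg1 /stable_letter !mulgA mulgVK; congr (_ * _)%g.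
have := flow_square (@cts_fun _ _ p) (u := cst 1) (fun t => @cst_continuous _ _ _ t).
rewrite /= (@path_zero _ _ _ _ p) (@path_one _ _ _ _ p) => ->; congr (_ * holonomy _ _)%g.
apply/funext => t; rewrite torus_flow_ge1 ?ler1n ?lexx ?subrr ?torus_flow0 //.
Qed.

(** Crossing the seam once over x amounts, up to the image of pi1(S), to the
    stable letter. *)
Let rise_cross x : exists h : H,
  (beta x * rise x 1 * (beta (phi x))^-1 = stable_letter * incl h)%g.
Proof.
exists (holonomy c (phi \o c x)).
rewrite (incl_holonomy (phi \o c x : {path I from phi s0 to phi x})).
rewrite /stable_letter !mulgA mulgVK; congr (_ * _)%g.
have := flow_square (@cts_fun _ _ (c x)) (u := cst 1) (fun t => @cst_continuous _ _ _ t).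
rewrite /= (@path_zero _ _ _ _ (c x)) (@path_one _ _ _ _ (c x)) -/(beta x) => ->.
congr (_ * holonomy _ _)%g.
apply/funext => t; rewrite torus_flow_ge1 ?ler1n ?lexx ?subrr ?torus_flow0 //.
Qed.

(** A short path of the torus lifts to S x R; the square of flow lines below the
    lift identifies its twisted holonomy with the class of a loop of S, except
    that the twist jumps by the stable letter where the lift crosses level 1. *)
Lemma mapping_torus_generated (K : set G) : subgroup_set K ->
  (forall g, K (incl g)) -> K stable_letter -> forall g, K g.
Proof.
move=> sK KH Kt; have [K1 KM KV] := sK.
pose b z := (beta (torus_lift z).1 * rise (torus_lift z).1 (ival (torus_lift z).2))%g.
(* b compares with the class of the flow line from any lift with level below 2 *)
have bP x u : 0 <= u < 2 -> K (b (torus_flow (x, u)) * (beta x * rise x u)^-1)%g.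
  move=> /andP[u0 u2]; have [u1|u1] := ltP u 1.
    rewrite /b torus_lift_flow ?u0 //= clampK ?u0 ?(ltW u1) //.
    by rewrite mulgV.
  have -> : b (torus_flow (x, u)) = (beta (phi x) * rise (phi x) (u - 1))%g.
    rewrite /b torus_flow_ge1 ?(ltW u2) // torus_lift_flow /=; last first.
      by apply/andP; split; lra.
    by rewrite clampK //; apply/andP; split; lra.
  have -> : rise x u = (rise x 1 * rise (phi x) (u - 1))%g.
    have cg : continuous (fun v : R => torus_flow (x, v)).
      apply: (continuous_compE _ torus_flow_continuous).
      apply: (continuous_pairE _ _) => [|v]; first exact: cst_continuous.
      exact: cvg_id.
    have E1 v : rise x v = holonomy d (subpath (fun v => torus_flow (x, v)) 0 v).
      congr holonomy; apply/funext => t.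
      by rewrite /subpath add0r subr0.
    have E2 : rise (phi x) (u - 1) = holonomy d (subpath (fun v => torus_flow (x, v)) 1 u).
      congr holonomy; apply/funext => t; rewrite /subpath.
      have t0 := ival_ge0 t; have t1 := ival_le1 t.
      by rewrite [RHS]torus_flow_ge1; [congr (torus_flow (_, _)); ring|nra|nra].
    by rewrite (E1 u) (E1 1) E2 holonomy_subpath.
  have [h hE] := rise_cross x.
  set r := rise (phi x) _.
  have -> : (beta (phi x) * r * (beta x * (rise x 1 * r))^-1 =
      (beta x * rise x 1 * (beta (phi x))^-1)^-1)%g.
    by rewrite !invgM invgK !mulgA mulgK.
  by rewrite hE; apply: KV; exact: KM.
have loc p : continuous p -> K (b (p zero) * holonomy d p * (b (p one))^-1)%g.
  apply: (holonomy_local_global (c := d) (K := K) (b := b)) => // z.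
  have [A [x [u [oA Az AP]]]] := torus_local_lift z.
  exists A; split=> // {}p cp Ap.
  have cx : continuous (x \o p).
    move=> t; have [cx _ _ _] := AP _ (Ap t).
    by apply: continuous_comp; [exact: cp|exact: cx].
  have cu : continuous (u \o p).
    move=> t; have [_ cu _ _] := AP _ (Ap t).
    by apply: continuous_comp; [exact: cp|exact: cu].
  have pE : p = (fun t => torus_flow ((x \o p) t, (u \o p) t)).
    by apply/funext => t; have [_ _ <- _] := AP _ (Ap t).
  have sq := flow_square cx cu; rewrite -pE in sq.
  set x1 := (x \o p) zero in sq; set x2 := (x \o p) one in sq.
  set u1 := (u \o p) zero in sq; set u2 := (u \o p) one in sq.
  have ub t : 0 <= (u \o p) t < 2 by have [_ _ _] := AP _ (Ap t).
  have Kb1 := bP x1 u1 (ub _); have Kb2 := bP x2 u2 (ub _).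
  have p0E : torus_flow (x1, u1) = p zero by rewrite [RHS](congr1 (@^~ zero) pE).
  have p1E : torus_flow (x2, u2) = p one by rewrite [RHS](congr1 (@^~ one) pE).
  rewrite {}p0E in Kb1; rewrite {}p1E in Kb2.
  pose xp := @mk_path I S x1 x2 (x \o p) cx erefl erefl.
  have := KM _ _ (KM _ _ Kb1 (KH (holonomy c xp))) (KV _ Kb2).
  rewrite (incl_holonomy xp) -[fiber R phi \o xp]/(fiber R phi \o (x \o p)).
  set f := holonomy d (fiber R phi \o _) in sq *; set b1 := b _; set b2 := b _.
  set B1 := beta x1; set B2 := beta x2; set r1 := rise x1 u1 in sq *.
  set r2 := rise x2 u2 in sq *.
  have -> : (b1 * (B1 * r1)^-1 * (B1 * f * B2^-1) * (b2 * (B2 * r2)^-1)^-1 =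
      b1 * r1^-1 * (f * r2) * b2^-1)%g.
    by rewrite !invgM !invgK !mulgA !mulgVK.
  by rewrite sq !mulgA mulgVK.
move=> g; rewrite -[g]homotopy_class_repr; set p := repr g.
have := loc p (@cts_fun _ _ p).
rewrite (holonomy_loop d0) (@path_zero _ _ _ _ p) (@path_one _ _ _ _ p).
have Kb : K (b (fiber R phi s0)).
  have h0 : 0 <= (0 : R) < 2 by rewrite lexx ltr0n.
  have := bP s0 0 h0; rewrite torus_flow0 beta0 mul1g.
  rewrite (_ : rise s0 0 = 1%g) ?invg1 ?mulg1 //.
  rewrite /rise (_ : (fun t => _) = cst (fiber R phi s0)) ?holonomy_cst //.
  by apply/funext => t; rewrite mul0r torus_flow0.
move: (b _) Kb => b0 Kb Kg; have := KM _ _ (KM _ _ (KV _ Kb) Kg) Kb.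
by rewrite !mulgA mulVg mul1g mulgVK.
Qed.
End generators.
End mapping_torus_group.

(** * Homomorphisms to the reals as cohomology classes *)

Section cohomology_of_homs.
Variables (R : realType) (X : topologicalType) (x0 : X).
Local Notation I := (unit_interval R).
Variable c : forall x : X, {path I from x0 to x}.
Hypothesis c0 : c x0 =1 cst x0.
Local Notation pi1 := (fundamental_group R x0).

Definition additive_on (G : groupType) (V : zmodType) (L : G -> V) : Prop :=
  forall g h, L (g * h)%g = L g + L h.

Lemma additive_on1 (G : groupType) (V : zmodType) (L : G -> V) :
  additive_on L -> L 1%g = 0.
Proof.
by move=> LM; apply: (addrI (L 1%g)); rewrite addr0 -LM mulg1.
Qed.

Lemma additive_onV (G : groupType) (V : zmodType) (L : G -> V) g :
  additive_on L -> L g^-1%g = - L g.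
Proof.
by move=> LM; apply: (addrI (L g)); rewrite subrr -LM mulgV additive_on1.
Qed.

Definition edge_row (t : I) : 'rV[R]_2 :=
  \row_(j < 2) if j == 0 then 1 - ival t else ival t.

Lemma edge_subproof (t : I) : edge_row t \in @std_simplex R 1.
Proof.
apply/mem_set; split=> [j|].
  by rewrite mxE; case: ifP => _; rewrite ?subr_ge0 ?ival_le1 ?ival_ge0.
by rewrite big_ord_recl big_ord1 !mxE /= subrK.
Qed.

Definition edge (t : I) : (@std_simplex R 1) := exist _ (edge_row t) (edge_subproof t).

Lemma edge_continuous : continuous edge.
Proof.
apply: continuous_comp_initial; apply: continuous_mx => i j.
rewrite [X in continuous X](_ : _ = fun t : I =>
    (if j == 0 then -1 else 1) * ival t + (if j == 0 then 1 else 0)).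
  exact: (continuous_affine _ _ ival_continuous).
by apply/funext => t; rewrite /= mxE; case: (j == 0); ring.
Qed.

(* Polar coordinates on the triangle: the side t = 0 of the square collapses to
   the first vertex. *)
Definition triangle_row (st : I * I) : 'rV[R]_3 :=
  \row_(j < 3) [:: 1 - ival st.2; ival st.2 * (1 - ival st.1);
    ival st.2 * ival st.1]`_j.

Lemma triangle_subproof st : triangle_row st \in @std_simplex R 2.
Proof.
have s0 := ival_ge0 st.1; have s1 := ival_le1 st.1.
have t0 := ival_ge0 st.2; have t1 := ival_le1 st.2.
apply/mem_set; split=> [j|].
  rewrite mxE; case: j => [[|[|[|j]]] hj] //=.
  - by rewrite subr_ge0.
  - by rewrite mulr_ge0// subr_ge0.
  - by rewrite mulr_ge0.
by rewrite !big_ord_recl big_ord0 !mxE /=; ring.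
Qed.

Definition triangle (st : I * I) : (@std_simplex R 2) := exist _ (triangle_row st) (triangle_subproof st).

Lemma triangle_continuous : continuous triangle.
Proof.
apply: continuous_comp_initial; apply: continuous_mx => i j.
have cf1 : continuous (fun st : I * I => ival st.1).
  exact: (continuous_compE continuous_fstE ival_continuous).
have cf2 : continuous (fun st : I * I => ival st.2).
  exact: (continuous_compE continuous_sndE ival_continuous).
rewrite [X in continuous X](_ : _ = fun st : I * I => [:: 1 - ival st.2;
    ival st.2 * (1 - ival st.1); ival st.2 * ival st.1]`_j); last first.
  by apply/funext => t; rewrite /= mxE.
have cB (f : I * I -> R) : continuous f -> continuous (fun st => 1 - f st).
  move=> cf st; apply: cvgB; [exact: cvg_cst|exact: cf].
have cM (f g : I * I -> R) : continuous f -> continuous g -> continuous (fun st => f st * g st).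
  by move=> cf cg st; apply: cvgM; [exact: cf|exact: cg].
case: j => [[|[|[|j]]] hj] //=; [exact: cB|apply: cM => //; exact: cB|exact: cM].
Qed.

(** The three remaining sides of the square run along the three faces. *)
Lemma coface_edge (i : 'I_3) (t : I) : coface i (edge t) =
  triangle (nth (t, one) [:: (t, one); (one, t); (zero, t)] i).
Proof.
apply: val_inj; apply/rowP => j; rewrite !mxE.
case: i j => [[|[|[|i]]] hi] [[|[|[|j]]] hj] //=;
  case: unliftP => [[[|[|k]] hk]|] //= /(congr1 val) //= _;
  by rewrite ?mxE /= ?ival0 ?ival1; ring.
Qed.

Definition hom_cochain (L : pi1 -> R) : cochain R 1 X :=
  fun s => L (holonomy c (s \o edge)).

(** The square relation for polar coordinates of a singular triangle is the
    cocycle relation. *)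
Lemma hom_cochain_cocycle (L : pi1 -> R) : additive_on L ->
  hom_cochain L \in is_cocycle (n := 1) (X := X).
Proof.
move=> LM; rewrite unfold_in; apply/eqP/funext => s.
rewrite /coboundary !big_ord_recl big_ord0 /hom_cochain.
have E (i : 'I_3) : face i s \o edge =
    (fun t => s (triangle (nth (t, one) [:: (t, one); (one, t); (zero, t)] i))).
  by apply/funext => t; rewrite -coface_edge.
have cH : continuous (fun st => s (triangle st)).
  exact: (continuous_compE triangle_continuous (@cts_fun _ _ s)).
have := congr1 L (holonomy_square c cH).
rewrite !LM (_ : (fun t => s (triangle (t, zero))) = cst (s (triangle (zero, zero)))); last first.
  apply/funext => t; congr (s _); apply: val_inj; apply/rowP => j; rewrite !mxE.
  by case: j => [[|[|[|j]]] hj] //=; rewrite ival0 !mul0r.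
rewrite holonomy_cst (additive_on1 LM) add0r => sq.
rewrite !E /= expr0 expr1 addr0 /= -[(-1) ^+ _]/((-1) ^+ 2) sqrrN expr1n !mul1r mulN1r.
by rewrite -sq [RHS](_ : _ = 0) //; ring.
Qed.

Definition hom_class (L : pi1 -> R) (LM : additive_on L) : cohomology R 1 X :=
  cohomology_class (Cocycle (hom_cochain_cocycle LM)).

Lemma hom_classP (a : R) (L1 L2 L : pi1 -> R) (h1 : additive_on L1)
    (h2 : additive_on L2) (h : additive_on L) :
  (forall g, L g = a * L1 g + L2 g) ->
  hom_class h = a *: hom_class h1 + hom_class h2.
Proof.
move=> LE; rewrite /hom_class [a *: _]cohomology_scaleE -cohomology_classD.
congr cohomology_class; apply: val_inj; apply/funext => s.
exact: LE.
Qed.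

(** A coboundary vanishes on the simplex of a loop. *)
Lemma hom_class_inj (L : pi1 -> R) (LM : additive_on L) :
  hom_class LM = 0 -> forall g, L g = 0.
Proof.
move=> L0 g; rewrite -[g]homotopy_class_repr; set p := repr g.
have : hom_class LM = cohomology_class (0 : cocycle R 1 X).
  rewrite L0; apply: (addrI (cohomology_class (0 : cocycle R 1 X))).
  by rewrite addr0 -cohomology_classD addr0.
move/cohomology_classP; rewrite subr0 /= => -[b _ bE].
have cs : continuous (fun t : (@std_simplex R 1) => p (clamp (val t 0 1))).
  apply: (continuous_compE _ (@cts_fun _ _ p)).
  apply: (continuous_compE _ clamp_continuous).
  apply: (@continuous_compE _ _ _ (set_val : @std_simplex R 1 -> _) (fun v : 'rV[R]_2 => v 0 1)).
    exact: initial_continuous.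
  exact: coord_continuous.
pose s0 : (@std_simplex R 1) -> X := fun t => p (clamp (val t 0 1)).
pose ms := isContinuous.Build _ _ s0 cs.
pose s : singular_simplex R 1 X := HB.pack s0 ms.
have sE : s \o edge = p.
  by apply/funext => t; rewrite /= /s0 /= mxE /= ivalK.
have := congr1 (fun f => f s) bE.
rewrite /hom_cochain sE (holonomy_loop c0) => <-.
rewrite /coboundary !big_ord_recl big_ord0 addr0 expr0 expr1 mul1r mulN1r.
suff -> : face ord0 s = face (fintype.lift ord0 ord0) s by rewrite subrr.
apply/continuousEP => t; rewrite /= /s0 /= !mxE.
have t1 : val t 0 0 = 1.
  by case: t => t ht; have [_] := set_mem ht; rewrite big_ord1.
case: unliftP => [k|] /(congr1 val) //= kE; case: unliftP => [l|] /(congr1 val) /= lE.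
  by move: lE; rewrite (ord1 l).
have -> : k = 0 by rewrite ord1.
by rewrite /= t1 (clamp_ge1 (lexx 1)) (clamp_le0 (lexx 0)) path_one path_zero.
Qed.

Variable phi : continuousType X X.

Lemma monodromy_holonomy x y (p : {path I from x to y}) :
  (monodromy phi c (holonomy c p) = holonomy c (phi \o c x) *
    holonomy c (phi \o p) * (holonomy c (phi \o c y))^-1)%g.
Proof.
rewrite holonomyE /close_up monodromyE.
pose fp (a b : X) (q : {path I from a to b}) :=
  (phi \o q : {path I from phi a to phi b}).
have -> : phi \o concat (concat (c x) p) (reverse (c y)) =
    concat (concat (fp _ _ (c x)) (fp _ _ p)) (reverse (fp _ _ (c y))).
  apply/funext => t; rewrite /= /mk_path /concat_fun /= /mk_path.
  rewrite /concat_fun /reverse_fun.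
  by case: ifP => _ //; case: ifP.
by rewrite (holonomy_concat c) (holonomy_concat c) (holonomy_reverse c).
Qed.

(** The two cocycles differ by the coboundary of the function sending x to the
    value of L on the class of phi (c x). *)
Lemma pullback_hom_class (L L' : pi1 -> R) (LM : additive_on L) (LM' : additive_on L') :
  (forall g, L' g = L (monodromy phi c g)) ->
  pullback R 1 phi (hom_class LM) = hom_class LM'.
Proof.
move=> LE; rewrite [LHS]pullbackE; apply/cohomology_classP => /=.
pose e0 : 'rV[R]_1 := \row_(j < 1) 1.
have v0 : e0 \in @std_simplex R 0.
  by apply/mem_set; split=> [j|]; rewrite ?big_ord1 mxE.
pose pt : (@std_simplex R 0) := exist _ e0 v0.
exists (fun s : singular_simplex R 0 X => L (holonomy c (phi \o c (s pt)))) => //.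
apply/funext => s; rewrite /coboundary !big_ord_recl big_ord0 addr0 expr0 expr1 mul1r mulN1r.
have cs : continuous (s \o edge) := continuous_compE edge_continuous (@cts_fun _ _ s).
pose p := @mk_path I X _ _ (s \o edge) cs erefl erefl.
have -> : (pullback_cochain phi (hom_cochain L) - hom_cochain L') s =
    L (holonomy c (phi \o p)) - L' (holonomy c p) by [].
rewrite LE monodromy_holonomy !LM (additive_onV _ LM) opprB opprD.
have E (i : 'I_2) t : edge t = coface i pt -> face i s pt = (s \o edge) t by move=> /= ->.
have E0 : face ord0 s pt = (s \o edge) one.
  apply: E; apply: val_inj; apply/rowP => j; rewrite !mxE.
  case: j => [[|[|j]] hj] //=; case: unliftP => [k|] /(congr1 val) /=;
    rewrite ?(ord1 k) => // _ /=; by rewrite ?mxE ival1 ?subrr.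
have E1 : face (fintype.lift ord0 ord0) s pt = (s \o edge) zero.
  apply: E; apply: val_inj; apply/rowP => j; rewrite !mxE.
  case: j => [[|[|j]] hj] //=; case: unliftP => [k|] /(congr1 val) /=;
    rewrite ?(ord1 k) => // _ /=; by rewrite ?mxE ival0 ?subr0.
rewrite E0 E1.
by rewrite /=; ring.
Qed.
End cohomology_of_homs.

(** * Homomorphisms with bounded orbits *)

Lemma geometric_bounded (R : realType) (r a C : R) : 0 <= r -> 0 < a ->
  (forall k, r ^+ k * a <= C) -> r <= 1.
Proof.
move=> r0 a0 rC; rewrite leNgt; apply/negP => r1.
have C0 : 0 < C by apply: lt_le_trans (rC 0%N); rewrite expr0 mul1r.
have ri : `|r^-1| < 1.
  by rewrite ger0_norm ?invr_ge0// invf_lt1// (lt_trans ltr01 r1).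
have /cvgrPdist_lt/(_ (a / C)) := cvg_expr ri.
rewrite divr_gt0// => /(_ isT)[k _ /(_ k (leqnn k))] /=.
rewrite sub0r normrN exprVn ger0_norm ?invr_ge0 ?exprn_ge0//.
have rk : 0 < r ^+ k by rewrite exprn_gt0// (lt_trans ltr01 r1).
by rewrite ltr_pdivlMr// mulrC ltr_pdivrMr// ltNge mulrC rC.
Qed.

Section bounded_orbits.
Variables (R : realType) (H : Type) (T : H -> H).
Local Notation C := (complex R).
Import Normc.

(** The elements g' one of whose iterates lies on the forward orbit of g are, for
    bijective T, the two-sided orbit of g. *)
Definition orbit_bounded (F : H -> C) : Prop := forall g, exists B : R,
  forall k l g', iter k T g' = iter l T g -> normc (F g') <= B.

Lemma orbit_bounded_shift (F : H -> C) (z : C) : orbit_bounded F ->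
  orbit_bounded (fun g => F (T g) - z * F g).
Proof.
move=> bF g; have [B hB] := bF g; exists (B + normc z * B) => k l g' E.
apply: le_trans (le_normcD _ _) _; apply: lerD.
  by apply: (hB k l.+1); rewrite -iterSr !iterS E.
rewrite normcN normcM ler_wpM2l ?(hB k l)//.
by case: z => a b; rewrite sqrtr_ge0.
Qed.

(** Along the orbit of g0 the function F grows like the powers of z in positive
    time and like the powers of its inverse in negative time. *)
Lemma orbit_bounded_eigen (F : H -> C) (z : C) g0 : (forall g, exists g', T g' = g) ->
  orbit_bounded F -> (forall g, F (T g) = z * F g) -> F g0 != 0 -> normc z = 1.
Proof.
move=> sT bF ez Fg0; have [B hB] := bF g0.
have normc_ge0 (w : C) : 0 <= normc w by case: w => a b; rewrite sqrtr_ge0.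
have a0 : 0 < normc (F g0).
  by rewrite lt_neqAle normc_ge0 andbT eq_sym; apply: contra Fg0 => /eqP/eq0_normc ->.
have nX w k : normc (w ^+ k : C) = normc w ^+ k.
  elim: k => [|k IH]; first by rewrite !expr0 normc1.
  by rewrite !exprS normcM IH.
have it k g : F (iter k T g) = z ^+ k * F g.
  elim: k => [|k IH]; first by rewrite expr0 mul1r.
  by rewrite iterS ez IH exprS mulrA.
have sk k g : exists g', iter k T g' = g.
  elim: k g => [|k IH] g; first by exists g.
  by have [g1 <-] := sT g; have [g2 <-] := IH g1; exists g2.
have le1 : normc z <= 1.
  apply: (@geometric_bounded _ _ (normc (F g0)) B) => // k.
  by rewrite -nX -normcM -it (hB 0%N k).
have z0 : 0 < normc z.
  rewrite lt_neqAle normc_ge0 andbT eq_sym; apply: contra Fg0 => /eqP/eq0_normc z0.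
  by have [g' <-] := sT g0; rewrite ez z0 mul0r.
have ge1 : (normc z)^-1 <= 1.
  apply: (@geometric_bounded _ _ (normc (F g0)) B) => //; first by rewrite invr_ge0.
  move=> k; have [g' E] := sk k g0.
  rewrite -E it normcM nX exprVn mulKf ?expf_neq0 ?gt_eqF//.
  by apply: (hB k 0%N).
by apply/le_anti; rewrite le1 -invf_le1// ge1.
Qed.

(** A space of functions on H, stable under composition with T, given by
    coordinates: coord L v means that L belongs to it with coordinates v, and
    composition with T acts on coordinates by A. *)
Variables (n : nat) (A : 'M[R]_n.+1) (coord : (H -> R) -> 'rV[R]_n.+1 -> Prop).
Hypothesis coordP : forall a L1 v1 L2 v2, coord L1 v1 -> coord L2 v2 ->
  coord (fun g => a * L1 g + L2 g) (a *: v1 + v2).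
Hypothesis coordT : forall L v, coord L v -> coord (fun g => L (T g)) (v *m A).
Hypothesis coord0 : forall L, coord L 0 -> forall g, L g = 0.

Let re (w : C) : R := complex.Re w.
Let im (w : C) : R := complex.Im w.
Let AC : 'M[C]_n.+1 := map_mx (real_complex R) A.

Let coordC (F : H -> C) (v : 'rV[C]_n.+1) : Prop :=
  coord (fun g => re (F g)) (map_mx re v) /\ coord (fun g => im (F g)) (map_mx im v).

Let reM (w w' : C) : re (w * w') = re w * re w' - im w * im w'.
Proof. by case: w w' => [a b] [c d]. Qed.

Let imM (w w' : C) : im (w * w') = re w * im w' + im w * re w'.
Proof. by case: w w' => [a b] [c d]. Qed.

Let reB (w w' : C) : re (w - w') = re w - re w'.
Proof. by case: w w' => [a b] [c d]. Qed.

Let imB (w w' : C) : im (w - w') = im w - im w'.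
Proof. by case: w w' => [a b] [c d]. Qed.

Let coordE L v L' v' : coord L v -> L =1 L' -> v = v' -> coord L' v'.
Proof. by move=> h /funext <- <-. Qed.

Let mulAC (f : C -> R) v : f 0 = 0 -> {morph f : w w' / w + w'} ->
  (forall w x, f (w * (real_complex R x)) = f w * x) ->
  map_mx f (v *m AC : 'rV[C]_n.+1) = map_mx f v *m A.
Proof.
move=> f0 fD fM; apply/rowP => j; rewrite !mxE.
rewrite (big_morph f fD f0); apply: eq_bigr => k _.
by rewrite !mxE fM.
Qed.

Let coordC_shift F v z : coordC F v ->
  coordC (fun g => F (T g) - z * F g) (v *m (AC - z%:M)).
Proof.
move=> [hr hi].
have Tr := coordT hr; have Ti := coordT hi.
have rE : map_mx re (v *m AC) = map_mx re v *m A.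
  by apply: mulAC => // [[a b] [c d]|[a b] x] //; rewrite reM /= mulr0 subr0.
have iE : map_mx im (v *m AC) = map_mx im v *m A.
  by apply: mulAC => // [[a b] [c d]|[a b] x] //; rewrite imM /= mulr0 add0r.
rewrite -rE in Tr; rewrite -iE in Ti.
rewrite mulmxBr mul_mx_scalar; split.
- apply: coordE (coordP (- re z) hr (coordP (im z) hi Tr)) _ _ => [g|].
    by rewrite reB reM; ring.
  by apply/rowP => j; rewrite !mxE reB reM; ring.
- apply: coordE (coordP (- re z) hi (coordP (- im z) hr Ti)) _ _ => [g|].
    by rewrite imB imM; ring.
  by apply/rowP => j; rewrite !mxE imB imM; ring.
Qed.

(** Peel off the linear factors of the characteristic polynomial one at a time:
    the last nonzero function obtained is an eigenfunction of composition with T. *)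
Lemma bounded_coord_eq0 : (forall g, exists g', T g' = g) ->
  (forall z, eigenvalue AC z -> `|z| != 1) ->
  forall L v, coord L v -> (forall g, exists B : R, forall k l g',
    iter k T g' = iter l T g -> `|L g'| <= B) -> forall g, L g = 0.
Proof.
move=> sT hyp L v Lv bL.
have [s sE] := closed_field_poly_normal (char_poly AC).
rewrite (monicP (char_poly_monic AC)) scale1r in sE.
have peel (r : seq C) (F : H -> C) (w : 'rV[C]_n.+1) :
    {subset r <= s} -> coordC F w ->
    w *m horner_mx AC (\prod_(z <- r) ('X - z%:P)) = 0 ->
    orbit_bounded F -> forall g, F g = 0.
  elim: r F w => [|z r IH] F w rs Fw wr bF g.
    move: Fw; rewrite big_nil rmorph1 mulmx1 in wr; rewrite wr => -[hr hi].
    have m0 (f : C -> R) : f 0 = 0 -> map_mx f (0 : 'rV[C]_n.+1) = 0.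
      by move=> f0; apply/rowP => j; rewrite !mxE.
    rewrite !m0// in hr hi.
    have := coord0 hr g; have := coord0 hi g.
    by case: (F g) => a b /= -> ->.
  have zs : z \in s by apply: rs; rewrite mem_head.
  have nz : normc z != 1.
    have : eigenvalue AC z by rewrite eigenvalue_root_char sE root_prod_XsubC.
    move/hyp; apply: contra => /eqP z1.
    by rewrite normc_def; move: z1; case: (z) => a b /= ->.
  have E : forall g, F (T g) - z * F g = 0.
    apply: (IH _ _ _ (coordC_shift z Fw)).
    - by move=> y yr; apply: rs; rewrite in_cons yr orbT.
    - by move: wr; rewrite big_cons rmorphM rmorphB /= horner_mx_X horner_mx_C mulmxA.
    - exact: orbit_bounded_shift.
  apply/eqP; apply: contraNT nz => Fg; apply/eqP.
  apply: (orbit_bounded_eigen sT bF _ Fg) => h.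
  exact: subr0_eq (E h).
move=> g; have := peel s (fun g => (L g)%:C%C) (map_mx (real_complex R) v).
have mC (f : C -> R) (w : 'rV[R]_n.+1) (x : R) : (forall y, f (real_complex R y) = x * y) ->
    map_mx f (map_mx (real_complex R) w) = x *: w.
  by move=> fx; apply/rowP => j; rewrite !mxE fx.
have h1 : {subset s <= s} by [].
have h2 : coordC (fun g => (L g)%:C%C) (map_mx (real_complex R) v).
  split; first by rewrite (mC _ _ 1) ?scale1r // => y; rewrite mul1r.
  rewrite (mC _ _ 0) => [|y]; last by rewrite mul0r.
  apply: coordE (coordP (-1) Lv Lv) _ _ => [h|]; first by rewrite mulN1r addNr.
  by rewrite scaleN1r addNr scale0r.
have h3 : map_mx (real_complex R) v *m horner_mx AC (\prod_(z <- s) ('X - z%:P)) = 0.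
  by rewrite -sE Cayley_Hamilton mulmx0.
have h4 : orbit_bounded (fun g => (L g)%:C%C).
  move=> h; have [B hB] := bL h; exists B => k l g' /hB.
  by rewrite /= expr0n /= addr0 sqrtr_sqr.
by move=> /(_ h1 h2 h3 h4 g) /(congr1 re).
Qed.
End bounded_orbits.

Section hyperbolic_monodromy.
Variables (R : realType) (X : topologicalType) (x0 : X).
Local Notation I := (unit_interval R).
Variable c : forall x : X, {path I from x0 to x}.
Hypothesis c0 : c x0 =1 cst x0.
Variable phi : continuousType X X.
Local Notation mono := (monodromy phi c).

(** The coordinates of a homomorphism are those of its cohomology class. *)
Lemma hyperbolic_no_bounded_hom : hyperbolic (pullback R 1 phi) ->
  (forall g, exists g', mono g' = g) ->
  forall L : fundamental_group R x0 -> R, additive_on L ->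
  (forall g, exists B : R, forall k l g', iter k mono g' = iter l mono g ->
     `|L g'| <= B) ->
  forall g, L g = 0.
Proof.
move=> [n [e [A [n0 eb eA hyp]]]] sM L LM bL.
case: n n0 e A eb eA hyp => // n _ e A eb eA hyp.
pose coord (L : fundamental_group R x0 -> R) (v : 'rV[R]_n.+1) :=
  exists h : additive_on L, hom_class c h = \sum_i v 0 i *: e i.
have [v [vE _]] := eb (hom_class c LM).
apply: (@bounded_coord_eq0 R _ mono n A coord) (ex_intro _ LM vE) bL => //.
- move=> a L1 v1 L2 v2 [h1 E1] [h2 E2].
  have h : additive_on (fun g => a * L1 g + L2 g).
    by move=> g g'; rewrite h1 h2; ring.
  exists h; rewrite (hom_classP c h1 h2 h (a := a)) // E1 E2 scaler_sumr -big_split /=.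
  by apply: eq_bigr => i _; rewrite !mxE scalerDl scalerA.
- move=> L1 v1 [h1 E1].
  have h : additive_on (fun g => L1 (mono g)).
    by move=> g g'; rewrite (@monodromyM R _ phi _ c) h1.
  exists h; rewrite -(@pullback_hom_class _ _ _ c phi _ _ h1 h) // E1 linear_sum /=.
  transitivity (\sum_i \sum_j (v1 0 i * A i j) *: e j).
    apply: eq_bigr => i _; rewrite linearZ /= eA scaler_sumr.
    by apply: eq_bigr => j _; rewrite scalerA.
  rewrite exchange_big /=; apply: eq_bigr => j _.
  by rewrite -scaler_suml mxE.
- move=> L1 [h1 E1]; apply: (hom_class_inj c0 (LM := h1)).
  by rewrite E1 big1 // => i _; rewrite mxE scale0r.
Qed.
End hyperbolic_monodromy.

(** * Norms, curves and orthogonal projections *)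

Section max_norm.
Variable R : realType.

Lemma coord_le_norm m n (A : 'M[R]_(m, n)) i j : `|A i j| <= `|A|.
Proof.
rewrite [leRHS]/Num.Def.normr/= mx_normrE.
exact: (le_bigmax _ (fun ij => `|A ij.1 ij.2|) (i, j)).
Qed.

Lemma norm_le_coord m n (A : 'M[R]_(m, n)) (e : R) : 0 <= e ->
  (forall i j, `|A i j| <= e) -> `|A| <= e.
Proof.
by move=> e0 Ae; rewrite [leLHS]/Num.Def.normr/= mx_normrE bigmax_le// => -[i j] _; exact: Ae.
Qed.

Lemma mulmx_norm m n p (A : 'M[R]_(m, n)) (B : 'M[R]_(n, p)) :
  `|A *m B| <= n%:R * (`|A| * `|B|).
Proof.
apply: norm_le_coord => [|i j]; first by rewrite mulr_ge0 ?mulr_ge0.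
rewrite mxE (le_trans (ler_norm_sum _ _ _))//.
rewrite -[X in X%:R * _]card_ord mulr_natl -sumr_const ler_sum// => k _.
by rewrite normrM ler_pM ?coord_le_norm.
Qed.

Lemma is_derive_coord (V : normedModType R) m n (f : V -> 'M[R]_(m, n)) x v df i j :
  is_derive x v f df -> is_derive x v (fun t => f t i j) (df i j).
Proof.
move=> [fx <-]; rewrite derive_mx// mxE; apply: DeriveDef => //.
by have /derivable_mxP := fx.
Qed.

Lemma is_derive_chain N p (c : R -> 'rV[R]_N) (F : 'rV[R]_N -> 'rV[R]_p) (s : R) x v :
  is_derive s 1 c v -> c s = x -> differentiable F x ->
  is_derive s 1 (F \o c) (v *m jacobian F x).
Proof.
move=> [cs cv] <- dF; have dc : differentiable c s by exact/derivable1_diffP.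
have dFc : differentiable (F \o c) s by exact: differentiable_comp.
apply: DeriveDef; first exact: diff_derivable.
rewrite deriveE// (diff_comp dc dF) /= -cv deriveE//.
by rewrite /jacobian mul_rV_lin1.
Qed.

Lemma is_derive_line N (p w : 'rV[R]_N) (s : R) :
  is_derive s 1 (fun t : R => p + t *: w) w.
Proof.
have h : is_derive s 1 (fun t : R => t *: w) w.
  have d : is_diff s ( *:%R^~ w) ( *:%R^~ w) by exact: is_diff_scalel.
  apply: DeriveDef; first by apply: diff_derivable; exact: ex_diff.
  by rewrite deriveE ?diff_val ?scale1r//; exact: ex_diff.
have := @is_deriveD _ _ _ (cst p) _ s 1 0 w (is_derive_cst _ _ _) h.
by rewrite add0r.
Qed.

(** The scalar mean value theorem applies to each coordinate, and the maximum norm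
    asks for no more than that. *)
Lemma mean_value N (u v : R -> 'rV[R]_N) (B : R) : 0 <= B ->
  (forall s : R, 0 <= s <= 1 -> is_derive s 1 u (v s) /\ `|v s| <= B) ->
  `|u 1 - u 0| <= B.
Proof.
move=> B0 uv; apply: norm_le_coord => // i j.
have dj (s : R) : 0 <= s <= 1 -> is_derive s 1 (fun t => u t i j) (v s i j).
  by move=> /uv[us _]; exact: is_derive_coord.
have h1 (s : R) : s \in `]0, 1[%R -> is_derive s 1 (fun t => u t i j) (v s i j).
  by rewrite in_itv /= => /andP[s0 s1]; apply: dj; rewrite !ltW.
have h2 : {within `[0, 1], continuous (fun t => u t i j)}.
  apply: derivable_within_continuous => s; rewrite in_itv /= => s01.
  by have [] := dj s s01.
have [c c01 E] := MVT ltr01 h1 h2.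
rewrite !mxE E subr0 mulr1; apply: le_trans (coord_le_norm _ _ _) _.
by move: c01; rewrite in_itv /= => /andP[c0 c1]; apply: (uv c _).2; rewrite !ltW.
Qed.

(** Orthogonal projection onto the row space of B: the row space meets its
    orthogonal complement trivially because the scalar product is positive. *)
Lemma orthogonal_projection N (B : 'M[R]_N) : exists P : 'M[R]_N,
  [/\ exists C, P = C *m B, P^T = P, B *m P = B & forall i j, `|P i j| <= 1].
Proof.
have cap : (B :&: kermx B^T = 0)%MS.
  apply/eqP/rowV0P => v; rewrite sub_capmx => /andP[/submxP[w wE] /sub_kermxP vB].
  have : v *m v^T = 0 by rewrite {2}wE trmx_mul mulmxA vB mul0mx.
  move=> /matrixP/(_ 0 0); rewrite !mxE => v0; apply/rowP => j; rewrite mxE.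
  apply/eqP; rewrite -sqrf_eq0; move/eqP: v0; rewrite psumr_eq0.
    by move=> /allP/(_ j); rewrite mem_index_enum mxE -expr2 => /(_ isT).
  by move=> k _; rewrite mxE -expr2 sqr_ge0.
have full : (1%:M <= B + kermx B^T)%MS.
  rewrite sub1mx -col_leq_rank mxrank_disjoint_sum// mxrank_ker mxrank_tr.
  by rewrite subnKC// rank_leq_row.
have [[u w] /= E] := sub_addsmxP full.
have PB : (1%:M - u *m B) *m B^T = 0.
  by rewrite {1}E addrAC subrr add0r -mulmxA mulmx_ker mulmx0.
have [C CE] : exists C, u *m B = C *m B by exists u.
move: (u *m B) PB CE {E} => P PB CE.
(* P^T = P P^T is symmetric, so each diagonal entry of P is the sum of the
   squares of its row *)
have PT : P^T = P *m P^T.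
  have : (1%:M - P) *m P^T = 0 by rewrite {2}CE trmx_mul mulmxA PB mul0mx.
  by rewrite mulmxBl mul1mx => /subr0_eq.
have PE : P = P *m P^T by rewrite -{1}[P]trmxK {1}PT trmx_mul trmxK.
have PTE : P^T = P by rewrite PT -PE.
exists P; split=> //; first by exists C.
  apply: trmx_inj; rewrite trmx_mul PTE; apply/esym/subr0_eq.
  by rewrite -{1}[B^T]mul1mx -mulmxBl.
have sq i : P i i = \sum_j P i j ^+ 2.
  by rewrite {1}PE mxE; apply: eq_bigr => j _; rewrite mxE expr2.
have le_sq i j : P i j ^+ 2 <= P i i.
  rewrite sq (bigD1 j)//= lerDl sumr_ge0// => k _; exact: sqr_ge0.
have d1 i : P i i <= 1.
  have := le_sq i i; rewrite expr2 => h; rewrite leNgt; apply/negP => h1.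
  have : P i i * 1 < P i i * P i i by rewrite ltr_pM2l// (lt_trans ltr01).
  by rewrite mulr1 ltNge h.
move=> i j; rewrite -(@ler_pXn2r _ 2)// ?nnegrE// expr1n real_normK ?num_real//.
exact: le_trans (le_sq i j) (d1 i).
Qed.
End max_norm.

(** * Tangent maps of a submanifold *)

Lemma segment_in_ball (R : realType) N (x y z : 'rV[R]_N) (r s : R) : 0 <= s <= 1 ->
  `|x - y| < r -> `|x - z| < r -> `|x - (z + s *: (y - z))| < r.
Proof.
move=> /andP[s0 s1] yr zr.
have -> : x - (z + s *: (y - z)) = (1 - s) *: (x - z) + s *: (x - y).
  by apply/rowP => j; rewrite !mxE; ring.
apply: le_lt_trans (ler_normD _ _) _; rewrite !normrZ !ger0_norm ?subr_ge0//.
by case: (lerP s 2^-1) => s2; nra.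
Qed.

Lemma C1_on_bounds (R : realType) N (U : set 'rV[R]_N) (F : 'rV[R]_N -> 'rV[R]_N) x :
  open U -> C1_on U F -> U x -> exists r K : R, [/\ 0 < r, 0 <= K,
    forall y, `|x - y| < r -> U y /\ `|jacobian F y| <= K &
    forall y z, `|x - y| < r -> `|x - z| < r -> `|F y - F z| <= K * `|y - z|].
Proof.
move=> oU CF Ux; have [_ cJ] := CF x Ux.
pose K0 := `|jacobian F x| + 1.
have : nbhs x (U `&` [set y | `|jacobian F y| <= K0]).
  apply: filterI; first exact: open_nbhs_nbhs.
  have /cvgrPdist_lt/(_ 1 ltr01) := cJ; apply: filterS => y /ltW h.
  have := ler_normB (jacobian F x) (jacobian F x - jacobian F y).
  by rewrite subKr => /le_trans; apply; rewrite lerD2l.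
move=> /nbhs_ballP[r /= r0 rP].
have {}rP y : `|x - y| < r -> U y /\ `|jacobian F y| <= K0.
  by move=> h; apply: rP; rewrite -ball_normE.
have K00 : 0 <= K0 by rewrite addr_ge0.
have N1 : 1 <= N%:R + 1 :> R by rewrite lerDr.
exists r, ((N%:R + 1) * K0); split=> //; first by rewrite mulr_ge0 ?addr_ge0.
  by move=> y /rP[Uy h]; split=> //; rewrite (le_trans h)// ler_peMl.
move=> y z yr zr.
pose u s := F (z + s *: (y - z)).
have -> : F y - F z = u 1 - u 0 by rewrite /u scale1r scale0r addr0 [z + _]addrC subrK.
apply: (@mean_value _ _ u (fun s => (y - z) *m jacobian F (z + s *: (y - z)))).
  by rewrite mulr_ge0 ?mulr_ge0 ?addr_ge0.
move=> s s01; have zs := segment_in_ball s01 yr zr.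
have [Us hs] := rP _ zs; split.
  apply: (@is_derive_chain _ _ _ (fun s => z + s *: (y - z)) F s (z + s *: (y - z))).
  - exact: is_derive_line.
  - by [].
  - by have [] := CF _ Us.
apply: (le_trans (mulmx_norm _ _)); rewrite -mulrA [K0 * _]mulrC.
by apply: ler_pM; rewrite ?mulr_ge0 ?lerDl ?ler_wpM2l.
Qed.

Section submanifold.
Variables (R : realType) (N m : nat) (M : set 'rV[R]_N).
Hypothesis hM : C1_submanifold m M.

(** A curve in the ambient space, regarded as a curve in M as long as it stays
    there. *)
Definition curve_in (g : R -> 'rV[R]_N) (x : M) : R -> M := fun s =>
  if pselect (M (g s)) is left h then exist _ (g s) (mem_set h) else x.

Lemma curve_inE g x s : M (g s) -> ambient (curve_in g x s) = g s.
Proof. by rewrite /curve_in /ambient => h; case: pselect. Qed.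

Lemma ambient_inj : injective (@ambient R N M).
Proof. exact: val_inj. Qed.

Lemma ambientP (x : M) : M (ambient x).
Proof. by case: x => x h; exact: set_mem. Qed.

Lemma velocity_curve_in g x v : ambient x = g 0 -> is_derive (0 : R) (1 : R) g v ->
  (\forall s \near (0 : R), M (g s)) -> velocity (curve_in g x) x v.
Proof.
move=> gx gv Mg; split.
  by apply: ambient_inj; rewrite curve_inE -?gx//; exact: ambientP.
apply: near_eq_is_derive gv; apply: filterS Mg => s Ms.
by rewrite /= curve_inE.
Qed.

Lemma is_derive_continuous_near (g : R -> 'rV[R]_N) v (s : R) (U : set 'rV[R]_N) :
  is_derive s 1 g v -> open U -> U (g s) -> \forall t \near s, U (g t).
Proof.
move=> gv oU Us; have dg : differentiable g s by apply/derivable1_diffP; case: gv.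
by apply: (differentiable_continuous dg); exact: open_nbhs_nbhs.
Qed.

Lemma is_derive_unique (g : R -> 'rV[R]_N) (s : R) v w :
  is_derive s 1 g v -> is_derive s 1 g w -> v = w.
Proof. by move=> [_ <-] [_ <-]. Qed.

Definition flat (w : 'rV[R]_N) : Prop := forall j : 'I_N, (m <= j)%N -> w 0 j = 0.

(* the projection onto the row vectors that are flat *)
Let D : 'M[R]_N := pid_mx m.

Lemma flat_pid w : flat (w *m D).
Proof.
move=> j mj; rewrite mxE big1// => k _; rewrite mxE.
by case: eqP => [->|]; rewrite ?andbF ?mulr0// ltnNge mj mulr0.
Qed.

Lemma pid_flat w : flat w -> w *m D = w.
Proof.
move=> fw; apply/rowP => j; rewrite mxE (bigD1 j)//= mxE eqxx /= big1 ?addr0.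
  by case: ltnP => [_|mj]; rewrite ?mulr1// fw// mul0r.
by move=> k kj; rewrite mxE -val_eqE in kj *; rewrite (negbTE kj) mulr0.
Qed.

(** B is the differential of an inverse chart in the flat directions: curves in M
    through x have flat images in the chart, and flat lines lift to curves in M. *)
Lemma tangent_space (x : M) : exists B : 'M[R]_N,
  forall v, tangent x v <-> exists w, v = w *m B.
Proof.
have [_ /(_ _ (ambientP x))[U [W [F [G [[oU Ux oW] [CF CG UF WG UM]]]]]]] := hM.
set p := ambient x in Ux *; set q := F p.
exists (D *m jacobian G q) => v; split.
  move=> [g [g0 gv]].
  have a0 : (@ambient R N M \o g) 0 = p by rewrite /= g0.
  have Ug : \forall s \near (0 : R), U (ambient (g s)).
    by apply: (is_derive_continuous_near gv oU); rewrite a0.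
  have [dF _] := CF p Ux; have [Wq Gq] := UF p Ux; have [dG _] := CG _ Wq.
  have Fv := is_derive_chain gv a0 dF.
  have qE : (F \o (@ambient R N M \o g)) 0 = q by rewrite /= g0.
  have Gv := is_derive_chain Fv qE dG.
  set w := v *m jacobian F p in Fv Gv.
  exists w; rewrite mulmxA pid_flat => [|j mj].
    apply: is_derive_unique gv (near_eq_is_derive _ Gv).
    by apply: filterS Ug => s /UF[_] /=.
  have wj := is_derive_coord 0 j Fv.
  have c0 : is_derive (0 : R) (1 : R) (fun s => (F \o (@ambient R N M \o g)) s 0 j) 0.
    apply: near_eq_is_derive (is_derive_cst (0 : R) _ _).
    apply: filterS Ug => s Us; apply/esym.
    by apply: ((UM _ Us).1 _) => //; exact: ambientP.
  by have [_ <-] := wj; have [_ ->] := c0.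
move=> [w ->]; set w' := w *m D.
have [Wq Gq] := UF p Ux; have [dG _] := CG _ Wq.
pose g (s : R) := G (q + s *: w').
have q0 : q + 0 *: w' = q by rewrite scale0r addr0.
have lw : is_derive (0 : R) (1 : R) (fun s => q + s *: w') w' := is_derive_line q w' 0.
have gv : is_derive (0 : R) (1 : R) g (w' *m jacobian G q).
  exact: is_derive_chain lw q0 dG.
exists (curve_in g x); rewrite mulmxA; apply: velocity_curve_in => //.
  by rewrite /g q0 Gq.
have Wn : \forall s \near (0 : R), W (q + s *: w').
  by apply: (is_derive_continuous_near lw oW); rewrite q0.
apply: filterS Wn => s Ws; have [Us Fs] := WG _ Ws.
apply/(UM _ Us) => j mj; rewrite Fs mxE [(s *: w') 0 j]mxE (flat_pid w mj) mulr0 addr0.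
by apply: ((UM _ Ux).1 (ambientP x)).
Qed.

(** The tangent matrix is the orthogonal projection P onto the tangent space
    followed by the jacobian of any local extension F.  Since the entries of P
    are at most 1, it is bounded by the jacobian. *)
Lemma tangent_map_formula (x : M) : exists P : 'M[R]_N,
  (forall i j, `|P i j| <= 1) /\
  forall (f : M -> M) (U : set 'rV[R]_N) (F : 'rV[R]_N -> 'rV[R]_N),
    open U -> U (ambient x) -> C1_on U F ->
    (forall y : M, U (ambient y) -> F (ambient y) = ambient (f y)) ->
    is_tangent_matrix f x (P *m jacobian F (ambient x)) /\
    forall A, is_tangent_matrix f x A -> A = P *m jacobian F (ambient x).
Proof.
have [B BP] := tangent_space x.
have [P [[C PC] PT BPB P1]] := orthogonal_projection B.
exists P; split=> // f U F oU Ux CF Ff.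
set p := ambient x; set J := jacobian F p.
have [dF _] := CF _ Ux.
have push g v : velocity g x v -> velocity (f \o g) (f x) (v *m J).
  move=> [g0 gv]; split; first by rewrite /= g0.
  have a0 : (@ambient R N M \o g) 0 = p by rewrite /= g0.
  have Ug : \forall s \near (0 : R), U (ambient (g s)).
    by apply: (is_derive_continuous_near gv oU); rewrite a0.
  have h := is_derive_chain gv a0 dF.
  by apply: near_eq_is_derive h; apply: filterS Ug => s Us /=; rewrite Ff.
split.
  split=> [g v gv|w wT].
    have /BP[c vE] : tangent x v by exists g.
    have vP : v *m P = v by rewrite vE -mulmxA BPB.
    by rewrite mulmxA vP; exact: push.
  rewrite mulmxA.
  have -> : w *m P = 0; last by rewrite mul0mx.
  rewrite -PT PC trmx_mul mulmxA.
  have -> : w *m B^T = 0; last by rewrite mul0mx.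
  apply/rowP => j; rewrite !mxE.
  have /wT : tangent x (row j B) by apply/BP; exists (delta_mx 0 j); rewrite rowE.
  move=> /matrixP/(_ 0 0); rewrite !mxE => h; rewrite -[RHS]h.
  by apply: eq_bigr => k _; rewrite !mxE.
move=> A [A1 A2].
have PA : P *m A = P *m J.
  apply/row_matrixP => i; rewrite !row_mul.
  have /BP[g gv] : exists w, row i P = w *m B.
    by exists (row i C); rewrite PC row_mul.
  have [_ h1] := A1 _ _ gv; have [_ h2] := push _ _ gv.
  exact: is_derive_unique h1 h2.
rewrite -PA; apply/esym/subr0_eq; apply: oppr_inj; rewrite oppr0 opprB.
rewrite -{1}[A]mul1mx -mulmxBl.
apply/row_matrixP => i; rewrite row_mul row0; apply: A2 => v /BP[c ->].
have -> : row i (1%:M - P) *m (c *m B)^T = row i ((1%:M - P) *m B^T) *m c^T.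
  by rewrite trmx_mul row_mul mulmxA.
suff -> : (1%:M - P) *m B^T = 0 by rewrite row0 mul0mx.
by rewrite mulmxBl mul1mx -{1}PT -trmx_mul BPB subrr.
Qed.

Lemma tangent_mapP (f : M -> M) (x : M) : C1_map f -> is_tangent_matrix f x (tangent_map f x).
Proof.
move=> Cf; have [U [F [oU Ux CF Ff]]] := Cf x.
have [P [_ /(_ f U F oU Ux CF Ff)[h _]]] := tangent_map_formula x.
exact: (@xgetI _ 0 (is_tangent_matrix f x) _ h).
Qed.

Lemma tangent_map_near_bounded (f : M -> M) (x : M) : C1_map f ->
  exists r K : R, 0 < r /\ forall y : M, `|ambient x - ambient y| < r ->
    `|tangent_map f y| <= K.
Proof.
move=> Cf; have [U [F [oU Ux CF Ff]]] := Cf x.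
have [r [K [r0 K0 rK _]]] := C1_on_bounds oU CF Ux.
exists r, (N%:R * K); split=> // y /rK[Uy JK].
have [P [P1 /(_ f U F oU Uy CF Ff)[_ h]]] := tangent_map_formula y.
rewrite (h _ (tangent_mapP y Cf)); apply: le_trans (mulmx_norm _ _) _.
rewrite ler_wpM2l// -[leRHS]mul1r ler_pM// norm_le_coord//.
Qed.
End submanifold.

(** * Displacements on a submanifold *)

Section displacement.
Variables (R : realType) (N m : nat) (M : set 'rV[R]_N).
Hypothesis hM : C1_submanifold m M.
Implicit Types (x y z : M) (f : M -> M).

Lemma is_derive_at_shift (g : R -> 'rV[R]_N) (s : R) v :
  is_derive (0 : R) 1 (fun h => g (h + s)) v <-> is_derive s 1 g v.
Proof.
have E : (fun h : R => h^-1 *: (((fun h => g (h + s)) \o shift 0) (h *: 1) - g (0 + s))) =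
    (fun h : R => h^-1 *: ((g \o shift s) (h *: 1) - g s)).
  by apply/funext => h /=; rewrite addr0 add0r.
split=> -[dg <-].
  by apply: DeriveDef; [move: dg; rewrite /derivable E|rewrite /derive E].
by apply: DeriveDef; [rewrite /derivable E|rewrite /derive E].
Qed.

Definition displacement f x : 'rV[R]_N := ambient x - ambient (f x).

(** A chart joins nearby points of M by a curve of comparable length, along which
    the displacement of f has derivative the velocity times the difference of
    the tangent maps of the identity and of f. *)
Lemma displacement_lipschitz_local x : exists r K : R, [/\ 0 < r, 0 <= K &
  forall y z, `|ambient x - ambient y| < r -> `|ambient x - ambient z| < r ->
  forall f (e : R), C1_map f -> 0 <= e ->
    (forall w, `|tangent_map id w - tangent_map f w| <= e) ->
    `|displacement f y - displacement f z| <= K * e * `|ambient y - ambient z|].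
Proof.
have [_ /(_ _ (ambientP x))[U [W [F [G [[oU Ux oW] [CF CG UF WG UM]]]]]]] := hM.
set p := ambient x in Ux *; have [Wq Gq] := UF _ Ux; set q := F p in Wq Gq.
have [r1 [K1 [r10 K10 U1 L1]]] := C1_on_bounds oU CF Ux.
have [r2 [K2 [r20 K20 U2 L2]]] := C1_on_bounds oW CG Wq.
have K11 : 0 < K1 + 1 by rewrite ltr_wpDl.
pose r := Num.min r1 (r2 / (K1 + 1)).
have r0 : 0 < r by rewrite lt_min r10 divr_gt0.
exists r, (N%:R * (N%:R * (K1 * K2))); split=> //; first by rewrite !mulr_ge0.
have near_q y : `|p - ambient y| < r ->
    [/\ U (ambient y), `|q - F (ambient y)| < r2 & flat m (F (ambient y))].
  rewrite lt_min => /andP[y1 y2]; have [Uy _] := U1 _ y1; split=> //.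
    apply: le_lt_trans (L1 _ _ _ y1) _; first by rewrite subrr normr0.
    rewrite ltr_pdivlMr// in y2; apply: le_lt_trans y2.
    by rewrite mulrC ler_wpM2l// lerDl.
  by apply/(UM _ Uy); exact: ambientP.
move=> y z yr zr f e Cf e0 fe.
have [Uy Yr fY] := near_q _ yr; have [Uz Zr fZ] := near_q _ zr.
set Y := F (ambient y) in Yr fY; set Z := F (ambient z) in Zr fZ.
pose c (s : R) := Z + s *: (Y - Z).
pose g (s : R) := G (c s).
have cr s : 0 <= s <= 1 -> `|q - c s| < r2 by move=> s01; exact: segment_in_ball.
have gM s : W (c s) -> M (g s).
  move=> Ws; have [Us Fs] := WG _ Ws; apply/(UM _ Us) => j mj.
  by rewrite Fs !mxE fY// fZ// subrr mulr0 addr0.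
pose curve := curve_in g z.
pose w s := (Y - Z) *m jacobian G (c s).
have curveE s : 0 <= s <= 1 -> ambient (curve s) = g s.
  by move=> /cr/U2[Ws _]; rewrite curve_inE//; exact: gM.
have curve_vel s : 0 <= s <= 1 -> velocity (fun h => curve (h + s)) (curve s) (w s).
  move=> s01; split; first by rewrite add0r.
  apply/(is_derive_at_shift (@ambient R N M \o curve)).
  have [Ws _] := U2 _ (cr _ s01).
  have lc : is_derive s 1 c (Y - Z) := is_derive_line Z (Y - Z) s.
  have dG : differentiable G (c s) by have [] := CG _ Ws.
  have h := is_derive_chain lc erefl dG.
  apply: near_eq_is_derive h.
  have := is_derive_continuous_near lc oW Ws; apply: filterS => t Wt.
  by rewrite /= curve_inE//; exact: gM.
have -> : displacement f y = displacement f (curve 1).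
  congr displacement; apply: ambient_inj; rewrite curveE ?ler01 ?lexx//.
  rewrite /g /c scale1r addrC subrK /Y; exact: esym (UF _ Uy).2.
have -> : displacement f z = displacement f (curve 0).
  congr displacement; apply: ambient_inj; rewrite curveE ?ler01 ?lexx//.
  rewrite /g /c scale0r addr0 /Z; exact: esym (UF _ Uz).2.
apply: (@mean_value _ _ (displacement f \o curve)
  (fun s => w s *m (tangent_map id (curve s) - tangent_map f (curve s)))).
  by rewrite !mulr_ge0.
move=> s s01; split.
  have [T1 _] := tangent_mapP hM (curve s) (@C1_map_id R N M).
  have [T2 _] := tangent_mapP hM (curve s) Cf.
  have [_ /(is_derive_at_shift (@ambient R N M \o curve)) d1] := T1 _ _ (curve_vel s s01).
  have [_ /(is_derive_at_shift (@ambient R N M \o (f \o curve))) d2] := T2 _ _ (curve_vel s s01).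
  rewrite mulmxBr; exact: is_deriveB.
have [_ Js] := U2 _ (cr _ s01).
apply: le_trans (mulmx_norm _ _) _; rewrite -!mulrA; apply: ler_wpM2l => //.
have ws : `|w s| <= N%:R * (K1 * `|ambient y - ambient z| * K2).
  apply: le_trans (mulmx_norm _ _) _; apply: ler_wpM2l => //.
  apply: ler_pM => //; apply: L1; first by move: yr; rewrite lt_min => /andP[].
  by move: zr; rewrite lt_min => /andP[].
apply: le_trans (ler_pM _ _ ws (fe _)) _ => //.
by rewrite le_eqVlt; apply/orP; left; apply/eqP; ring.
Qed.

Lemma near_compact_uniform (P : nat -> 'rV[R]_N -> Prop) : compact M ->
  (forall x : 'rV[R]_N, M x -> exists r : R, 0 < r /\
    \forall n \near \oo, forall v : 'rV[R]_N, `|x - v| < r -> P n v) ->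
  exists n, forall v : 'rV[R]_N, M v -> P n v.
Proof.
move=> /compact_near_coveringP cM h.
have : \forall n \near \oo, M `<=` P n.
  apply: cM => x /h[r [r0 rP]].
  exists (ball x r, [set n | forall v : 'rV[R]_N, `|x - v| < r -> P n v]).
    by split=> //=; exact: nbhsx_ballx.
  by move=> [y n] /= []; rewrite -ball_normE /= => yr; apply.
by move=> [n _ /(_ n (leqnn n))]; exists n.
Qed.

(** For nearby points this is the local estimate with a constant made uniform by
    compactness; for points at distance at least 1 / (n + 1) the bound e on the
    displacements themselves is enough. *)
Lemma displacement_lipschitz : compact M -> exists2 C : R, 0 <= C &
  forall f (e : R), C1_map f ->
    (forall w, `|displacement f w| <= e) ->
    (forall w, `|tangent_map id w - tangent_map f w| <= e) ->
  forall y z, `|displacement f y - displacement f z| <= C * e * `|ambient y - ambient z|.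
Proof.
move=> cM.
pose P (n : nat) (v : 'rV[R]_N) := forall y z, ambient y = v ->
  `|v - ambient z| < n.+1%:R^-1 -> forall f (e : R), C1_map f -> 0 <= e ->
    (forall w, `|tangent_map id w - tangent_map f w| <= e) ->
    `|displacement f y - displacement f z| <= n%:R * e * `|ambient y - ambient z|.
have [n nP] : exists n, forall v, M v -> P n v.
  apply: near_compact_uniform => // x Mx.
  pose x' : M := exist _ x (mem_set Mx).
  have [r [K [r0 K0 loc]]] := displacement_lipschitz_local x'.
  have r20 : 0 < r / 2 by rewrite divr_gt0.
  exists (r / 2); split=> //; near=> n => v vr y z yv zv f e Cf e0 fe.
  have xy : `|ambient x' - ambient y| < r / 2 by rewrite yv.
  apply: le_trans (loc y z _ _ f e Cf e0 fe) _.
  - by apply: lt_trans xy _; rewrite ltr_pdivrMr// ltr_pMr// ltr1n.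
  - rewrite (splitr r) -[ambient x' - _](subrKA (ambient y)).
    apply: le_lt_trans (ler_normD _ _) _; apply: ltrD => //.
    rewrite yv; apply: lt_trans zv _; near: n.
    exact: (near_infty_natSinv_lt (PosNum r20)).
  - rewrite ler_wpM2r// ler_wpM2r//; near: n; exact: nbhs_infty_ger.
exists (2 * n.+1%:R); first by rewrite mulr_ge0.
move=> f e Cf de te y z.
have e0 : 0 <= e := le_trans (normr_ge0 _) (de y).
have [yz|yz] := ltP `|ambient y - ambient z| n.+1%:R^-1.
  apply: le_trans (nP _ (ambientP y) y z erefl yz f e Cf e0 te) _.
  by rewrite ler_wpM2r// ler_wpM2r// -natrM ler_nat (leq_trans (leqnSn n))// leq_pmull.
apply: le_trans (ler_normB _ _) _.
apply: le_trans (lerD (de y) (de z)) _.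
rewrite -mulr2n -[e *+ 2]mulr_natl -!mulrA ler_wpM2l// mulrCA ler_peMr//.
by rewrite -ler_pdivrMl ?mulr1 // invr_gt0.
Unshelve. all: by end_near. Qed.

(** The suprema in the C1 distance are suprema of bounded sets, because M is
    compact and tangent maps are locally bounded. *)
Lemma C1_dist_bounds (p : C1_diffeo M) : compact M ->
  (forall x, `|displacement p x| <= C1_dist 1%g p) /\
  (forall x, `|tangent_map id x - tangent_map p x| <= C1_dist 1%g p).
Proof.
move=> cM.
pose A := range (fun x => `|ambient ((1%g : C1_diffeo M) x) - ambient (p x)|).
pose B := range (fun x => `|tangent_map (1%g : C1_diffeo M) x - tangent_map p x|).
have tb f : C1_map f -> exists n : nat, forall x, `|tangent_map f x| <= n%:R.
  move=> Cf; pose P (n : nat) (v : 'rV[R]_N) := forall y, ambient y = v ->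
    `|tangent_map f y| <= n%:R.
  have [n nP] : exists n, forall v, M v -> P n v.
    apply: near_compact_uniform => // x Mx.
    pose x' : M := exist _ x (mem_set Mx).
    have [r [K [r0 loc]]] := tangent_map_near_bounded hM x' Cf.
    exists r; split=> //; near=> n => v vr y yv.
    apply: le_trans (loc y _) _; first by rewrite yv.
    by near: n; exact: nbhs_infty_ger.
  by exists n => x; apply: (nP _ (ambientP x)).
have ubB : has_ubound B.
  have [n1 h1] := tb _ (@diffeo_C1 _ _ _ (1%g : C1_diffeo M)).
  have [n2 h2] := tb _ (@diffeo_C1 _ _ _ p).
  exists (n1%:R + n2%:R) => _ [x _ <-].
  by apply: le_trans (ler_normB _ _) _; apply: lerD.
have ubA : has_ubound A.
  have [K [_ KP]] := compact_bounded cM.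
  have hK v : M v -> `|v| <= K + 1 by apply: KP; rewrite ltrDl.
  exists ((K + 1) + (K + 1)) => _ [x _ <-].
  apply: le_trans (ler_normB _ _) _.
  by apply: lerD; apply: hK; exact: ambientP.
have sup0 (C : set R) : has_ubound C -> (forall c, C c -> 0 <= c) -> 0 <= sup C.
  move=> ubC C0; have [->|/set0P[c Cc]] := eqVneq C set0; first by rewrite sup0.
  exact: le_trans (C0 _ Cc) (ub_le_sup ubC Cc).
have A0 : 0 <= sup A by apply: sup0 => // _ [x _ <-].
have B0 : 0 <= sup B by apply: sup0 => // _ [x _ <-].
split=> x; rewrite /C1_dist.
  by apply: ler_wpDr => //; apply: ub_le_sup => //; exists x.
by apply: ler_wpDl => //; apply: ub_le_sup => //; exists x.
Unshelve. all: by end_near. Qed.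
End displacement.

(** * Rigidity near the trivial representation *)

Lemma subr_interchange (V : zmodType) (a b c d : V) :
  (a - b) - (c - d) = (a - c) - (b - d).
Proof. by rewrite !opprD !opprK addrACA. Qed.

Lemma multiplicative1 (G H : groupType) (f : {multiplicative G -> H}) : f 1%g = 1%g.
Proof. by apply: (@mulgI _ (f 1%g)); rewrite -gmulfM !mulg1. Qed.

Lemma multiplicativeV (G H : groupType) (f : {multiplicative G -> H}) g :
  f g^-1%g = (f g)^-1%g.
Proof. by apply: (@mulgI _ (f g)); rewrite -gmulfM !mulgV multiplicative1. Qed.

Lemma ultra_bounded_cvg (R : realType) (T : Type) (F : set_system T) (f : T -> R) (B : R) :
  UltraFilter F -> F [set t | `|f t| <= B] -> exists l : R, f @ F --> l.
Proof.
move=> FU fB.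
have [] := @segment_compact R (- B) B (f @ F) _.
  by apply: filterS fB => t ft; rewrite /= in_itv /= -ler_norml; exact: ft.
move=> l [_ cl]; exists l => A nA.
have [//|FA] := in_ultra_setVsetC (f @^-1` A) FU.
by have [y [/= nAy Ay]] := cl (~` A) A FA nA.
Qed.

Section rigidity.
Variables (R : realType) (N m : nat) (M : set 'rV[R]_N).
Hypotheses (hM : C1_submanifold m M) (cM : compact M).
Variables (G H : groupType) (incl : {multiplicative H -> G}) (t : G) (mono : H -> H).
Hypothesis conj_t : forall g, (incl g * t = t * incl (mono g))%g.
Variables (Sigma : seq G) (SigmaH : seq H).
Hypotheses (genG : generates Sigma) (genH : forall h, span_set SigmaH h).
Hypothesis no_bounded_hom : forall L : H -> R, additive_on L ->
  (forall g, exists B : R, forall k l g', iter k mono g' = iter l mono g ->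
     `|L g'| <= B) -> forall g, L g = 0.
Local Notation hom := {multiplicative G -> C1_diffeo M}.

Lemma iter_mono k g : incl (iter k mono g) = (t ^- k * incl g * t ^+ k)%g.
Proof.
elim: k => [|k IH]; first by rewrite /= expg0 invg1 mul1g mulg1.
have E h : incl (mono h) = (t^-1 * incl h * t)%g by rewrite -mulgA conj_t mulKg.
by rewrite iterS E IH expgSr invgM !mulgA.
Qed.

Lemma iter_mono_conj k l g g' : iter k mono g' = iter l mono g ->
  exists a : G, incl g' = (a^-1 * incl g * a)%g.
Proof.
move=> /(congr1 incl); rewrite !iter_mono => E; exists (t ^+ l * t ^- k)%g.
have -> : incl g' = (t ^+ k * (t ^- k * incl g' * t ^+ k) * t ^- k)%g.
  by rewrite !mulgA mulgV mul1g mulgK.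
by rewrite E invgM invgK !mulgA.
Qed.

Section sequence.
Variable rho : nat -> hom.
Hypothesis rho_small : forall k, rep_dist Sigma (trivial_rep M G) (rho k) < k.+1%:R^-1.
Hypothesis rho_nontrivial : forall k, exists g, rho k (incl g) <> 1%g.

Let disp k (g : G) (x : M) : 'rV[R]_N := displacement (rho k g) x.

Let dispM k g h x : disp k (g * h)%g x = disp k h x + disp k g (rho k h x).
Proof. by rewrite /disp /displacement gmulfM /= subrKA. Qed.

Let disp1 k x : disp k 1%g x = 0.
Proof. by rewrite /disp /displacement multiplicative1 /= subrr. Qed.

Let dispV k g x : disp k g^-1%g x = - disp k g (rho k g^-1%g x).
Proof.
by apply: (addrI (disp k g (rho k g^-1%g x))); rewrite subrr addrC -dispM mulgV disp1.
Qed.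

Let ambient_rho k g x : ambient (rho k g x) = ambient x - disp k g x.
Proof. by rewrite /disp /displacement subKr. Qed.

(** The elements whose displacement has eventually small Lipschitz constant form
    a subgroup, which contains the generators. *)
Let disp_lipschitz g (e : R) : 0 < e -> \forall k \near \oo, forall x y,
  `|disp k g x - disp k g y| <= e * `|ambient x - ambient y|.
Proof.
pose P := [set g : G | forall e : R, 0 < e -> \forall k \near \oo, forall x y : M,
  `|disp k g x - disp k g y| <= e * `|ambient x - ambient y|].
have lip_dist k h (d : R) x y : 0 <= d ->
    `|disp k h x - disp k h y| <= d * `|ambient x - ambient y| ->
    `|ambient (rho k h x) - ambient (rho k h y)| <= (1 + d) * `|ambient x - ambient y|.
  move=> d0 hd; rewrite !ambient_rho subr_interchange mulrDl mul1r.
  by apply: le_trans (ler_normB _ _) _; rewrite lerD2l.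
suff : P g by apply.
apply: (generates_sub genG) g; first split.
- by move=> d d0; near=> k => x y; rewrite !disp1 subrr normr0 mulr_ge0// ltW.
- move=> g h Pg Ph d d0.
  have [d' [d'0 d'1 d'3]] : exists d' : R, [/\ 0 < d', d' <= 1 & d' <= d / 3].
    exists (Num.min (d / 3) 1); split; first by rewrite lt_min divr_gt0//= ltr01.
      by rewrite ge_min lexx orbT.
    by rewrite ge_min lexx.
  near=> k => x y; rewrite !dispM opprD addrACA.
  have hx : `|disp k h x - disp k h y| <= d' * `|ambient x - ambient y|.
    by move: x y; near: k; exact: Ph.
  have hg u v : `|disp k g u - disp k g v| <= d' * `|ambient u - ambient v|.
    by move: u v; near: k; exact: Pg.
  apply: le_trans (ler_normD _ _) _.
  apply: le_trans (lerD hx (le_trans (hg _ _) (ler_wpM2l (ltW d'0) (lip_dist _ _ _ _ _ (ltW d'0) hx)))) _.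
  have a0 : 0 <= `|ambient x - ambient y| by [].
  rewrite mulrA -mulrDl ler_wpM2r// mulrDr mulr1.
  have dd : d' * d' <= d' by rewrite ler_piMr// ltW.
  by lra.
- move=> g Pg d d0.
  have [d' [d'0 d'1 d'3]] : exists d' : R, [/\ 0 < d', d' <= 2^-1 & d' <= d / 2].
    exists (Num.min (d / 2) 2^-1); split; first by rewrite lt_min divr_gt0//= invr_gt0.
      by rewrite ge_min lexx orbT.
    by rewrite ge_min lexx.
  near=> k => x y; rewrite !dispV -opprD normrN.
  set x' := rho k g^-1%g x; set y' := rho k g^-1%g y.
  have hg : `|disp k g x' - disp k g y'| <= d' * `|ambient x' - ambient y'|.
    by move: (x') (y'); near: k; exact: Pg.
  have back z : ambient z = ambient (rho k g^-1%g z) - disp k g (rho k g^-1%g z).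
    by rewrite ambient_rho dispV opprK addrK.
  have tri : `|ambient x' - ambient y'| <=
      `|ambient x - ambient y| + `|disp k g x' - disp k g y'|.
    rewrite (back x) (back y) -/x' -/y'.
    rewrite [X in _ <= `|X| + _]subr_interchange.
    by rewrite -{1}(subrK (disp k g x' - disp k g y') (ambient x' - ambient y')) ler_normD.
  have half := ler_wpM2r (normr_ge0 (ambient x' - ambient y')) d'1.
  have twice : `|ambient x' - ambient y'| <= 2 * `|ambient x - ambient y|.
    by move: tri hg half; lra.
  apply: le_trans hg _; apply: le_trans (ler_pM _ _ d'3 twice) _ => //.
    exact: ltW.
  by rewrite mulrA divfK// pnatr_eq0.
- move=> s sS d d0.
  have [C C0 CP] := displacement_lipschitz hM cM.
  have Cd : 0 < d / (C + 1) by rewrite divr_gt0// ltr_wpDl.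
  near=> k => x y.
  have [b1 b2] := C1_dist_bounds hM (rho k s) cM.
  have ds : C1_dist 1%g (rho k s) <= k.+1%:R^-1.
    apply: le_trans (ltW (rho_small k)).
    exact: (le_bigmax_seq 0 s predT (fun s => C1_dist (trivial_rep M G s) (rho k s))).
  apply: le_trans (CP _ k.+1%:R^-1 (@diffeo_C1 _ _ _ (rho k s)) _ _ x y) _.
  - by move=> w; exact: le_trans (b1 w) ds.
  - by move=> w; exact: le_trans (b2 w) ds.
  rewrite ler_wpM2r//.
  have kd : k.+1%:R^-1 <= d / (C + 1).
    by apply/ltW; near: k; exact: (near_infty_natSinv_lt (PosNum Cd)).
  apply: le_trans (ler_wpM2l C0 kd) _.
  rewrite mulrCA ler_piMr// ?(ltW d0)// ler_pdivrMr ?mul1r ?lerDl//.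
  by rewrite ltr_wpDl.
Unshelve. all: by end_near. Qed.

(* The total displacement of the generators of H at x. *)
Let total k (x : M) : R := \sum_(s <- SigmaH) \sum_j `|disp k (incl s) x 0 j|.

Let total_ge0 k x : 0 <= total k x.
Proof. by apply: sumr_ge0 => s _; exact: sumr_ge0. Qed.

Let amplitude k : R := sup (range (total k)).

Let total_le k x : total k x <= amplitude k.
Proof.
apply: ub_le_sup; last by exists x.
have [K [_ KP]] := compact_bounded cM.
have hK (y : M) : `|ambient y| <= K + 1.
  by apply: KP; [rewrite ltrDl|exact: ambientP].
exists (\sum_(s <- SigmaH) \sum_(j < N) ((K + 1) + (K + 1))) => _ [y _ <-].
apply: ler_sum => s _; apply: ler_sum => j _.
apply: le_trans (coord_le_norm _ _ _) _.
by apply: le_trans (ler_normB _ _) _; apply: lerD.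
Qed.

(** Displacements are subadditive along words in the generators, with a constant
    that depends neither on the representation nor on the point. *)
Let disp_amplitude h : exists2 C : R, 0 <= C &
  forall k x, `|disp k (incl h) x| <= C * amplitude k.
Proof.
refine (genH h (K := [set h | exists2 C : R, 0 <= C &
  forall k x, `|disp k (incl h) x| <= C * amplitude k]) _ _) => [|s sS]; last first.
  exists 1 => // k x; rewrite mul1r; apply: le_trans (total_le k x).
  apply: norm_le_coord => // i j; rewrite (ord1 i) /total.
  rewrite (big_rem s)//= (bigD1 j)//= -!addrA lerDl.
  by rewrite addr_ge0// sumr_ge0// => s' _; rewrite sumr_ge0.
split.
- exists 0 => // k x; rewrite multiplicative1 disp1 normr0 mul0r //.
- move=> g g' [C C0 hC] [C' C'0 hC']; exists (C' + C); first exact: addr_ge0.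
  move=> k x; rewrite gmulfM dispM mulrDl.
  by apply: le_trans (ler_normD _ _) _; apply: lerD.
- move=> g [C C0 hC]; exists C => // k x.
  by rewrite multiplicativeV dispV normrN.
Qed.

Let amplitude_gt0 k : 0 < amplitude k.
Proof.
rewrite ltNge; apply/negP => a0; have [g] := rho_nontrivial k; apply.
apply: C1_diffeoP => x /=; apply: ambient_inj.
rewrite ambient_rho (_ : disp _ _ _ = 0) ?subr0//.
have [C C0 hC] := disp_amplitude g.
by apply/normr0_eq0/le_anti; rewrite normr_ge0 (le_trans (hC k x))// mulr_ge0_le0.
Qed.

Let far_point k : exists x : M, amplitude k / 2 < total k x.
Proof.
have [/= _ [x _ <-] h] : exists2 e, range (total k) e & amplitude k - amplitude k / 2 < e.
  apply: sup_adherent; first by rewrite divr_gt0.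
  have [g ng] := rho_nontrivial k; split; last first.
    exists (amplitude k) => _ [x _ <-]; exact: total_le.
  have [x _] : exists x : M, True.
    have [//|nx] := EM (exists x : M, True); exfalso; apply: ng.
    by apply: C1_diffeoP => x; exfalso; apply: nx; exists x.
  by exists (total k x); exists x.
by exists x; move: h; rewrite {1}(splitr (amplitude k)) addrK.
Qed.

Let pt k : M := projT1 (cid (far_point k)).
Let ptP k : amplitude k / 2 < total k (pt k) := projT2 (cid (far_point k)).

Let normalized k h (j : 'I_N) : R := disp k (incl h) (pt k) 0 j / amplitude k.

Let normalized_le C k h j : `|disp k (incl h) (pt k)| <= C * amplitude k ->
  `|normalized k h j| <= C.
Proof.
move=> hC; rewrite normrM normfV (gtr0_norm (amplitude_gt0 k)) ler_pdivrMr//.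
exact: le_trans (coord_le_norm _ _ _) hC.
Qed.

(** The ultralimit of the normalised displacements at the points pt k is a
    homomorphism in each coordinate, is bounded along the orbits of mono, and is
    not zero, since the generators contribute at least 1/2 in total. *)
Lemma no_nontrivial_sequence : False.
Proof.
have [F [FU Foo]] := ultraFilterLemma (F := \oo) _.
have FF : ProperFilter F by exact: ultra_proper.
have lim_ex h (j : 'I_N) : exists l : R, normalized k h j @[k --> F] --> l.
  have [C C0 hC] := disp_amplitude h.
  by apply: (ultra_bounded_cvg (B := C)); apply: Foo; near=> k; exact: normalized_le.
pose L j h : R := projT1 (cid (lim_ex h j)).
have LP j h : normalized k h j @[k --> F] --> L j h := projT2 (cid (lim_ex h j)).
have Ladd j : additive_on (L j).
  move=> g h; apply/eqP; rewrite -subr_eq0; apply/eqP.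
  have c1 : normalized k (g * h)%g j - (normalized k g j + normalized k h j) @[k --> F]
      --> L j (g * h)%g - (L j g + L j h).
    by apply: cvgB; [exact: LP|apply: cvgD; exact: LP].
  suff c2 : normalized k (g * h)%g j - (normalized k g j + normalized k h j) @[k --> F]
      --> (0 : R) by exact: cvg_unique c1 c2.
  apply/cvgrPdist_le => e e0; apply: Foo.
  have [C C0 hC] := disp_amplitude h.
  have eC : 0 < e / (C + 1) by rewrite divr_gt0// ltr_wpDl.
  near=> k; rewrite sub0r normrN /normalized gmulfM dispM mxE.
  rewrite -mulrDl -mulrBl normrM normfV (gtr0_norm (amplitude_gt0 k)) ler_pdivrMr//.
  set y := rho k (incl h) (pt k).
  have -> : disp k (incl h) (pt k) 0 j + disp k (incl g) y 0 j -
      (disp k (incl g) (pt k) 0 j + disp k (incl h) (pt k) 0 j) =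
      (disp k (incl g) y - disp k (incl g) (pt k)) 0 j.
    by rewrite !mxE; ring.
  apply: le_trans (coord_le_norm _ _ _) _.
  have lip : `|disp k (incl g) y - disp k (incl g) (pt k)| <=
      e / (C + 1) * `|ambient y - ambient (pt k)|.
    by move: (y) (pt k); near: k; exact: disp_lipschitz.
  apply: le_trans lip _; rewrite /y (ambient_rho k (incl h) (pt k)) -[X in `|X|]opprB subKr normrN.
  apply: le_trans (ler_wpM2l (ltW eC) (hC k _)) _.
  rewrite mulrA ler_wpM2r ?(ltW (amplitude_gt0 k))//.
  rewrite -mulrA ler_piMr ?(ltW e0)// mulrC ler_pdivrMr ?mul1r ?lerDl//.
  by rewrite ltr_wpDl.
(* conjugation by an element with 1-Lipschitz displacement at most doubles
   displacements *)
have Lorbit j g : exists B : R, forall k l g', iter k mono g' = iter l mono g ->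
    `|L j g'| <= B.
  have [C C0 hC] := disp_amplitude g; exists (2 * C) => p l g' /iter_mono_conj[a aE].
  have c1 : `|normalized k g' j| @[k --> F] --> `|L j g'| by apply: cvg_norm; exact: LP.
  apply: (cvgr_to_le c1); apply: Foo; near=> k.
  apply: normalized_le; rewrite aE !dispM.
  have lip : forall x y, `|disp k a^-1%g x - disp k a^-1%g y| <= 1 * `|ambient x - ambient y|.
    by near: k; exact: disp_lipschitz.
  set x := pt k; set y := rho k a x; set z := rho k (incl g) y.
  have E : disp k a x + disp k a^-1%g y = 0 by rewrite -dispM mulVg disp1.
  have -> : disp k a x + (disp k (incl g) y + disp k a^-1%g z) =
      disp k (incl g) y + (disp k a^-1%g z - disp k a^-1%g y).
    by rewrite -[disp k a x](addrK (disp k a^-1%g y)) E; apply/rowP => i; rewrite !mxE; ring.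
  apply: le_trans (ler_normD _ _) _.
  have zy : `|ambient z - ambient y| <= C * amplitude k.
    by rewrite (ambient_rho k (incl g) y) -[X in `|X|]opprB subKr normrN.
  rewrite -mulrA mulr_natl mulr2n; apply: lerD => //.
  by apply: le_trans (lip _ _) _; rewrite mul1r.
have L0 j h : L j h = 0 by exact: no_bounded_hom (Ladd j) (Lorbit j) h.
have c1 : \sum_(s <- SigmaH) \sum_j `|normalized k s j| @[k --> F] -->
    \sum_(s <- SigmaH) \sum_j `|L j s|.
  apply: cvg_big => [|s _]; first exact: add_continuous.
  apply: cvg_big => [|j _]; first exact: add_continuous.
  by apply: cvg_norm; exact: LP.
have : 2^-1 <= \sum_(s <- SigmaH) \sum_j `|L j s|.
  apply: (cvgr_to_ge c1); apply: nearW => k.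
  have -> : \sum_(s <- SigmaH) \sum_j `|normalized k s j| =
      total k (pt k) / amplitude k.
    rewrite /total mulr_suml; apply: eq_bigr => s _; rewrite mulr_suml.
    by apply: eq_bigr => j _; rewrite normrM normfV (gtr0_norm (amplitude_gt0 k)).
  by rewrite ler_pdivlMr ?amplitude_gt0// mulrC; exact/ltW/ptP.
rewrite big1 => [|s _]; last by rewrite big1// => j _; rewrite L0 normr0.
by rewrite leNgt invr_gt0 ltr0n.
Unshelve. all: by end_near. Qed.
End sequence.

(** Counterexamples in ever smaller neighbourhoods of the trivial representation
    would form a sequence excluded by the preceding lemma. *)
Theorem near_trivial_reps_kill : exists2 e : R, 0 < e & forall rho : hom,
  rep_dist Sigma (trivial_rep M G) rho < e -> forall h, rho (incl h) = 1%g.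
Proof.
have [//|no] := EM (exists2 e : R, 0 < e & forall rho : hom,
  rep_dist Sigma (trivial_rep M G) rho < e -> forall h, rho (incl h) = 1%g).
exfalso.
have bad k : exists rho : hom, rep_dist Sigma (trivial_rep M G) rho < k.+1%:R^-1 /\
    exists h, rho (incl h) <> 1%g.
  have [//|nb] := EM (exists rho : hom,
    rep_dist Sigma (trivial_rep M G) rho < k.+1%:R^-1 /\ exists h, rho (incl h) <> 1%g).
  exfalso; apply: no; exists k.+1%:R^-1 => [|rho small h]; first by rewrite invr_gt0.
  have [//|nh] := EM (rho (incl h) = 1%g); exfalso; apply: nb.
  by exists rho; split=> //; exists h.
have /choice[rho rhoP] := bad.
exact: (no_nontrivial_sequence (fun k => (rhoP k).1) (fun k => (rhoP k).2)).
Qed.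
End rigidity.

(** * Hyperbolic mapping tori *)

Lemma mapping_torus_paths (R : realType) (S : topologicalType)
    (phi : continuousType S S) (s0 : S)
    (c : forall x, {path unit_interval R from s0 to x}) :
  exists d : forall z, {path unit_interval R from fiber R phi s0 to z},
    d (fiber R phi s0) =1 cst (fiber R phi s0).
Proof.
apply: based_path_family => z.
set x := (torus_lift z).1; set u := ival (torus_lift z).2.
have cv : continuous (fun t : unit_interval R => torus_flow phi (x, u * ival t)).
  apply: (continuous_compE _ (@torus_flow_continuous R S phi)).
  apply: (continuous_pairE _ _); first exact: cst_continuous.
  rewrite (_ : (fun t => _) = (fun t : unit_interval R => u * ival t + 0)).
    exact: (continuous_affine _ _ ival_continuous).
  by apply/funext => t; rewrite addr0.
have v0 : torus_flow phi (x, u * ival zero) = fiber R phi x.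
  by rewrite ival0 mulr0 torus_flow0.
have v1 : torus_flow phi (x, u * ival one) = z.
  by rewrite ival1 mulr1 torus_flow_lift.
by exists (concat (fiber R phi \o c x) (mk_path cv v0 v1)).
Qed.

Theorem corollary1p2 (R : realType) (N m : nat) (M : set 'rV[R]_N)
    (q : M -> 'M[R]_N) (S : topologicalType) (phi : continuousType S S)
    (chi : int) (s0 : S) :
  C1_submanifold m M -> compact M -> riemannian_metric q ->
  compact_surface R S -> orientable R S ->
  euler_characteristic R S chi -> chi < 0 ->
  homeomorphism phi ->
  hyperbolic (pullback R 1 phi) ->
  exists U : set {multiplicative fundamental_group R (fiber R phi s0)
                  -> C1_diffeo M},
    C1_nbhs (trivial_rep M (fundamental_group R (fiber R phi s0))) U /\
    forall rho, U rho ->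
      forall g : fundamental_group R s0,
        rho (pi1_map (fiber R phi) g) = 1%g.
Proof.
move=> hM cM _ [hS cS conS charts] _ _ _ [psi phiK psiK] hyp.
have cells := surface_has_cells charts.
have [c c0] := path_connected s0 conS cells.
have [d d0] := mapping_torus_paths phi c.
have [SigmaH genH] := pi1_finitely_generated s0 hS cS conS cells.
pose incl : {multiplicative fundamental_group R s0 ->
  fundamental_group R (fiber R phi s0)} :=
  @pi1_map R S (mapping_torus R phi) (fiber R phi) s0.
pose t := stable_letter c d.
pose Sigma := t :: [seq incl h | h <- SigmaH].
have genG : generates Sigma.
  apply: span_generates.
  have [K1 KM KV] := span_subgroup Sigma.
  apply: (mapping_torus_generated phiK psiK c0 d0 (K := span_set Sigma)).
  - exact: span_subgroup.
  - move=> g; apply: (genH g [set g | span_set Sigma (incl g)]) => [|s sS].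
      split.
      + by rewrite /= multiplicative1.
      + by move=> a b /= Ka Kb; rewrite gmulfM; exact: KM.
      + by move=> a /= Ka; rewrite multiplicativeV; exact: KV.
    by apply: span_mem; rewrite in_cons map_f ?orbT.
  - by apply: span_mem; rewrite mem_head.
have [e e0 kill] := near_trivial_reps_kill hM cM (stable_letter_conj c0 d0)
  genG genH (hyperbolic_no_bounded_hom c0 hyp (monodromy_surj phiK psiK c0)).
exists [set rho | rep_dist Sigma (trivial_rep M _) rho < e]; split.
  by exists Sigma, e.
by move=> rho small g; exact: kill.
Qed.
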